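(* Assume that $h_0:\mathbb{R}\to\mathbb{R}$ is convex and lower semicontinuous and that $\phi_0:\mathbb{R}\to\mathbb{R}$ is continuous and concave. Let $V$ be the value function $$V(t,y)=\inf_{u\in\mathfrak{U}_{t,y}}\Big(\phi(x^{y,u}(T))+\int_t^T h(u(s))\,ds\Big),$$ and let $(x_*,u_* )$ be an optimal pair for the minimization problem defining $V(t,y)$, for given $t\in[0,T]$ and $y\in X$. Then $$u_*(s)\in\partial h^*\big(-B^*\,\partial V(s,x_*(s))\big)\qquad\text{for a.e. } s\in[t,T],$$ where $\partial V(s,\cdot)$ denotes the subdifferential of the function $z\mapsto V(s,z)$; that is, for a.e. $s\in[t,T]$ there is $\eta\in\partial V(s,x_*(s))$ with $u_*(s)\in\partial h^*(-B^*\eta)$.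
   Context: Let $T>0$, $\rho>0$, $R>0$ be constants, let $\Xi\subset\mathbb{R}^2$ be a bounded open set with regular boundary, and let $X=L_2(\Xi)$ with its usual inner product $\langle\cdot,\cdot\rangle$ and norm $|\cdot|$. Let $A$ be the operator $Ay=(\Delta-\rho)y$ on $X$ with Neumann boundary conditions, i.e. with domain $$D(A)=\Big\{v\in H^1(\Xi):\ \Delta v\in L_2(\Xi),\ \int_\Xi \Delta v\,\psi\,d\xi=-\int_\Xi\langle\nabla v,\nabla\psi\rangle\,d\xi\ \text{ for all }\psi\in H^1(\Xi)\Big\}.$$ It is self-adjoint and generates a strongly continuous semigroup $e^{tA}$ on $X$. Let $b:\Xi\to[0,\infty)$ be a bounded measurable function and $B\in\mathcal{L}(X)$ the multiplication operator $(By)(\xi)=b(\xi)y(\xi)$; $B^*$ is its adjoint. For $t\in[0,T]$, $y\in X$ and $u\in L_1([t,T],X)$, $x^{y,u}$ denotes the mild solution on $[t,T]$ of $x'=Ax+Bu$, $x(t)=y$, i.e. $x^{y,u}(s)=e^{(s-t)A}y+\int_t^s e^{(s-r)A}Bu(r)\,dr$. The functions $\phi_0,h_0:\mathbb{R}\to\mathbb{R}$ are such that the following integrals are finite, so that they define functionals $\phi,h_1:X\to\mathbb{R}$: $$\phi(x)=-\int_\Xi\phi_0(x(\xi))\,d\xi,\qquad h_1(u)=\int_\Xi h_0(u(\xi))\,d\xi .$$ Define $h:X\to\mathbb{R}\cup\{+\infty\}$ by $h(u)=h_1(u)$ if $u(\xi)\in[0,R]$ for a.e. $\xi$, and $h(u)=+\infty$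 otherwise. The set of admissible controls $\mathfrak{U}_{t,y}$ is the set of measurable $u:[t,T]\to X$ such that $u(s)(\xi)\in[0,R]$ and $x^{y,u}(s)(\xi)\ge 0$ for a.e. $(s,\xi)\in[t,T]\times\Xi$; the infimum over the empty set is $+\infty$. An optimal pair for $V(t,y)$ is a pair $(x_*,u_* )$ with $u_*\in\mathfrak{U}_{t,y}$ attaining the infimum and $x_*=x^{y,u_*}$. For convex $f:X\to\,]-\infty,+\infty]$, the subdifferential is $\partial f(x)=\{w\in X:\langle x-y,w\rangle\ge f(x)-f(y)\ \forall y\in X\}$, and the conjugate is $f^*(p)=\sup_{x\in X}(\langle p,x\rangle-f(x))$. *)

(* Defs.v *)
From HB Require Import structures.
From mathcomp Require Import all_boot all_order all_algebra.
From mathcomp Require Import all_classical all_reals all_analysis.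
From mathcomp Require Import measurable_realfun lra.

Set Implicit Arguments.
Unset Strict Implicit.
Unset Printing Implicit Defensive.

Import Order.TTheory GRing.Theory Num.Theory.
Import numFieldNormedType.Exports.

Local Open Scope classical_set_scope.
Local Open Scope ring_scope.
Local Open Scope quotient_scope.

Section L2_space.
Context d (T : measurableType d) (R : realType).
Variable mu : {measure set T -> \bar R}.

Local Notation L := (LfunType mu (lee1n 2)).

Definition L2_null : {pred L} := fun f => `[< (f : T -> R) = cst 0 %[ae mu] >].

Lemma L2_null_zmod_closed : zmod_closed L2_null.
Proof.
split; first by rewrite unfold_in; apply/asboolP; apply: filterE => x.
move=> f g; rewrite !unfold_in => /asboolP f0 /asboolP g0; apply/asboolP.
apply: filterS2 f0 g0 => x fx gx Dx.
by transitivity (f x - g x) => //; rewrite fx// gx//= subr0.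
Qed.

HB.instance Definition _ := GRing.isZmodClosed.Build L L2_null
  L2_null_zmod_closed.

(* L_2(mu): square-integrable functions modulo equality mu-a.e. *)
Definition L2 : Type := Quotient.quot L2_null.

HB.instance Definition _ := Choice.on L2.
HB.instance Definition _ := EqQuotient.on L2.
HB.instance Definition _ := GRing.Zmodule.on L2.

Definition L2_fun (x : L2) : T -> R := (repr x : L).
Coercion L2_fun : L2 >-> Funclass.

Definition L2_class (f : L) : L2 := \pi_L2 f.

Lemma L2_classK (x : L2) : L2_class (repr x) = x.
Proof. exact: reprK. Qed.

Lemma L2_class_eqP (f g : L) :
  L2_class f = L2_class g <-> (f : T -> R) = g %[ae mu].
Proof.
apply: (@iff_trans _ (f - g \in L2_null)).
  rewrite (Quotient.idealrBE L2_null).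
  by split=> [h|/eqP//]; apply/eqP.
rewrite unfold_in; split=> [/asboolP|] h; [|apply/asboolP].
  by apply: filterS h => x h Dx; apply/eqP; rewrite -subr_eq0; apply/eqP/h.
apply: filterS h => x h Dx.
by transitivity (f x - g x) => //; rewrite h// subrr.
Qed.

Lemma L2_class_ae (f : L) : (L2_class f : T -> R) = f %[ae mu].
Proof. by apply/L2_class_eqP; rewrite L2_classK. Qed.

Lemma L2_classD (f g : L) : L2_class f + L2_class g = L2_class (f + g).
Proof. by rewrite /L2_class !piE. Qed.

Definition L2_scale (a : R) (x : L2) : L2 := L2_class (a *: (repr x : L)).

Let L2_scale_class a (f : L) : L2_scale a (L2_class f) = L2_class (a *: f).
Proof.
apply/L2_class_eqP; apply: filterS (L2_class_ae f) => x h Dx.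
by congr (a * _); exact: h.
Qed.

Let L2_scaleA a b (x : L2) : L2_scale a (L2_scale b x) = L2_scale (a * b) x.
Proof. by rewrite -[x]L2_classK !L2_scale_class scalerA. Qed.

Let L2_scale1 : left_id 1 L2_scale.
Proof. by move=> x; rewrite -[x]L2_classK L2_scale_class scale1r. Qed.

Let L2_scaleDr : right_distributive L2_scale +%R.
Proof.
move=> a x y; rewrite -[x]L2_classK -[y]L2_classK L2_classD !L2_scale_class.
by rewrite scalerDr L2_classD.
Qed.

Let L2_scaleDl (x : L2) : {morph L2_scale^~ x : a b / a + b}.
Proof.
by move=> a b; rewrite -[x]L2_classK !L2_scale_class scalerDl L2_classD.
Qed.

HB.instance Definition _ := GRing.Zmodule_isLmodule.Build R L2
  L2_scaleA L2_scale1 L2_scaleDr L2_scaleDl.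

Definition L2_norm (x : L2) : R := fine ('N[mu]_2%:E [EFin \o x])%E.

Let L2_norm_class (f : L) :
  L2_norm (L2_class f) = fine ('N[mu]_2%:E [EFin \o f])%E.
Proof.
rewrite /L2_norm unlock; congr (fine (_ `^ _)%E).
have mp (g : L) : 
      measurable_fun setT (fun x => `|(g x)%:E| `^ 2 : \bar R)%E.
  apply: (measurableT_comp (measurable_poweR 2)) => //.
  by apply: measurableT_comp => //; exact/measurable_EFinP.
apply: ae_eq_integral => //.
- exact: (mp (repr (L2_class f))).
- exact: (mp f).
by apply: filterS (L2_class_ae f) => x h Dx /=; rewrite h.
Qed.

Let L2_normD (x y : L2) : L2_norm (x + y) <= L2_norm x + L2_norm y.
Proof.
rewrite -[x]L2_classK -[y]L2_classK L2_classD !L2_norm_class.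
exact: (@ler_LnormD _ _ _ mu _ (lee1n 2)).
Qed.

Let L2_normZ a (x : L2) : L2_norm (a *: x) = `|a| * L2_norm x.
Proof.
rewrite -[x]L2_classK [_ *: _]L2_scale_class !L2_norm_class.
have -> : EFin \o (a *: (repr x : L)) = EFin \o (a \*: (repr x : L)) :> (T -> _).
  by [].
by rewrite (@LnormZ _ _ _ mu _ (lee1n 2)) -(finite_norm_fine (repr x : L)).
Qed.

Let L2_norm0_eq0 (x : L2) : L2_norm x = 0 -> x = 0.
Proof.
rewrite -[x]L2_classK L2_norm_class.
move=> /(@fine_Lnormr_eq0 _ _ _ mu _ (lee1n 2)) h.
have -> : 0 = L2_class (0 : L) by rewrite /L2_class !piE.
exact/L2_class_eqP.
Qed.

HB.instance Definition _ := Lmodule_isNormed.Build R L2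
  L2_normD L2_normZ L2_norm0_eq0.

End L2_space.

Section Hilbert.
Context d (T : measurableType d) (R : realType).
Variable mu : {measure set T -> \bar R}.
Local Notation X := (L2 mu).

Definition dot (x y : X) : R := \int[mu]_xi (x xi * y xi).

(* The class of f in L_2(mu), and 0 when f is not square-integrable. *)
Definition L2_of (f : T -> R) : X :=
  L2_class (insubd (0 : LfunType mu (lee1n 2)) f).

Definition adjoint (A : X -> X) (z : X) : X :=
  xget 0 [set w | forall x, dot (A x) z = dot x w].

Definition conjugate (f : X -> \bar R) (p : X) : \bar R :=
  ereal_sup [set ((dot p x)%:E - f x)%E | x in [set: X]].

(* Subgradients exist only on the effective domain; this avoids the
   meaningless comparison +oo - +oo <= <x - y, w>. *)
Definition subdifferential (f : X -> \bar R) (x : X) : set X :=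
  [set w | f x \is a fin_num /\
           forall y, (f x - f y <= (dot (x - y) w)%:E)%E].

End Hilbert.

Section semigroup.
Context (R : realType) (X : normedModType R).

Definition C0_semigroup (S : R -> X -> X) : Prop :=
  [/\ forall t, 0 <= t -> linear (S t) /\ continuous (S t),
      S 0 = id,
      forall s t, 0 <= s -> 0 <= t -> S (s + t) = S s \o S t
    & forall x, S t x @[t --> 0^'+] --> x].

Definition generator (S : R -> X -> X) (v w : X) : Prop :=
  h^-1 *: (S h v - v) @[h --> 0^'+] --> w.

End semigroup.

Section Bochner.
Context d (T : measurableType d) (R : realType) (X : normedModType R).
Variable mu : {measure set T -> \bar R}.

Definition borel : Type := g_sigma_algebraType (@open X).
HB.instance Definition _ := Measurable.on borel.

Definition borel_fun (D : set T) (f : T -> X) : Prop :=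
  measurable_fun D (f : T -> borel).

(* A step function is encoded by the list of its pairs (set, value); the
   sets may overlap. *)
Definition step_fun (s : seq (set T * X)) (x : T) : X :=
  \sum_(p <- s) (\1_(p.1) x : R) *: p.2.

Definition step_int (s : seq (set T * X)) : X :=
  \sum_(p <- s) fine (mu p.1) *: p.2.

Definition is_bochner_integral (D : set T) (f : T -> X) (w : X) : Prop :=
  borel_fun D f /\
  exists s : nat -> seq (set T * X),
    [/\ forall n p, p \in s n ->
          [/\ measurable p.1, p.1 `<=` D & (mu p.1 < +oo)%E],
        (\int[mu]_(x in D) (`|f x - step_fun (s n) x|)%:E)%E
          @[n --> \oo] --> 0%E
      & step_int (s n) @[n --> \oo] --> w].

Definition bochner_integral (D : set T) (f : T -> X) : X :=
  xget 0 (is_bochner_integral D f).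

End Bochner.

(* The plane with its Borel sets; as a bare type it is R * R, whose topology
   and normed structure are used for everything not measure-theoretic. *)
Notation plane R := (measurableTypeR R * measurableTypeR R)%type.

Section domain.
Context (R : realType).
Implicit Types (Xi : set (R * R)) (psi : R * R -> R).

Lemma open_measurable_plane Xi : open Xi -> measurable (Xi : set (plane R)).
Proof.
move=> oXi.
pose box (q : (rat * rat) * (rat * rat)) : set (plane R) :=
  `]ratr q.1.1, ratr q.1.2[ `*` `]ratr q.2.1, ratr q.2.2[.
have -> : Xi = \bigcup_q (if `[< box q `<=` Xi >] then box q else set0).
  apply/seteqP; split=> [[x1 x2] Xix|x [q _]]; last by case: asboolP => // /[apply].
  have [e /= e0 eXi] : exists2 e : R, 0 < e & ball ((x1, x2) : R * R) e `<=` Xi.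
    by have /nbhs_ballP[e e0 ?] := open_nbhs_nbhs (conj oXi Xix); exists e.
  have lte (y : R) : y - e < y /\ y < y + e by split; lra.
  have [/rat_in_itvoo[a1 Ha1] /rat_in_itvoo[c1 Hc1]] := lte x1.
  have [/rat_in_itvoo[a2 Ha2] /rat_in_itvoo[c2 Hc2]] := lte x2.
  exists ((a1, c1), (a2, c2)) => //.
  move: Ha1 Hc1 Ha2 Hc2; rewrite !in_itv/=.
  move=> /andP[? ?] /andP[? ?] /andP[? ?] /andP[? ?].
  case: asboolP => [_|[]]; first by split; rewrite /= in_itv/=; apply/andP; split.
  move=> [z1 z2] []; rewrite /= !in_itv/= => /andP[? ?] /andP[? ?].
  by apply: eXi; split; rewrite /ball/= ltr_norml; apply/andP; split; lra.
apply: countable_bigcupT_measurable => [|q]; first exact: countableP.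
by case: ifPn => // _; apply: measurableX; exact: measurable_itv.
Qed.

Definition smooth psi : Prop :=
  forall vs : seq (R * R), let g := foldr (fun v f => 'D_v f) psi vs in
    continuous g /\ forall x v, derivable g x v.

Definition test_function Xi psi : Prop :=
  [/\ smooth psi, compact (closure (psi @^-1` [set~ 0]))
    & closure (psi @^-1` [set~ 0]) `<=` Xi].

(* Near each boundary point, and in suitable Cartesian coordinates, Xi is the
   part of the plane lying above the graph of a function of class C^1. *)
Definition regular_boundary Xi : Prop :=
  forall z : R * R, (closure Xi `\` Xi°) z ->
  exists (a b r : R) (gamma : R -> R),
    [/\ a ^+ 2 + b ^+ 2 = 1, 0 < r,
        (forall x, derivable gamma x 1) /\ continuous (derive1 gamma)
      & forall x : R * R, ball z r x ->
          (Xi x <-> gamma (a * x.1 + b * x.2) < - b * x.1 + a * x.2)].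

Variables (Xi : set (R * R)) (Xi_open : open Xi).

Definition domain_measure : set (plane R) -> \bar R :=
  mrestr (@lebesgue_measure R \x @lebesgue_measure R)%E
    (open_measurable_plane Xi_open).

HB.instance Definition _ := Measure.on domain_measure.

(* L_2(Xi): functions are defined on the whole plane, but the measure does not
   see their values outside Xi. *)
Local Notation mu := domain_measure.
Local Notation X := (L2 mu).

Definition weak_gradient (v : X) (g : X * X) : Prop :=
  forall psi, test_function Xi psi ->
    (\int[mu]_xi (v xi * 'D_((1, 0) : R * R) psi xi) =
       - \int[mu]_xi (g.1 xi * psi xi)) /\
    (\int[mu]_xi (v xi * 'D_((0, 1) : R * R) psi xi) =
       - \int[mu]_xi (g.2 xi * psi xi)).

Definition laplacian psi : R * R -> R := fun xi =>
  'D_((1, 0) : R * R) ('D_((1, 0) : R * R) psi) xi +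
  'D_((0, 1) : R * R) ('D_((0, 1) : R * R) psi) xi.

Definition weak_laplacian (v w : X) : Prop :=
  forall psi, test_function Xi psi ->
    \int[mu]_xi (v xi * laplacian psi xi) = \int[mu]_xi (w xi * psi xi).

(* Graph of the Neumann Laplacian: v is in H^1, Delta v = w is in L_2, and
   Green's formula holds against every k in H^1. *)
Definition neumann_laplacian (v w : X) : Prop :=
  exists g, [/\ weak_gradient v g, weak_laplacian v w
    & forall k gk, weak_gradient k gk ->
        dot w k = - (dot g.1 gk.1 + dot g.2 gk.2)].

(* Graph of A = Delta - rho. *)
Definition neumann_operator (rho : R) (v z : X) : Prop :=
  exists w, neumann_laplacian v w /\ z = w - rho *: v.

Definition neumann_semigroup (rho : R) (S : R -> X -> X) : Prop :=
  C0_semigroup S /\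
  forall v z, generator S v z <-> neumann_operator rho v z.

Definition mult_op (b : R * R -> R) (y : X) : X :=
  L2_of mu (fun xi : plane R => (b \_ Xi) xi * y xi).

End domain.

Arguments mult_op {R Xi} Xi_open b y.

Section control.
Context d (E : measurableType d) (R : realType).
Variable mu : {measure set E -> \bar R}.
Local Notation X := (L2 mu).
Local Notation leb := (@lebesgue_measure R).

Variables (T U : R).
Variables (S : R -> X -> X) (B : X -> X) (phi0 h0 : R -> R).

Definition mild (t : R) (y : X) (u : R -> X) (s : R) : X :=
  S (s - t) y +
  bochner_integral leb `[t, s] (fun r => S (s - r) (B (u r))).

Definition phi (x : X) : R := - \int[mu]_xi phi0 (x xi).

Definition h1 (u : X) : R := \int[mu]_xi h0 (u xi).

Definition in_range (u : X) : Prop := \forall xi \ae mu, 0 <= u xi <= U.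

Definition h_ext (u : X) : \bar R := if `[< in_range u >] then (h1 u)%:E else +oo%E.

(* The constraints hold for a.e. s and then for a.e. xi, which by Fubini
   amounts to a.e. (s, xi): elements of X are classes of functions of xi. *)
Definition admissible (t : R) (y : X) (u : R -> X) : Prop :=
  borel_fun (`[t, T] : set (measurableTypeR R)) u /\
  \forall s \ae leb, s \in `[t, T] ->
    in_range (u s) /\ \forall xi \ae mu, 0 <= mild t y u s xi.

Definition cost (t : R) (y : X) (u : R -> X) : \bar R :=
  ((phi (mild t y u T))%:E + \int[leb]_(s in `[t, T]) h_ext (u s))%E.

Definition value (t : R) (y : X) : \bar R :=
  ereal_inf [set cost t y u | u in admissible t y].

Definition optimal_pair (t : R) (y : X) (x u : R -> X) : Prop :=
  [/\ admissible t y u, cost t y u = value t y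
    & forall s, s \in `[t, T] -> x s = mild t y u s].

End control.

(* Main.v *)
Require Import Defs.
From HB Require Import structures.
From mathcomp Require Import all_boot all_order all_algebra.
From mathcomp Require Import all_classical all_reals all_analysis.
From mathcomp Require Import measurable_realfun ring lra.

(** The proof compares the optimal control u_opt with all other controls after
    an arbitrary displacement z of the final state.  The function
      F z = inf_u (phi (x_u T + z) + \int_t^T h_1 (u s) ds),
    the infimum being over all Borel controls with values in the range, is
    convex, since x_u depends affinely on u and phi, h_1 are convex; it is
    finite, and bounded above near every point.  Hence it has a subgradient p at
    0 ([convex_subgradient]), and as u_opt attains F 0, for all u and z
      phi (x_opt T) + \int h_1 (u_opt) + <p, z> <= phi (x_u T + z) + \int h_1 (u).
    Both halves of the conclusion are instances of this single inequality, with
    the costate eta s = (e^{(T - s) A})^* p.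

    For the subgradient of the value function at time s, let u follow u_opt up to
    s and any control v afterwards, and take z = e^{(T - s) A} (z' - x_opt s):
    then x_u T + z is the final state reached from z' at time s with v, and
    <p, z> = <eta s, z' - x_opt s> ([tail_subgradient]).  For the inclusion in the
    subdifferential of the conjugate, take z = x_opt T - x_u T: the terminal costs
    cancel, and u_opt minimizes the integral of h_1 w + <e^{(T - s) A} B w, p>.
    Replacing u_opt by a constant v exactly where this lowers the integrand shows
    that u_opt s minimizes it over a countable dense set of values v for almost
    every s, thus over all values by continuity ([maximum_principle]).  This is
    the Fenchel characterization of u_opt s as a subgradient of the conjugate of h
    at - B^* eta s.

    These variations need controls that are free of the state constraint.  It
    holds for all of them: b >= 0, the semigroup preserves the cone of nonnegative
    functions, and y >= 0 because x_opt s >= 0 for s arbitrarily close to t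
    ([initial_nonneg]).  Positivity and contractivity of the semigroup come from
    <A v, v> <= 0 and <A v, min (v, 0)> <= 0: along an orbit starting in the
    domain, the squared norms of x and of min (x, 0) have a nonpositive upper
    derivative, and the domain is dense ([lyapunov]).  The second inequality tests
    Green's formula with a smooth substitute of min (v, 0), which needs the chain
    rule for weak derivatives ([chain_rule]).  It is obtained from difference
    quotients: tested against psi k with psi a test function, those of v are
    bounded by |g| |psi k| and converge to <g, psi k>.  Both facts are first
    proved for smooth k, where they concern the test function psi k, and extend
    to square-integrable k by density ([smooth_dense]).

    Three tools run through the text.  Norm convergence in L_2 is reduced to
    pointwise convergence along fast Cauchy sequences ([L2_cvg_fast],
    [L2_dominate]), which gives completeness and the continuity of convex
    integral functionals.  Orthogonal projection is never used: representation of
    linear functionals and adjoints come from the existence of subgradients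
    ([riesz], [adjointP]).  Vector-valued integrals enter only through their scalar
    products with fixed vectors ([dot_bochner]). *)

Set Implicit Arguments.
Unset Strict Implicit.
Unset Printing Implicit Defensive.

Import Order.TTheory GRing.Theory Num.Theory.
Import numFieldNormedType.Exports.

Local Open Scope classical_set_scope.
Local Open Scope ring_scope.

(** * The Hilbert space of square-integrable classes *)

Section L2_basics.
Context d (T : measurableType d) (R : realType).
Variable mu : {measure set T -> \bar R}.
Local Notation X := (L2 mu).
Implicit Types x y z : X.

Lemma L2_measurable x : measurable_fun setT (x : T -> R).
Proof. by have := LfunP (repr x : LfunType mu (lee1n 2)); rewrite inE => /andP[/set_mem]. Qed.

Lemma L2_integrableM x y : mu.-integrable setT (EFin \o (fun xi => x xi * y xi)).
Proof.
apply/Lfun1_integrable.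
exact: (Lfun2_mul_Lfun1 (LfunP (repr x)) (LfunP (repr y))).
Qed.

Lemma L2_eqP x y : x = y <-> \forall xi \ae mu, x xi = y xi.
Proof.
rewrite -{1}[x]L2_classK -{1}[y]L2_classK; split.
  by move/L2_class_eqP; apply: filterS => xi; apply.
by move=> h; apply/L2_class_eqP; apply: filterS h.
Qed.

Lemma L2_zeroE : \forall xi \ae mu, L2_fun (0 : X) xi = 0.
Proof.
have e : (0 : X) = L2_class (0 : LfunType mu (lee1n 2)) by rewrite /L2_class !piE.
by apply: filterS (L2_class_ae (0 : LfunType mu (lee1n 2))) => xi /(_ I); rewrite -e.
Qed.

Lemma L2_addE x y : \forall xi \ae mu, L2_fun (x + y) xi = x xi + y xi.
Proof.
have e : x + y = L2_class (repr x + repr y) by rewrite -L2_classD !L2_classK.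
by apply: filterS (L2_class_ae (repr x + repr y)) => xi /(_ I); rewrite -e.
Qed.

Lemma L2_scaleE a x : \forall xi \ae mu, L2_fun (a *: x) xi = a * x xi.
Proof. by apply: filterS (L2_class_ae (a *: (repr x : LfunType mu (lee1n 2)))) => xi /(_ I). Qed.

Lemma L2_oppE x : \forall xi \ae mu, L2_fun (- x) xi = - x xi.
Proof. by apply: filterS (L2_scaleE (-1) x) => xi; rewrite scaleN1r mulN1r. Qed.

Lemma L2_subE x y : \forall xi \ae mu, L2_fun (x - y) xi = x xi - y xi.
Proof. by apply: filterS2 (L2_addE x (- y)) (L2_oppE y) => xi -> ->. Qed.

Lemma square_Lfun (f : T -> R) : measurable_fun setT f ->
  mu.-integrable setT (EFin \o (fun xi => f xi ^+ 2)) -> f \in Lfun mu 2%:E.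
Proof.
move=> mf /integrableP[_ fi]; rewrite inE; apply/andP; split; first exact/mem_set.
apply/mem_set; rewrite /finite_norm unlock; apply: poweR_lty.
apply: le_lt_trans fi; rewrite le_eqVlt; apply/orP; left; apply/eqP.
by apply: eq_integral => xi _ /=; rewrite powR_mulrn// normrX.
Qed.

Lemma L2_ofE (f : T -> R) : measurable_fun setT f ->
  mu.-integrable setT (EFin \o (fun xi => f xi ^+ 2)) ->
  \forall xi \ae mu, L2_of mu f xi = f xi.
Proof.
move=> mf fi; have fL := square_Lfun mf fi.
apply: filterS (L2_class_ae (insubd (0 : LfunType mu (lee1n 2)) f)) => xi /(_ I).
rewrite /L2_of => ->.
by have -> // : (insubd (0 : LfunType mu (lee1n 2)) f : T -> R) = f;
  exact: (insubdK _ fL).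
Qed.

Lemma dot_integral x y : (dot x y)%:E = (\int[mu]_xi (x xi * y xi)%:E)%E.
Proof.
rewrite /dot /Rintegral fineK//.
by apply: integrable_fin_num => //; exact: L2_integrableM.
Qed.

Lemma L2_normE x : `|x| ^+ 2 = dot x x.
Proof.
apply: EFin_inj; rewrite dot_integral.
have nx : ('N[mu]_2%:E[EFin \o x])%E = `|x|%:E.
  by rewrite -(finite_norm_fine (repr x : LfunType mu (lee1n 2))).
have := powR_Lnorm mu (EFin \o x) (r := 2).
rewrite pnatr_eq0 => /(_ isT).
rewrite nx poweR_EFin powR_mulrn// => ->.
apply: eq_integral => xi _ /=.
by rewrite powR_mulrn// -normrX ger0_norm ?sqr_ge0// expr2.
Qed.

Lemma eq_Rintegral_ae (f g : T -> R) : measurable_fun setT f ->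
  measurable_fun setT g -> (\forall xi \ae mu, f xi = g xi) ->
  \int[mu]_xi f xi = \int[mu]_xi g xi.
Proof.
move=> mf mg fg; congr fine; apply: ae_eq_integral => //.
- exact/measurable_EFinP.
- exact/measurable_EFinP.
- by apply: filterS fg => xi /= -> _.
Qed.

Lemma measurable_L2M x y : measurable_fun setT (fun xi => x xi * y xi).
Proof. by apply: measurable_funM; exact: L2_measurable. Qed.

Lemma dotC x y : dot x y = dot y x.
Proof. by apply: eq_Rintegral => xi _; rewrite mulrC. Qed.

Lemma dotDl x y z : dot (x + y) z = dot x z + dot y z.
Proof.
rewrite /dot -RintegralD//; try exact: L2_integrableM.
apply: eq_Rintegral_ae; first exact: measurable_L2M.
  by apply: measurable_funD; exact: measurable_L2M.
by apply: filterS (L2_addE x y) => xi ->; rewrite mulrDl.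
Qed.

Lemma dotZl a x z : dot (a *: x) z = a * dot x z.
Proof.
rewrite /dot -RintegralZl//; try exact: L2_integrableM.
apply: eq_Rintegral_ae; first exact: measurable_L2M.
  by apply: measurable_funM => //; exact: measurable_L2M.
by apply: filterS (L2_scaleE a x) => xi ->; rewrite mulrA.
Qed.

Lemma dotDr x y z : dot x (y + z) = dot x y + dot x z.
Proof. by rewrite dotC dotDl !(dotC x). Qed.
Lemma dotZr a x y : dot x (a *: y) = a * dot x y.
Proof. by rewrite dotC dotZl (dotC x). Qed.
Lemma dotNl x y : dot (- x) y = - dot x y.
Proof. by rewrite -scaleN1r dotZl mulN1r. Qed.
Lemma dotNr x y : dot x (- y) = - dot x y.
Proof. by rewrite dotC dotNl dotC. Qed.
Lemma dotBl x y z : dot (x - y) z = dot x z - dot y z.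
Proof. by rewrite dotDl dotNl. Qed.
Lemma dotBr x y z : dot x (y - z) = dot x y - dot x z.
Proof. by rewrite dotDr dotNr. Qed.
Lemma dot0l x : dot 0 x = 0.
Proof. by rewrite -(scale0r (0 : X)) dotZl mul0r. Qed.
Lemma dot0r x : dot x 0 = 0.
Proof. by rewrite dotC dot0l. Qed.

Lemma normD2 x y : `|x + y| ^+ 2 = `|x| ^+ 2 + 2 * dot x y + `|y| ^+ 2.
Proof. rewrite !L2_normE dotDl !dotDr (dotC y x); ring. Qed.

Lemma normB2 x y : `|x - y| ^+ 2 = `|x| ^+ 2 - 2 * dot x y + `|y| ^+ 2.
Proof. by rewrite normD2 dotNr normrN mulrN. Qed.

Lemma cauchy_schwarz x y : `|dot x y| <= `|x| * `|y|.
Proof.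
have [->|y0] := eqVneq y 0; first by rewrite dot0r normr0 mulr_ge0.
have y0' : 0 < `|y| by rewrite normr_gt0.
have h (s : R) : s * dot x y * 2 <= `|x| ^+ 2 + s ^+ 2 * `|y| ^+ 2.
  have := sqr_ge0 `|x - s *: y|.
  rewrite normB2 dotZr normrZ exprMn real_normK ?num_real//; lra.
have := h (dot x y / `|y| ^+ 2).
have -> : dot x y / `|y| ^+ 2 * dot x y * 2 = 2 * (dot x y ^+ 2 / `|y| ^+ 2) by field; lra.
have -> : (dot x y / `|y| ^+ 2) ^+ 2 * `|y| ^+ 2 = dot x y ^+ 2 / `|y| ^+ 2.
  by field; lra.
move=> hh.
have {hh} : dot x y ^+ 2 / `|y| ^+ 2 <= `|x| ^+ 2 by lra.
rewrite ler_pdivrMr ?exprn_gt0// -exprMn => hh.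
by rewrite -(ler_pXn2r (n := 2))// ?nnegrE// ?mulr_ge0// real_normK ?num_real.
Qed.

Lemma dot_le x y : dot x y <= `|x| * `|y|.
Proof. exact: le_trans (ler_norm _) (cauchy_schwarz x y). Qed.

Lemma dot_inj x y : (forall z, dot x z = dot y z) -> x = y.
Proof.
move=> h; apply/eqP; rewrite -subr_eq0 -normr_eq0 -sqrf_eq0 L2_normE.
by rewrite dotBl h subrr.
Qed.

End L2_basics.

Section L2_order.
Context d (T : measurableType d) (R : realType).
Variable mu : {measure set T -> \bar R}.
Local Notation X := (L2 mu).
Implicit Types x y z : X.

Lemma measurable_sqr (f : T -> R) : measurable_fun setT f ->
  measurable_fun setT (EFin \o (fun xi => f xi ^+ 2)).
Proof. by move=> mf; apply/measurable_EFinP; exact: measurable_funX. Qed.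

Lemma L2_integrable_sqr x : mu.-integrable setT (EFin \o (fun xi => x xi ^+ 2)).
Proof. exact: L2_integrableM. Qed.

Lemma ae_le_integrable (f g : T -> R) : measurable_fun setT f ->
  mu.-integrable setT (EFin \o g) ->
  (\forall xi \ae mu, `|f xi| <= `|g xi|) -> mu.-integrable setT (EFin \o f).
Proof.
move=> mf /integrableP[mg gi] fg; apply/integrableP; split.
  exact/measurable_EFinP.
apply: le_lt_trans gi; apply: ae_ge0_le_integral => //.
- by apply: measurableT_comp => //; exact/measurable_EFinP.
- by apply: measurableT_comp.
- by apply: filterS fg => xi h _ /=; rewrite lee_fin.
Qed.

Lemma L2_ofE_le (f : T -> R) (y : X) : measurable_fun setT f ->
  (\forall xi \ae mu, `|f xi| <= `|y xi|) ->
  \forall xi \ae mu, L2_of mu f xi = f xi.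
Proof.
move=> mf fy; apply: L2_ofE => //.
apply: (ae_le_integrable _ (L2_integrable_sqr y)); first exact: measurable_funX.
apply: filterS fy => xi h.
by rewrite !normrX ler_pXn2r// nnegrE.
Qed.

Lemma L2_norm_le x y : (\forall xi \ae mu, `|x xi| <= `|y xi|) -> `|x| <= `|y|.
Proof.
move=> xy; rewrite -(ler_pXn2r (n := 2))// ?nnegrE// !L2_normE.
rewrite -lee_fin !dot_integral; apply: ae_ge0_le_integral => //.
- by move=> xi _; rewrite lee_fin -expr2 sqr_ge0.
- by apply: measurable_sqr; exact: L2_measurable.
- by move=> xi _; rewrite lee_fin -expr2 sqr_ge0.
- by apply: measurable_sqr; exact: L2_measurable.
apply: filterS xy => xi h _; rewrite lee_fin -!expr2.
by rewrite -[x xi ^+ 2]real_normK ?num_real// -[y xi ^+ 2]real_normK ?num_real// ler_pXn2r// nnegrE.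
Qed.

Definition L2_abs x : X := L2_of mu (fun xi => `|x xi|).

Lemma L2_absE x : \forall xi \ae mu, L2_abs x xi = `|x xi|.
Proof.
apply: (@L2_ofE_le _ x); first by apply: measurableT_comp => //; exact: L2_measurable.
by apply: filterE => xi; rewrite normr_id.
Qed.

Lemma L2_norm_abs x : `|L2_abs x| = `|x|.
Proof.
apply/eqP; rewrite eq_le; apply/andP; split; apply: L2_norm_le;
  by apply: filterS (L2_absE x) => xi ->; rewrite normr_id.
Qed.

Lemma L2_sumE (z : nat -> X) N :
  \forall xi \ae mu, L2_fun (\sum_(n < N) z n) xi = \sum_(n < N) z n xi.
Proof.
elim: N => [|N IH].
  by apply: filterS (L2_zeroE mu) => xi; rewrite !big_ord0.
apply: filterS2 IH (L2_addE (\sum_(n < N) z n) (z N)) => xi.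
by rewrite !big_ord_recr /= => -> ->.
Qed.

(** The partial sums of |z_n| increase and are bounded in norm, so by monotone
    convergence their pointwise limit is square-integrable.  This turns smallness
    in norm into a pointwise bound common to a whole sequence. *)
Lemma L2_dominate (z : nat -> X) : (forall n, `|z n| <= (2^-1) ^+ n) ->
  exists2 Z : X, `|Z| <= 2 &
    \forall xi \ae mu, forall N, \sum_(n < N) `|z n xi| <= Z xi.
Proof.
move=> hz.
pose f N xi : R := \sum_(n < N) `|z n xi|.
have f_ge0 N xi : 0 <= f N xi by apply: sumr_ge0.
have f_mono xi : {homo f^~ xi : m n / (m <= n)%N >-> m <= n}.
  apply: homo_leq => // [a b c ab bc|n]; first exact: le_trans bc.
  by rewrite /f big_ord_recr /= lerDl.
have mf N : measurable_fun setT (f N).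
  elim: N => [|N IH].
    have -> : f 0%N = cst 0 by apply/funext => xi; rewrite /f big_ord0.
    exact: measurable_cst.
  have -> : f N.+1 = (fun xi => f N xi + `|z N xi|).
    by apply/funext => xi; rewrite /f big_ord_recr.
  apply: measurable_funD => //; apply: measurableT_comp => //; exact: L2_measurable.
pose g N xi : \bar R := (f N xi ^+ 2)%:E.
have g_ge0 N xi : (0 <= g N xi)%E by rewrite lee_fin sqr_ge0.
have g_mono xi : {homo g^~ xi : m n / (m <= n)%N >-> (m <= n)%E}.
  by move=> m n mn; rewrite lee_fin ler_pXn2r// ?nnegrE// f_mono.
have mg N : measurable_fun setT (g N) by apply: measurable_sqr.
have fW N : \forall xi \ae mu, L2_fun (\sum_(n < N) L2_abs (z n)) xi = f N xi.
  apply: filterS2 (L2_sumE (L2_abs \o z) N) (ae_foralln (fun n => L2_absE (z n))).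
  by move=> xi /= -> h; apply: eq_bigr => i _; rewrite h.
have Wle N : `|\sum_(n < N) L2_abs (z n)| <= 2.
  apply: (le_trans (ler_norm_sum _ _ _)).
  apply: (@le_trans _ _ (\sum_(n < N) (2^-1) ^+ n)).
    by apply: ler_sum => i _; rewrite L2_norm_abs.
  have h M : \sum_(n < M) (2^-1) ^+ n = 2 - 2 * (2^-1) ^+ M :> R.
    elim: M => [|M IH]; first by rewrite big_ord0 expr0; lra.
    by rewrite big_ord_recr /= IH exprS; lra.
  by rewrite h gerBl mulr_ge0 ?exprn_ge0 ?invr_ge0.
have gle N : (\int[mu]_xi g N xi <= 4%:E)%E.
  have -> : (\int[mu]_xi g N xi = (`|\sum_(n < N) L2_abs (z n)| ^+ 2)%:E)%E.
    rewrite L2_normE dot_integral; apply: ae_eq_integral => //.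
    - by apply: measurable_sqr; exact: L2_measurable.
    - by apply: filterS (fW N) => xi h _; rewrite /g h.
  by rewrite lee_fin; have := Wle N; have := normr_ge0 (\sum_(n < N) L2_abs (z n)); nra.
have gcvg xi : cvgn (g^~ xi) by apply: ereal_nondecreasing_is_cvgn.
pose G xi := limn (g^~ xi).
have mG : measurable_fun setT G.
  by apply: (emeasurable_fun_cvg g) => // xi _; exact: gcvg.
have G_ge0 xi : (0 <= G xi)%E by apply: lime_ge => //; apply: nearW => n; exact: g_ge0.
have Gle : (\int[mu]_xi G xi <= 4%:E)%E.
  rewrite /G (monotone_convergence mu)//.
  apply: lime_le; last by apply: nearW => n; exact: gle.
  apply: ereal_nondecreasing_is_cvgn => m n mn.
  by apply: ge0_le_integral => // xi _; exact: g_mono.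
have Gint : mu.-integrable setT G.
  apply/integrableP; split => //.
  rewrite (le_lt_trans _ (ltry 4))// (le_trans _ Gle)//.
  by apply/ge0_le_integral => //; [exact: measurableT_comp | move=> xi _; rewrite gee0_abs].
have Gfin := integrable_ae measurableT Gint.
pose Zf xi := Num.sqrt (fine (G xi)).
have mZ : measurable_fun setT Zf.
  have ms : measurable_fun [set: R] (@Num.sqrt R).
    by apply: continuous_measurable_fun; exact: sqrt_continuous.
  by apply: (measurableT_comp ms); exact: measurableT_comp.
have ZG : \forall xi \ae mu, (Zf xi ^+ 2)%:E = G xi.
  apply: filterS Gfin => xi /(_ I) h.
  by rewrite /Zf sqr_sqrtr ?fine_ge0// fineK.
have iZ : mu.-integrable setT (EFin \o (fun xi => Zf xi ^+ 2)).
  apply/integrableP; split; first exact: measurable_sqr.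
  rewrite (le_lt_trans _ (ltry 4))// (le_trans _ Gle)//.
  apply: ae_ge0_le_integral => //; first by apply: measurableT_comp => //; exact: measurable_sqr.
  by apply: filterS ZG => xi <- _ /=; rewrite ger0_norm ?sqr_ge0.
have ZE := L2_ofE mZ iZ.
exists (L2_of mu Zf).
  rewrite -(ler_pXn2r (n := 2))// ?nnegrE// L2_normE -lee_fin dot_integral.
  apply: le_trans (_ : 4%:E <= _)%E; last by rewrite lee_fin; lra.
  apply: le_trans Gle.
  apply: ae_ge0_le_integral => //.
  - by move=> xi _; rewrite lee_fin -expr2 sqr_ge0.
  - by apply: measurable_sqr; exact: L2_measurable.
  - by apply: filterS2 ZE ZG => xi -> <- _; rewrite expr2.
apply: filterS3 ZE ZG Gfin => xi -> h /(_ I) fin N.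
rewrite -(ler_pXn2r (n := 2))// ?nnegrE ?sqrtr_ge0//; last exact: (f_ge0 N xi).
rewrite -lee_fin h.
rewrite /G; have /cvg_lim -> // := ereal_nondecreasing_cvgn (g_mono xi).
by apply: ereal_sup_ubound; exists N.
Qed.

End L2_order.

Section L2_complete.
Context d (T : measurableType d) (R : realType).
Variable mu : {measure set T -> \bar R}.
Local Notation X := (L2 mu).
Implicit Types x y z : X.

(** Riesz-Fischer: the increments, multiplied by 2^n, are dominated by a fixed
    function, which makes the sequence converge almost everywhere and controls the
    distance to the pointwise limit at the rate 2^-n. *)
Lemma L2_cvg_fast (x : nat -> X) :
  (forall n, `|x n.+1 - x n| <= (2^-1) ^+ n) ->
  exists l : X, forall n, `|l - x n| <= 2 * (2^-1) ^+ n.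
Proof.
move=> hx.
have half0 n : 0 < (2^-1) ^+ n :> R by rewrite exprn_gt0.
pose z n k : X := 2 ^+ n *: (x (n + k).+1 - x (n + k)%N).
have hz n k : `|z n k| <= (2^-1) ^+ k.
  rewrite normrZ ger0_norm ?exprn_ge0//.
  rewrite (le_trans (ler_wpM2l _ (hx (n + k)%N))) ?exprn_ge0//.
  by rewrite exprD mulrA -exprMn mulfV// expr1n mul1r.
have [Z /all_and2 [Z2 hZ]] := choice (fun n =>
  match L2_dominate (hz n) with ex_intro2 Z a b => ex_intro _ Z (conj a b) end).
have xE : \forall xi \ae mu, forall n, L2_fun (x n.+1 - x n) xi = x n.+1 xi - x n xi.
  by apply: ae_foralln => n; exact: L2_subE.
have zE : \forall xi \ae mu, forall n k, z n k xi = 2 ^+ n * L2_fun (x (n + k).+1 - x (n + k)%N) xi.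
  by apply: ae_foralln => n; apply: ae_foralln => k; exact: L2_scaleE.
have step : \forall xi \ae mu, forall n k, `|x (n + k)%N xi - x n xi| <= (2^-1) ^+ n * Z n xi.
  apply: filterS3 (ae_foralln hZ) xE zE => xi h1 h2 h3 n k.
  have := h1 n k; have : 0 < (2^-1) ^+ n :> R by [].
  move=> /ler_pM2l /(_ (\sum_(i < k) `|z n i xi|) (Z n xi)) <-.
  apply: le_trans; rewrite mulr_sumr.
  elim: k => [|k IH]; first by rewrite addn0 subrr normr0 big_ord0.
  rewrite big_ord_recr /= h3 h2 normrM ger0_norm ?exprn_ge0// mulrA -exprMn mulVf//.
  rewrite expr1n mul1r addnS.
  have -> : x (n + k).+1 xi - x n xi =
    (x (n + k)%N xi - x n xi) + (x (n + k).+1 xi - x (n + k)%N xi) by ring.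
  by rewrite (le_trans (ler_normD _ _))// lerD2r.
have cv : \forall xi \ae mu, cvgn (fun n => x n xi).
  apply: filterS3 (ae_foralln hZ) xE zE => xi h1 h2 h3.
  have sE n : x n xi = x 0%N xi + series (fun k => x k.+1 xi - x k xi) n.
    rewrite /series /= telescope_sumr ?leq0n//; ring.
  have -> : (fun n => x n xi) = (fun n => x 0%N xi + series (fun k => x k.+1 xi - x k xi) n).
    by apply/funext.
  apply: is_cvgD; first exact: is_cvg_cst.
  apply: normed_cvg; apply: nondecreasing_is_cvgn.
    by apply: nondecreasing_series => k _ _ /=; exact: normr_ge0.
  exists (Z 0%N xi) => _ [n _ <-].
  apply: (le_trans _ (h1 0%N n)); rewrite [leLHS]/series /= big_mkord.
  by apply: ler_sum => i _; rewrite h3 h2 expr0 mul1r add0n.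
(* the upper limit is measurable and agrees with the limit wherever there is one *)
pose lf xi := fine (limn_esup (fun n => (x n xi)%:E)).
have mlf : measurable_fun setT lf.
  apply: measurableT_comp => //.
  by apply: measurable_fun_limn_esup => n; apply/measurable_EFinP; exact: L2_measurable.
have lfE : \forall xi \ae mu, x n xi @[n --> \oo] --> lf xi.
  apply: filterS cv => xi h; rewrite /lf is_cvg_limn_esupE.
    have -> : (fun n => (x n xi)%:E) = EFin \o (fun n => x n xi) by [].
    by rewrite EFin_lim//.
  by apply/cvg_ex; exists (limn (fun n => x n xi))%:E; apply: cvg_EFin => //; exact: nearW.
have near_l : \forall xi \ae mu, forall n, `|lf xi - x n xi| <= (2^-1) ^+ n * Z n xi.
  apply: filterS2 step lfE => xi h1 h2 n.
  have h3 : `|x m xi - x n xi| @[m --> \oo] --> `|lf xi - x n xi|.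
    by apply: cvg_norm; apply: cvgB => //; exact: cvg_cst.
  have -> : `|lf xi - x n xi| = limn (fun m => `|x m xi - x n xi|) by rewrite (cvg_lim _ h3).
  apply: limr_le; first by apply/cvg_ex; eexists; exact: h3.
  by near=> m; rewrite -(@subnKC n m)//; near: m; exists n.
pose l : X := L2_of mu lf.
have lE : \forall xi \ae mu, l xi = lf xi.
  apply: (@L2_ofE_le _ _ _ _ _ (L2_abs (x 0%N) + L2_abs (Z 0%N))) => //.
  apply: filterS3 (near_l) (L2_addE (L2_abs (x 0%N)) (L2_abs (Z 0%N)))
    (filterI (L2_absE (x 0%N)) (L2_absE (Z 0%N))) => xi /(_ 0%N) h -> [-> ->].
  rewrite expr0 mul1r in h.
  rewrite [leRHS]ger0_norm ?addr_ge0//.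
  have -> : lf xi = x 0%N xi + (lf xi - x 0%N xi) by ring.
  by rewrite (le_trans (ler_normD _ _))// lerD2l (le_trans h)// ler_norm.
exists l => n.
have -> : 2 * (2^-1) ^+ n = `|(2^-1) ^+ n| * 2 :> R by rewrite mulrC ger0_norm// ltW.
apply: le_trans (ler_wpM2l (normr_ge0 _) (Z2 n)).
rewrite -normrZ; apply: L2_norm_le.
apply: filterS3 near_l lE (filterI (L2_subE l (x n)) (L2_scaleE ((2^-1) ^+ n) (Z n))).
move=> xi /(_ n) h1 h2 [-> ->]; rewrite h2 (le_trans h1)//.
exact: ler_norm.
Unshelve. all: by end_near. Qed.

Lemma L2_complete (F : set_system X) : ProperFilter F -> cauchy F -> cvg F.
Proof.
move=> FF /cauchy_ballP Fc.
pose e n : R := 4^-1 * (2^-1) ^+ n.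
have e0 n : 0 < e n by rewrite mulr_gt0 ?invr_gt0// exprn_gt0 ?invr_gt0.
have /choice[x hx] : forall n, exists x : X, F (ball x (e n)).
  move=> n; have /cauchyP /(_ _ (e0 n))[y Fy] : cauchy F by apply/cauchy_ballP.
  by exists y.
have [l hl] : exists l : X, forall n, `|l - x n| <= 2 * (2^-1) ^+ n.
  apply: L2_cvg_fast => n.
  have FI : F (ball (x n.+1) (e n.+1) `&` ball (x n) (e n)) by apply: filterI.
  have [y []] := filter_ex FI.
  rewrite /ball /= /ball_ => h1 h2.
  have -> : x n.+1 - x n = (x n.+1 - y) - (x n - y) by rewrite opprB addrA subrK.
  rewrite (le_trans (ler_normB _ _))//.
  have : e n.+1 + e n <= (2^-1) ^+ n.
    have : 0 < (2^-1) ^+ n :> R by rewrite exprn_gt0 ?invr_gt0.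
    rewrite /e exprS; lra.
  by apply: le_trans; apply: lerD; apply: ltW.
apply/cvg_ex; exists l; apply/cvgrPdist_lt => eps eps0.
have [N _ hN] : \forall n \near \oo, 3 * (2^-1) ^+ n < eps :> R.
  have : 3 * (2^-1) ^+ n @[n --> \oo] --> (3 * 0 : R).
    by apply: cvgMr; apply: cvg_expr; rewrite ger0_norm; lra.
  rewrite mulr0 => /cvgrPdist_lt /(_ _ eps0).
  by apply: filterS => n; rewrite sub0r normrN ger0_norm// mulr_ge0// exprn_ge0// invr_ge0.
apply: filterS (hx N) => y; rewrite /ball /= /ball_ => h.
have -> : l - y = (l - x N) + (x N - y) by rewrite addrA subrK.
rewrite (le_lt_trans (ler_normD _ _))//.
have h1 : `|x N - y| < 4^-1 * (2^-1) ^+ N := h.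
have h2 : 3 * (2^-1) ^+ N < eps := hN N (leqnn _).
have h3 := hl N.
apply: le_lt_trans (lerD h3 (ltW h1)) _.
have : 0 < (2^-1) ^+ N :> R by rewrite exprn_gt0 ?invr_gt0.
lra.
Qed.

HB.instance Definition _ := Uniform_isComplete.Build X L2_complete.



End L2_complete.

(** * Subgradients of convex functions *)

Section convex_functionals.
Context d (T : measurableType d) (R : realType).
Variable mu : {measure set T -> \bar R}.
Local Notation X := (L2 mu).
Implicit Types x y z : X.

Definition cvx (F : X -> R) : Prop := forall x y (s : R), 0 <= s <= 1 ->
  F (s *: x + (1 - s) *: y) <= s * F x + (1 - s) * F y.

Definition locally_bounded_above (F : X -> R) : Prop :=
  forall x, exists M r, 0 < r /\ forall z, `|z| <= r -> F (x + z) <= M.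

Lemma cvx_shift (F : X -> R) (a : X) (c : R) : cvx F -> cvx (fun z => F (a + z) + c).
Proof.
move=> cF x y s s01 /=.
have -> : a + (s *: x + (1 - s) *: y) = s *: (a + x) + (1 - s) *: (a + y).
  rewrite !scalerDr addrACA -scalerDl.
  by rewrite subrKC scale1r.
have := cF (a + x) (a + y) s s01; lra.
Qed.

Lemma cvx_bound0 (F : X -> R) (M r : R) : cvx F -> F 0 = 0 -> 0 < r ->
  (forall z, `|z| <= r -> F z <= M) ->
  [/\ 0 <= M / r, forall z, `|z| <= r -> `|F z| <= M / r * `|z|
    & forall z, - (M / r * `|z|) <= F z].
Proof.
move=> cF F0 r0 hF.
have M0 : 0 <= M by rewrite -F0; apply: hF; rewrite normr0 ltW.
have up z : `|z| <= r -> F z <= M / r * `|z|.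
  move=> zr; have [->|z0] := eqVneq z 0; first by rewrite F0 normr0 mulr0.
  have z0' : 0 < `|z| by rewrite normr_gt0.
  have := cF ((r / `|z|) *: z) 0 (`|z| / r).
  rewrite divr_ge0 ?(ltW r0)//= ler_pdivrMr// mul1r zr => /(_ isT).
  rewrite scaler0 addr0 scalerA F0 mulr0 addr0.
  have -> : `|z| / r * (r / `|z|) = 1 by field; lra.
  rewrite scale1r => /le_trans; apply.
  have -> : M / r * `|z| = `|z| / r * M by ring.
  apply: ler_wpM2l; first by rewrite divr_ge0// ltW.
  by apply: hF; rewrite normrZ ger0_norm ?divfK ?gt_eqF// divr_ge0// ltW.
have sym z : - F (- z) <= F z.
  have := cF z (- z) 2^-1.
  have -> : 1 - 2^-1 = 2^-1 :> R by lra.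
  have -> : (0 <= 2^-1 :> R) && (2^-1 <= 1 :> R) by apply/andP; split; lra.
  by rewrite scalerN subrr F0 => /(_ isT); lra.
have lo z : `|z| <= r -> - (M / r * `|z|) <= F z.
  move=> zr; apply: le_trans (sym z).
  by rewrite lerN2 -[`|z|]normrN; apply: up; rewrite normrN.
split; first by rewrite divr_ge0// ltW.
  by move=> z zr; rewrite ler_norml lo// up.
move=> z; have [/lo//|rz] := leP `|z| r.
have z0' : 0 < `|z| by exact: lt_trans rz.
have := cF z 0 (r / `|z|).
rewrite divr_ge0 ?(ltW r0)//= ler_pdivrMr// mul1r (ltW rz) => /(_ isT).
rewrite scaler0 addr0 F0 mulr0 addr0.
have nz : `|(r / `|z|) *: z| = r.
  by rewrite normrZ ger0_norm ?divfK ?gt_eqF// divr_ge0// ltW.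
have := lo ((r / `|z|) *: z); rewrite nz lexx => /(_ isT).
move=> /le_trans /[apply].
have -> : - (M / r * r) = r / `|z| * (- (M / r * `|z|)) by field; lra.
by rewrite ler_pM2l// divr_gt0.
Qed.

(** An almost minimizer z of G + |.|^2 / (2 l) makes - z / l an approximate
    subgradient, as in the resolvent of a maximal monotone operator.  An almost
    minimizer up to l^3 is compared with points at distance of order l^2, and the
    error that results is of order l. *)
Lemma cvx_epsilon_subgradient (G : X -> R) (K l : R) : cvx G -> G 0 = 0 ->
  0 <= K -> (forall z, - (K * `|z|) <= G z) -> 0 < l <= 1 ->
  exists p, `|p| <= 2 * K + 2 /\ forall w,
   dot p w - l * (K * (2 * K + 2) + (2 * K + 2) ^+ 2 + 1) * (1 + `|w| ^+ 2) <= G w.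
Proof.
move=> cG G0 K0 hK /andP[l0 l1].
set L := 2 * K + 2.
pose E := [set G z + `|z| ^+ 2 / (2 * l) | z in [set: X]].
have lbE : lbound E (- (K ^+ 2 * l / 2)).
  move=> _ [z _ <-]; have := hK z.
  suff : 0 <= - (K * `|z|) + `|z| ^+ 2 / (2 * l) + K ^+ 2 * l / 2 by lra.
  have -> : - (K * `|z|) + `|z| ^+ 2 / (2 * l) + K ^+ 2 * l / 2 =
    (`|z| - K * l) ^+ 2 / (2 * l) by field; lra.
  by rewrite divr_ge0 ?sqr_ge0//; lra.
have hE : has_inf E by split; [exists (G 0 + `|0 : X| ^+ 2 / (2 * l)); exists 0|exists (- (K ^+ 2 * l / 2))].
have l30 : 0 < l ^+ 3 by rewrite exprn_gt0.
have [_ [z _ <-] hz] := inf_adherent l30 hE.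
have minz w : G z + `|z| ^+ 2 / (2 * l) <= G w + `|w| ^+ 2 / (2 * l) + l ^+ 3.
  have /(ge_inf hE.2) : E (G w + `|w| ^+ 2 / (2 * l)) by exists w.
  lra.
pose p := - (l^-1 *: z).
have zE : z = - (l *: p) by rewrite /p scalerN opprK scalerA mulfV ?scale1r// gt_eqF.
have nz : `|z| = l * `|p| by rewrite zE normrN normrZ gtr0_norm.
have nz2 : `|z| ^+ 2 / (2 * l) = l * `|p| ^+ 2 / 2 by rewrite nz; field; lra.
have pL : `|p| <= L.
  have := minz 0; rewrite G0 normr0 expr0n/= mul0r !add0r nz2.
  have := hK z; rewrite nz => h1 h2.
  have {}h : `|p| ^+ 2 <= 2 + 2 * K * `|p|.
    have : l * `|p| ^+ 2 <= l * (2 + 2 * K * `|p|) by nra.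
    by rewrite ler_pM2l.
  rewrite leNgt; apply/negP => hL; rewrite /L in hL; nra.
exists p; split => // w.
(* the competitor lies on the segment from z to w, at the fraction l^2 of it *)
have h := minz (l ^+ 2 *: w + (1 - l ^+ 2) *: z).
have := cG w z (l ^+ 2).
have l21 : l ^+ 2 <= 1 by nra.
rewrite sqr_ge0 l21 => /(_ isT) h2.
have e1 : l ^+ 2 *: w + (1 - l ^+ 2) *: z = z + l ^+ 2 *: (w - z).
  by rewrite scalerBl scale1r scalerBr addrCA.
have n1 : `|l ^+ 2 *: w + (1 - l ^+ 2) *: z| ^+ 2 / (2 * l) =
    l * `|p| ^+ 2 / 2 - l ^+ 2 * dot p (w - z) + l ^+ 3 * `|w - z| ^+ 2 / 2.
  rewrite e1 (normD2 z (_ *: _)) dotZr normrZ exprMn real_normK ?num_real// nz.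
  have -> : dot z (w - z) = - l * dot p (w - z) by rewrite {1}zE dotNl dotZl; ring.
  by field; lra.
rewrite n1 nz2 in h.
have h3 : G z + dot p (w - z) - l * `|w - z| ^+ 2 / 2 - l <= G w.
  have : l ^+ 2 * (G z + dot p (w - z) - l * `|w - z| ^+ 2 / 2 - l) <= l ^+ 2 * G w by nra.
  by rewrite ler_pM2l// exprn_gt0.
have h4 := hK z; rewrite nz in h4.
have h5 : dot p (w - z) = dot p w + l * `|p| ^+ 2.
  by rewrite dotBr {1}zE dotNr dotZr -L2_normE; ring.
have h6 : `|w - z| ^+ 2 <= 2 * `|w| ^+ 2 + 2 * `|z| ^+ 2.
  have := sqr_ge0 `|w + z|; rewrite normB2 normD2; lra.
rewrite nz exprMn in h6.
rewrite h5 in h3.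
have p0 := normr_ge0 p; have w0 := sqr_ge0 `|w|.
have h7 : K * (l * `|p|) <= l * (K * L) by rewrite mulrCA ler_pM2l// ler_wpM2l.
have h8 : `|p| ^+ 2 <= L ^+ 2 by rewrite ler_pXn2r ?nnegrE//; rewrite /L; lra.
have h9 : l ^+ 2 * `|p| ^+ 2 <= L ^+ 2.
  apply: le_trans h8; by rewrite ler_piMl ?sqr_ge0.
have h10 : l * `|w - z| ^+ 2 <= l * (2 * `|w| ^+ 2 + 2 * L ^+ 2).
  by rewrite ler_pM2l//; lra.
have h11 : 0 <= l * `|p| ^+ 2 by rewrite mulr_ge0 ?sqr_ge0// ltW.
have h12 : l * `|w| ^+ 2 <= l * (K * L + L ^+ 2 + 1) * `|w| ^+ 2.
  rewrite -mulrA ler_pM2l// ler_peMl//.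
  have : 0 <= K * L by rewrite mulr_ge0// /L; lra.
  have := sqr_ge0 L; lra.
nra.
Qed.

End convex_functionals.

Lemma continuous_atP (R : realType) (V W : normedModType R) (f : V -> W) (x : V) :
  (f y @[y --> x] --> f x) <-> (forall eps, 0 < eps -> exists2 dl, 0 < dl &
    forall y, `|x - y| < dl -> `|f x - f y| < eps).
Proof.
split=> [/cvgrPdist_lt h eps /h /nbhs_normP[dl dl0 hd]|h]; first by exists dl.
by apply/cvgrPdist_lt => eps /h[dl dl0 hd]; apply/nbhs_normP; exists dl.
Qed.

Section convex_functionals2.
Context d (T : measurableType d) (R : realType).
Variable mu : {measure set T -> \bar R}.
Local Notation X := (L2 mu).
Implicit Types x y z : X.

(** The sets of approximate subgradients are convex, nested, nonempty and bounded
    uniformly.  By the parallelogram law their elements of nearly minimal norm form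
    a Cauchy sequence, whose limit is an exact subgradient. *)
Lemma convex_subgradient (F : X -> R) : cvx F -> locally_bounded_above F ->
  exists p, forall z, F 0 + dot p z <= F z.
Proof.
move=> cF bF.
pose G z := F (0 + z) + - F 0.
have cG : cvx G by exact: cvx_shift.
have G0 : G 0 = 0 by rewrite /G addr0 subrr.
have [M [r [r0 hM]]] := bF 0.
have [K0 _ hK] := cvx_bound0 cG G0 r0 (fun z hz => lerD (hM z hz) (lexx (- F 0))).
set K := (M - F 0) / r in K0 hK.
pose L := 2 * K + 2.
pose C := K * L + L ^+ 2 + 1.
have C0 : 0 < C.
  have : 0 <= K * L by rewrite mulr_ge0// /L; lra.
  have := sqr_ge0 L; rewrite /C; lra.
pose e n : R := n.+1%:R^-1.
have e0 n : 0 < e n by rewrite invr_gt0.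
have eS m n : (m <= n)%N -> e n <= e m by move=> mn; rewrite lef_pV2 ?posrE// ler_nat.
pose P n : set X := [set p | forall w, dot p w - e n * C * (1 + `|w| ^+ 2) <= G w].
have PS m n : (m <= n)%N -> P n `<=` P m.
  move=> mn p hp w; apply: le_trans (hp w).
  rewrite lerD2l lerN2 ler_wpM2r ?addr_ge0 ?sqr_ge0// ler_wpM2r ?eS//.
  exact: ltW.
have P0 n : exists p, P n p /\ `|p| <= L.
  have : 0 < e n <= 1 by rewrite e0 invf_le1// ler1n.
  by move=> /(cvx_epsilon_subgradient cG G0 K0 hK)[p [pL hp]]; exists p.
pose E n := [set `|p| ^+ 2 | p in P n].
have hE n : has_inf (E n).
  split; first by have [p [hp _]] := P0 n; exists (`|p| ^+ 2), p.
  by exists 0 => _ [p _ <-]; exact: sqr_ge0.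
pose dd n := inf (E n).
have ddS m n : (m <= n)%N -> dd m <= dd n.
  move=> mn; apply: lb_le_inf; first by case: (hE n).
  by move=> _ [p hp <-]; apply: ge_inf; [case: (hE m)|exists p => //; exact: (PS _ _ mn)].
have ddL n : dd n <= L ^+ 2.
  have [p [hp pL]] := P0 n.
  apply: (@le_trans _ _ (`|p| ^+ 2)); first by apply: ge_inf; [case: (hE n)|exists p].
  by rewrite ler_pXn2r ?nnegrE//; rewrite /L; lra.
have /choice[p hp] : forall n, exists p, P n p /\ `|p| ^+ 2 <= dd n + e n.
  move=> n; have [_ [p hp <-] h] := inf_adherent (e0 n) (hE n).
  by exists p; split => //; exact: ltW.
have mid n q q' : P n q -> P n q' -> P n (2^-1 *: (q + q')).
  move=> h h' w; rewrite dotZl dotDl; have := h w; have := h' w; lra.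
have close N n m : (N <= n)%N -> (N <= m)%N ->
    `|p n - p m| ^+ 2 <= 2 * dd n + 2 * dd m - 4 * dd N + 4 * e N.
  move=> Nn Nm.
  have := mid _ _ _ (PS _ _ Nn _ (hp n).1) (PS _ _ Nm _ (hp m).1).
  move=> hm; have : dd N <= `|2^-1 *: (p n + p m)| ^+ 2.
    by apply: ge_inf; [case: (hE N)|exists (2^-1 *: (p n + p m))].
  rewrite normrZ exprMn ger0_norm ?invr_ge0//.
  have -> : (2^-1) ^+ 2 = 4^-1 :> R by field.
  rewrite normB2 normD2.
  have := (hp n).2; have := (hp m).2; have := eS _ _ Nn; have := eS _ _ Nm; lra.
have dd_cvg : cvgn dd.
  apply: nondecreasing_is_cvgn; first by move=> m n; exact: ddS.
  by exists (L ^+ 2) => _ [n _ <-].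
have e_cvg : e n @[n --> \oo] --> 0 by exact: cvg_harmonic.
have p_cvg : cvgn p.
  apply/cauchy_cvgP/cauchyP => eps eps0.
  pose D := limn dd.
  have ddD n : dd n <= D by apply: nondecreasing_cvgn_le => // m k; exact: ddS.
  have eps2 : 0 < eps ^+ 2 / 8 by rewrite divr_gt0// exprn_gt0.
  have [N _ hN] : \forall n \near \oo, D - dd n < eps ^+ 2 / 8 /\ e n < eps ^+ 2 / 8.
    move/cvgrPdist_lt : dd_cvg => /(_ _ eps2) h1.
    move/cvgrPdist_lt : e_cvg => /(_ _ eps2) h2.
    apply: filterS2 h1 h2 => n h1 h2; split; first by apply: le_lt_trans h1; exact: ler_norm.
    by apply: le_lt_trans h2; rewrite sub0r normrN ler_norm.
  exists (p N); exists N => // m /= Nm; rewrite /ball /=.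
  have := close N N m (leqnn _) Nm.
  have [h1 h2] : D - dd N < eps ^+ 2 / 8 /\ e N < eps ^+ 2 / 8 := hN N (leqnn _).
  have h3 := ddD m => h4.
  suff : `|p N - p m| < eps by [].
  rewrite -(ltr_pXn2r (n := 2))// ?nnegrE ?(ltW eps0)//.
  by apply: le_lt_trans h4 _; lra.
exists (limn p) => z.
suff : dot (limn p) z <= G z by rewrite /G add0r; lra.
apply/ler_addgt0Pr => eps eps0.
have eps2 : 0 < eps / 2 / (`|z| + 1) by rewrite !divr_gt0// ltr_wpDl.
have eps3 : 0 < eps / 2 / (C * (1 + `|z| ^+ 2)).
  by rewrite !divr_gt0// mulr_gt0// ltr_wpDr// sqr_ge0.
have [N _ hN] : \forall n \near \oo, `|limn p - p n| < eps / 2 / (`|z| + 1) /\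
    e n < eps / 2 / (C * (1 + `|z| ^+ 2)).
  move/cvgrPdist_lt : p_cvg => /(_ _ eps2) h1.
  move/cvgrPdist_lt : e_cvg => /(_ _ eps3) h2.
  apply: filterS2 h1 h2 => n h1 h2; split => //.
  by apply: le_lt_trans h2; rewrite sub0r normrN ler_norm.
have [h1 h2] := hN N (leqnn _).
have h3 := (hp N).1 z.
have h4 := dot_le (limn p - p N) z; rewrite dotBl in h4.
have h5 : e N * (C * (1 + `|z| ^+ 2)) <= eps / 2.
  by rewrite -ler_pdivlMr ?(ltW h2)// mulr_gt0// ltr_wpDr// sqr_ge0.
have h6 : `|limn p - p N| * `|z| <= eps / 2.
  apply: (@le_trans _ _ (`|limn p - p N| * (`|z| + 1))); first by rewrite ler_wpM2l// lerDl.
  by rewrite -ler_pdivlMr ?(ltW h1)// ltr_wpDl.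
lra.
Qed.

Lemma cvx_continuous (F : X -> R) : cvx F -> locally_bounded_above F -> continuous F.
Proof.
move=> cF bF x.
pose G z := F (x + z) + - F x.
have cG : cvx G by exact: cvx_shift.
have G0 : G 0 = 0 by rewrite /G addr0 subrr.
have [M [r [r0 hM]]] := bF x.
have [K0 h _] := cvx_bound0 cG G0 r0 (fun z hz => lerD (hM z hz) (lexx (- F x))).
set K := (M - F x) / r in K0 h.
apply/(@continuous_atP R X R^o) => eps eps0.
have K1 : 0 < K + 1 by rewrite ltr_wpDl.
exists (Num.min r (eps / (K + 1))) => /=.
  by rewrite lt_min r0 divr_gt0.
move=> y; rewrite lt_min => /andP[xr].
rewrite ltr_pdivlMr// => xe.
have -> : F x - F y = - G (y - x) by rewrite /G addrCA subrr addr0; ring.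
rewrite normrN (le_lt_trans (h _ _))//; first by rewrite distrC ltW.
rewrite distrC; apply: le_lt_trans xe.
by rewrite mulrC ler_wpM2l// lerDl.
Qed.

(** A convex function that is bounded above near 0 decreases at most linearly. *)
Lemma cvx_affine_minorant (F : X -> R) : cvx F -> locally_bounded_above F ->
  exists2 K, 0 <= K & forall z, F 0 - K * `|z| <= F z.
Proof.
move=> cF bF.
pose G z := F (0 + z) + - F 0.
have cG : cvx G by exact: cvx_shift.
have G0 : G 0 = 0 by rewrite /G addr0 subrr.
have [M [r [r0 hM]]] := bF 0.
have [K0 _ hK] := cvx_bound0 cG G0 r0 (fun z hz => lerD (hM z hz) (lexx (- F 0))).
exists ((M - F 0) / r) => // z; have := hK z; rewrite /G add0r; lra.
Qed.

(** A linear functional is convex and continuous; a subgradient p at 0 satisfies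
    <p, z> <= f z for z and for - z, so it represents f. *)
Lemma riesz (f : X -> R) : linear f -> continuous f ->
  exists p, forall z, f z = dot z p.
Proof.
move=> lf cf.
have f0 : f 0 = 0 by have := lf 1 0 0; rewrite scale1r addr0 scale1r; lra.
have cF : cvx f.
  move=> x y s s01; rewrite lf -[(1 - s) *: y]addr0 lf f0 addr0.
  exact: lexx.
have bF : locally_bounded_above f.
  move=> x; have [r r0 hr] := (continuous_atP (V := X) (W := R^o) f x).1 (cf x) 1 ltr01.
  exists (f x + 1), (r / 2); split; first by rewrite divr_gt0.
  move=> z zr; have : `|f x - f (x + z)| <= 1.
    apply/ltW/hr; rewrite opprD addrA subrr sub0r normrN.
    by rewrite (le_lt_trans zr)// ltr_pdivrMr//; lra.
  by rewrite ler_norml => /andP[]; lra.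
have [p hp] := convex_subgradient cF bF.
exists p => z; apply/eqP; rewrite eq_le; apply/andP; split; last first.
  by have := hp z; rewrite f0 add0r dotC.
have := hp (- z); rewrite f0 add0r dotNr dotC -(scaleN1r z) -[_ *: z]addr0 lf f0 addr0.
by rewrite /GRing.scale /= mulN1r lerN2.
Qed.

End convex_functionals2.

(** * Convex integral functionals and composition with Lipschitz functions *)

Lemma convex_functionP (R : realType) (f : R -> R) :
  convex_function [set: R^o] f -> forall (a b s : R), 0 <= s <= 1 ->
  f (s * a + (1 - s) * b) <= s * f a + (1 - s) * f b.
Proof.
move=> cf a b s s01.
by apply: (cf (Itv01 (andP s01).1 (andP s01).2) a b); rewrite inE.
Qed.

Section integrable_real.
Context d (T : measurableType d) (R : realType) (mu : {measure set T -> \bar R}).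
Variables (D : set T) (mD : measurable D).

Lemma integrable_addR (f g : T -> R) : mu.-integrable D (EFin \o f) ->
  mu.-integrable D (EFin \o g) -> mu.-integrable D (EFin \o (fun x => f x + g x)).
Proof. by move=> fi gi; exact: (integrableD mD fi gi). Qed.

Lemma integrable_subR (f g : T -> R) : mu.-integrable D (EFin \o f) ->
  mu.-integrable D (EFin \o g) -> mu.-integrable D (EFin \o (fun x => f x - g x)).
Proof. by move=> fi gi; exact: (integrableB mD fi gi). Qed.

Lemma integrable_scaleR (k : R) (f : T -> R) : mu.-integrable D (EFin \o f) ->
  mu.-integrable D (EFin \o (fun x => k * f x)).
Proof. by move=> fi; exact: (integrableZl mD k fi). Qed.

End integrable_real.

Section integral_functionals.
Context d (T : measurableType d) (R : realType).
Variable mu : {measure set T -> \bar R}.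
Local Notation X := (L2 mu).
Implicit Types x y z : X.

Section convex_integrand.
Variable psi : R -> R.
Hypothesis psi_convex : forall (a b s : R), 0 <= s <= 1 ->
  psi (s * a + (1 - s) * b) <= s * psi a + (1 - s) * psi b.
Hypothesis psi_integrable : forall x : X, mu.-integrable setT (fun xi => (psi (x xi))%:E).

Definition int_fun (x : X) : R := \int[mu]_xi psi (x xi).

Lemma ae_le_Rintegral (f g : T -> R) : mu.-integrable setT (EFin \o f) ->
  mu.-integrable setT (EFin \o g) -> (\forall xi \ae mu, f xi <= g xi) ->
  \int[mu]_xi f xi <= \int[mu]_xi g xi.
Proof.
move=> fi gi fg; rewrite -subr_ge0 -RintegralB//.
have mgf : measurable_fun setT (fun xi => g xi - f xi).
  by apply: measurable_funB; apply/measurable_EFinP; exact: measurable_int fi || exact: measurable_int gi.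
rewrite (@eq_Rintegral_ae _ _ _ _ _ (fun xi => `|g xi - f xi|))//.
- by apply: Rintegral_ge0.
- exact: measurableT_comp.
- by apply: filterS fg => xi h; rewrite ger0_norm// subr_ge0.
Qed.

Lemma int_fun_cvx : cvx int_fun.
Proof.
move=> x y s s01.
have ix := psi_integrable x; have iy := psi_integrable y.
have isx := integrable_scaleR measurableT s ix.
have isy := integrable_scaleR measurableT (1 - s) iy.
rewrite /int_fun -!RintegralZl// -RintegralD//.
apply: ae_le_Rintegral; [exact: psi_integrable|exact: integrable_addR|].
apply: filterS3 (L2_addE (s *: x) ((1 - s) *: y)) (L2_scaleE s x) (L2_scaleE (1 - s) y).
by move=> xi -> -> ->; exact: psi_convex.
Qed.

Lemma psi_max (a b c : R) : a <= c <= b -> psi c <= `|psi a| + `|psi b|.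
Proof.
move=> /andP[ac cb]; have [ab|ab] := ltP a b; last first.
  have -> : c = a by lra.
  by rewrite (le_trans (ler_norm _))// lerDl.
have ba : 0 < b - a by lra.
have -> : c = (b - c) / (b - a) * a + (1 - (b - c) / (b - a)) * b by field; lra.
set s := (b - c) / (b - a).
have s0 : 0 <= s by rewrite divr_ge0//; lra.
have s1 : s <= 1 by rewrite ler_pdivrMr//; lra.
apply: le_trans (psi_convex _ _ _) _; first by rewrite s0 s1.
apply: lerD; (apply: le_trans (ler_norm _) _; rewrite normrM ger0_norm ?subr_ge0//).
  by rewrite ler_piMl.
by rewrite ler_piMl//; lra.
Qed.

(** If it failed at x, there would be z_n with |z_n| <= 2^-n and functional values
    above n.  A common bound Z of the z_n puts x + z_n between x - Z and x + Z, and a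
    convex function on an interval is bounded by its values at the two ends. *)
Lemma int_fun_locally_bounded : locally_bounded_above int_fun.
Proof.
apply: contrapT => /existsNP[x hx].
have /choice[z hz] : forall n : nat, exists z, `|z| <= (2^-1) ^+ n /\ n%:R < int_fun (x + z).
  move=> n; apply: contrapT => hn; apply: hx; exists n%:R, ((2^-1) ^+ n).
  split; first by rewrite exprn_gt0 ?invr_gt0.
  move=> z zn; rewrite leNgt; apply/negP => hh; apply: hn; by exists z.
have [Z _ hZ] := L2_dominate (fun n => (hz n).1).
pose M := \int[mu]_xi (`|psi (L2_fun (x - Z) xi)| + `|psi (L2_fun (x + Z) xi)|).
have iM (y : X) : mu.-integrable setT (EFin \o (fun xi => `|psi (y xi)|)).
  exact: (integrable_norm (psi_integrable y)).
have h n : int_fun (x + z n) <= M.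
  apply: ae_le_Rintegral; first exact: psi_integrable.
    by apply: integrable_addR => //; exact: iM.
  apply: filterS3 hZ (L2_addE x (z n)) (filterI (L2_subE x Z) (L2_addE x Z)).
  move=> xi h -> [-> ->].
  apply: psi_max.
  have := h n.+1; rewrite big_ord_recr /=.
  have : 0 <= \sum_(i < n) `|z i xi| by apply: sumr_ge0.
  move=> h1 h2; have : `|z n xi| <= Z xi by lra.
  by rewrite ler_norml => /andP[? ?]; apply/andP; split; lra.
have := (hz (Num.truncn M).+1).2; have := h (Num.truncn M).+1.
have : M < (Num.truncn M).+1%:R by exact: truncnS_gt.
lra.
Qed.

End convex_integrand.

Section finite_measure.
Hypothesis mu_fin : (mu setT < +oo)%E.

Lemma integrable_cst (c : R) : mu.-integrable setT (EFin \o cst c).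
Proof.
apply/integrableP; split; first by apply/measurable_EFinP; exact: measurable_cst.
by rewrite /= integral_cst// lte_mul_pinfty// lee_fin.
Qed.

Definition L2_cst (c : R) : X := L2_of mu (cst c).

Lemma L2_cstE c : \forall xi \ae mu, L2_cst c xi = c.
Proof. by apply: L2_ofE => //; exact: (integrable_cst (c ^+ 2)). Qed.

Lemma L2_of_bounded (f : T -> R) (M : R) : measurable_fun setT f ->
  (\forall xi \ae mu, `|f xi| <= M) -> \forall xi \ae mu, L2_of mu f xi = f xi.
Proof.
move=> mf fM; apply: (@L2_ofE_le _ _ _ _ _ (L2_cst M)) => //.
by apply: filterS2 fM (L2_cstE M) => xi h ->; rewrite (le_trans h)// ler_norm.
Qed.

Lemma L2_norm_bounded (x : X) (M : R) : 0 <= M ->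
  (\forall xi \ae mu, `|x xi| <= M) -> `|x| ^+ 2 <= M ^+ 2 * fine (mu setT).
Proof.
move=> M0 xM; rewrite L2_normE -(Rintegral_cst mu)//.
apply: ae_le_Rintegral; first exact: L2_integrable_sqr.
  exact: (integrable_cst (M ^+ 2)).
apply: filterS xM => xi h; rewrite -expr2 -[leLHS]real_normK ?num_real//.
by rewrite ler_pXn2r ?nnegrE.
Qed.

Definition L2_map (f : R -> R) (x : X) : X := L2_of mu (f \o x).

Definition lip1 (f : R -> R) : Prop := forall a b, `|f a - f b| <= `|a - b|.

Lemma lip1_continuous f : lip1 f -> continuous f.
Proof.
move=> lf x; apply/(@continuous_atP R R^o R^o) => eps eps0; exists eps => // y.
exact: le_lt_trans.
Qed.

Lemma lip1_measurable f : lip1 f -> measurable_fun setT f.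
Proof. by move=> lf; apply: continuous_measurable_fun; exact: lip1_continuous. Qed.

Lemma L2_mapE f x : lip1 f -> \forall xi \ae mu, L2_map f x xi = f (x xi).
Proof.
move=> lf; apply: (@L2_ofE_le _ _ _ _ _ (L2_cst `|f 0| + L2_abs x)).
  apply: measurableT_comp; first exact: lip1_measurable.
  exact: L2_measurable.
apply: filterS3 (L2_addE (L2_cst `|f 0|) (L2_abs x)) (L2_cstE `|f 0|) (L2_absE x).
move=> xi -> -> ->; rewrite [leRHS]ger0_norm ?addr_ge0//=.
have -> : f (x xi) = f 0 + (f (x xi) - f 0) by ring.
rewrite (le_trans (ler_normD _ _))// lerD2l (le_trans (lf _ _))//.
by rewrite subr0.
Qed.

Lemma L2_map_lip f x y : lip1 f -> `|L2_map f x - L2_map f y| <= `|x - y|.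
Proof.
move=> lf; apply: L2_norm_le.
apply: filterS2 (filterI (L2_mapE x lf) (L2_mapE y lf))
  (filterI (L2_subE (L2_map f x) (L2_map f y)) (L2_subE x y)).
by move=> xi [h1 h2] [-> ->]; rewrite h1 h2; exact: lf.
Qed.

Lemma L2_map_continuous f : lip1 f -> continuous (L2_map f).
Proof.
move=> lf x; apply/(@continuous_atP R X X) => eps eps0; exists eps => // y.
by apply: le_lt_trans; exact: L2_map_lip.
Qed.

End finite_measure.
End integral_functionals.

(** * Density by monotone classes, and separability *)

Import HBNNSimple.

Lemma indic_in (T : Type) (R : pzRingType) (A : set T) x : A x -> \1_A x = 1 :> R.
Proof. by move=> Ax; rewrite indicE mem_set. Qed.

Lemma indic_out (T : Type) (R : pzRingType) (A : set T) x : ~ A x -> \1_A x = 0 :> R.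
Proof. by move=> Ax; rewrite indicE memNset. Qed.

Section density.
Context d (T : measurableType d) (R : realType).
Variable mu : {measure set T -> \bar R}.
Local Notation X := (L2 mu).
Implicit Types x y z : X.

Lemma L2_dominated_cvg (f : nat -> X) (g Y : X) :
  (\forall xi \ae mu, f n xi @[n --> \oo] --> g xi) ->
  (forall n, \forall xi \ae mu, `|f n xi| <= Y xi) ->
  f n @[n --> \oo] --> g.
Proof.
move=> fg fY.
have fY' := ae_foralln fY.
pose h n xi : \bar R := (L2_fun (f n - g) xi ^+ 2)%:E.
have fgE : \forall xi \ae mu, forall n, L2_fun (f n - g) xi = f n xi - g xi.
  by apply: ae_foralln => n; exact: L2_subE.
have [_ _ ] : [/\ mu.-integrable setT (cst 0 : T -> \bar R),
  [sequence \int[mu]_xi `|h n xi - cst 0 xi|]_n @ \oo --> 0 &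
  [sequence \int[mu]_xi h n xi]_n @ \oo --> \int[mu]_xi (cst 0 xi)]%E.
  apply: (@dominated_convergence _ _ _ mu setT measurableT h (cst 0)
    (fun xi => 4%:E * (Y xi ^+ 2)%:E)%E) => //.
  - by move=> n; apply: measurable_sqr; exact: L2_measurable.
  - apply: filterS2 fg fgE => xi h1 h2 _.
    have -> : h^~ xi = EFin \o (fun n => (f n xi - g xi) ^+ 2).
      by apply/funext => n; rewrite /h h2.
    apply: cvg_EFin; first exact: nearW.
    have -> : 0 = (g xi - g xi) * (g xi - g xi) :> R by rewrite subrr mulr0.
    by under eq_fun do rewrite expr2; apply: cvgM; apply: cvgB => //; exact: cvg_cst.
  - exact: (integrableZl measurableT 4 (L2_integrable_sqr Y)).
  - apply: filterS3 fg fgE fY' => xi h1 h2 h3 n _.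
    rewrite /h h2 gee0_abs ?lee_fin ?sqr_ge0//.
    have h4 : `|g xi| <= Y xi.
      rewrite -(cvg_lim _ (cvg_norm h1))//; apply: limr_le; last exact: nearW.
      by apply/cvg_ex; eexists; exact: (cvg_norm h1).
    move: (h3 n) h4; rewrite !ler_norml => /andP[? ?] /andP[? ?]; nra.
rewrite integral0 => h0.
apply/cvgrPdist_lt => eps eps0.
have eps2 : 0 < eps ^+ 2 by rewrite exprn_gt0.
have /fine_cvgP[_ /cvgrPdist_lt /(_ _ eps2)] := h0.
apply: filterS => n; rewrite sub0r normrN /=.
have -> : fine (\int[mu]_xi h n xi) = `|f n - g| ^+ 2.
  by rewrite L2_normE.
rewrite ger0_norm ?sqr_ge0// ltr_pXn2r ?nnegrE ?(ltW eps0)// distrC.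
by apply.
Qed.

(** Closedness is stated with approximating elements, the form in which it is used
    throughout. *)
Definition closed_subspace (M : set X) : Prop :=
  [/\ M 0, forall (a : R) x y, M x -> M y -> M (a *: x + y)
    & forall x, (forall eps, 0 < eps -> exists2 y, M y & `|x - y| < eps) -> M x].

Section closed_subspace.
Variable M : set X.
Hypothesis M_closed : closed_subspace M.

Lemma subspaceZ a x : M x -> M (a *: x).
Proof. by have [M0 MD _] := M_closed; move=> Mx; rewrite -[_ *: _]addr0; exact: MD. Qed.

Lemma subspaceD x y : M x -> M y -> M (x + y).
Proof. by have [M0 MD _] := M_closed; move=> Mx My; rewrite -[x]scale1r; exact: MD. Qed.

Lemma subspaceB x y : M x -> M y -> M (x - y).
Proof. by move=> Mx My; apply: subspaceD => //; rewrite -scaleN1r; exact: subspaceZ. Qed.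

Lemma subspace_cvg (f : nat -> X) g : (forall n, M (f n)) ->
  f n @[n --> \oo] --> g -> M g.
Proof.
have [_ _ Mc] := M_closed; move=> fM /cvgrPdist_lt fg; apply: Mc => eps eps0.
have [N _ hN] := fg eps eps0; exists (f N) => //; exact: (hN N (leqnn _)).
Qed.

Hypothesis mu_fin : (mu setT < +oo)%E.

Definition L2_ind (A : set T) : X := L2_of mu (\1_A).

Lemma L2_indE A : measurable A -> \forall xi \ae mu, L2_ind A xi = \1_A xi.
Proof.
move=> mA; apply: (@L2_of_bounded _ _ _ _ mu_fin _ 1) => //.
by apply: filterE => xi; rewrite ger0_norm// indicE; case: (xi \in A).
Qed.

Lemma L2_bounded_cvg (f : nat -> X) (g : X) (c : R) :
  (\forall xi \ae mu, f n xi @[n --> \oo] --> g xi) ->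
  (forall n, \forall xi \ae mu, `|f n xi| <= c) -> f n @[n --> \oo] --> g.
Proof.
move=> fg fc; apply: (@L2_dominated_cvg f g (L2_cst mu c)) => // n.
by apply: filterS2 (fc n) (L2_cstE mu_fin c) => xi h ->.
Qed.

Lemma subspace_ind_cvg (A : nat -> set T) (B : set T) :
  (forall n, measurable (A n)) -> measurable B ->
  (\forall xi \ae mu, \forall n \near \oo, A n xi <-> B xi) ->
  (forall n, M (L2_ind (A n))) -> M (L2_ind B).
Proof.
move=> mA mB AB MA; apply: (subspace_cvg MA); apply: (@L2_bounded_cvg _ _ 1).
  have hA : \forall xi \ae mu, forall n, L2_ind (A n) xi = \1_(A n) xi.
    by apply: ae_foralln => n; exact: L2_indE.
  apply: filterS3 AB hA (L2_indE mB) => xi h1 h2 ->.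
  under eq_fun do rewrite h2.
  apply: cvg_near_cst; apply: filterS h1 => n h; rewrite !indicE.
  by congr (nat_of_bool _)%:R; apply/idP/idP; rewrite !inE => ?; apply/h.
move=> n; apply: filterS (L2_indE (mA n)) => xi ->.
by rewrite ger0_norm// indicE; case: (xi \in _).
Qed.

(** Monotone class argument: the sets A for which the indicator of C and of the
    preimage of A lies in M form a Dynkin system. *)
Lemma subspace_pi_lambda d' (T' : measurableType d') (f : T -> T') (C : set T)
    (G : set (set T')) : measurable_fun setT f -> measurable C ->
  (@measurable _ T') = <<s G >> -> setI_closed G ->
  M (L2_ind C) -> (forall A, G A -> M (L2_ind (f @^-1` A `&` C))) ->
  forall A, measurable A -> M (L2_ind (f @^-1` A `&` C)).
Proof.
move=> mf mC mG GI MC MG A.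
have mfA B : measurable B -> measurable (f @^-1` B `&` C).
  by move=> mB; apply: measurableI => //; rewrite -[_ @^-1` _]setTI; exact: mf.
pose H := [set B | measurable B /\ M (L2_ind (f @^-1` B `&` C))].
suff : (@measurable _ T') `<=` H by move=> h /h[].
rewrite mG; apply: (lambda_system_subset GI) => //; last first.
  move=> B GB; split; last exact: MG.
  by rewrite mG; exact: sub_sigma_algebra.
split => //.
- by split; [exact: measurableT|rewrite preimage_setT setTI].
- move=> B1 B2 B21 [mB1 MB1] [mB2 MB2]; split; first exact: measurableD.
  have -> : L2_ind (f @^-1` (B1 `\` B2) `&` C) =
      L2_ind (f @^-1` B1 `&` C) - L2_ind (f @^-1` B2 `&` C).
    apply/L2_eqP; apply: filterS3 (L2_indE (mfA _ (measurableD mB1 mB2)))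
      (filterI (L2_indE (mfA _ mB1)) (L2_indE (mfA _ mB2)))
      (L2_subE (L2_ind (f @^-1` B1 `&` C)) (L2_ind (f @^-1` B2 `&` C))).
    move=> xi -> [h1 h2] ->; rewrite h1 h2.
    have [[x1 xC]|n1] := pselect ((f @^-1` B1 `&` C) xi); last first.
      have n2 : ~ (f @^-1` B2 `&` C) xi by move=> [/B21 ? ?]; exact: n1.
      have n3 : ~ (f @^-1` (B1 `\` B2) `&` C) xi by move=> [[? _] ?]; exact: n1.
      by rewrite !indic_out// subrr.
    rewrite (indic_in R (A := f @^-1` B1 `&` C))//.
    have [x2|x2] := pselect (B2 (f xi)).
      rewrite (indic_in R (A := f @^-1` B2 `&` C))// subrr indic_out//.
      by move=> [[_]].
    rewrite indic_in// (indic_out R (A := f @^-1` B2 `&` C)) ?subr0//.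
    by move=> [].
  exact: subspaceB.
- move=> F ndF HF; split; first by apply: bigcup_measurable => n _; case: (HF n).
  apply: (@subspace_ind_cvg (fun n => f @^-1` (F n) `&` C)).
  + by move=> n; apply: mfA; case: (HF n).
  + by apply: mfA; apply: bigcup_measurable => n _; case: (HF n).
  + apply: filterE => xi; have [[k _ Fk]|h] := pselect ((\bigcup_n F n) (f xi)).
      exists k => // n /= kn; split=> [[_ xC]|[_ xC]]; split => //; first by exists k.
      have : (F k `<=` F n) by apply/subsetPset; exact: ndF.
      by apply.
    exists 0%N => // n _; split=> [[Fn _]|[hh _]]; last by [].
    by exfalso; apply: h; exists n.
  + by move=> n; case: (HF n).
Qed.

(** Simple functions are linear combinations of indicators, and every
    square-integrable function is a dominated limit of simple functions. *)
Lemma subspace_full : (forall A, measurable A -> M (L2_ind A)) -> forall x, M x.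
Proof.
move=> MA.
have MS (g : {nnsfun T >-> R}) : M (L2_of mu (fun t => g t)).
  have [K0 MD Mc] := M_closed.
  have [s hs] : exists s : seq R, forall t, g t = \sum_(c <- s) c * \1_(g @^-1` [set c]) t.
    exists (finmap.enum_fset (fset_set (range g))) => t; rewrite {1}(fimfunE g) fsbig_finite//.
  pose w : X := \sum_(c <- s) c *: L2_ind (g @^-1` [set c]).
  have -> : L2_of mu (fun t => g t) = w.
    have wE : \forall xi \ae mu, w xi = \sum_(c <- s) c * \1_(g @^-1` [set c]) xi.
      rewrite /w {hs w}; elim: s => [|c s IH].
        by rewrite big_nil; apply: filterS (L2_zeroE mu) => xi ->; rewrite big_nil.
      rewrite big_cons.
      have mc : measurable (g @^-1` [set c]) by exact: measurable_sfunP.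
      apply: filterS3 (filterI (L2_addE (c *: L2_ind (g @^-1` [set c]))
         (\sum_(c <- s) c *: L2_ind (g @^-1` [set c])))
         (L2_scaleE c (L2_ind (g @^-1` [set c])))) IH (L2_indE mc).
      by move=> xi [-> ->] -> ->; rewrite big_cons.
    apply/L2_eqP; have gw : \forall xi \ae mu, `|g xi| <= `|w xi|.
      by apply: filterS wE => xi ->; rewrite hs.
    by apply: filterS2 (L2_ofE_le (measurable_funPT g) gw) wE => xi -> ->; exact: hs.
  rewrite /w; elim: s {hs w} => [|c s IH]; first by rewrite big_nil.
  rewrite big_cons; apply: MD => //; apply: MA; exact: measurable_sfunP.
have MP (x : X) : (\forall xi \ae mu, 0 <= x xi) -> M x.
  move=> x0.
  pose f xi : \bar R := (`|x xi|)%:E.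
  have mf : measurable_fun setT f.
    by apply/measurable_EFinP; apply: measurableT_comp => //; exact: L2_measurable.
  have f0 xi : setT xi -> (0 <= f xi)%E by move=> _; rewrite lee_fin.
  pose g := nnsfun_approx measurableT mf.
  have gf xi : g n xi @[n --> \oo] --> `|x xi|.
    have := cvg_nnsfun_approx measurableT mf f0 (x := xi) I.
    by move=> /fine_cvgP[].
  have gle n xi : `|g n xi| <= `|x xi|.
    rewrite ger0_norm// -(cvg_lim _ (gf xi))//.
    apply: nondecreasing_cvgn_le; last by apply/cvg_ex; eexists; exact: gf.
    by move=> i j ij; exact: (lefP _ _ (nd_nnsfun_approx measurableT mf ij)).
  have gE : \forall xi \ae mu, forall n, L2_of mu (fun t => g n t) xi = g n xi.
    apply: ae_foralln => n; apply: L2_ofE_le; first exact: measurable_funPT.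
    by apply: filterE => xi; exact: gle.
  apply: (@subspace_cvg (fun n => L2_of mu (fun t => g n t))); first by move=> n; exact: MS.
  apply: (@L2_dominated_cvg _ _ x).
    apply: filterS2 gE x0 => xi h h0; under eq_fun do rewrite h.
    have -> : x xi = `|x xi| by rewrite ger0_norm.
    exact: gf.
  move=> n; apply: filterS2 gE x0 => xi h h0; rewrite h.
  by rewrite -[leRHS]ger0_norm.
move=> x.
have -> : x = 2^-1 *: (L2_abs x + x) - 2^-1 *: (L2_abs x - x).
  rewrite -scalerBr opprB [L2_abs x + x]addrC addrACA subrr addr0.
  by rewrite -mulr2n -(scaler_nat 2 x) scalerA mulVf ?scale1r.
apply: subspaceB; apply: subspaceZ; apply: MP.
  apply: filterS2 (L2_addE (L2_abs x) x) (L2_absE x) => xi -> ->.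
  by rewrite -lerBlDr sub0r -normrN ler_norm.
apply: filterS2 (L2_subE (L2_abs x) x) (L2_absE x) => xi -> ->.
by rewrite subr_ge0 ler_norm.
Qed.

End closed_subspace.
End density.

Section plane_density.
Context (R : realType) (Xi : set (R * R)) (Xi_open : open Xi).
Hypothesis Xi_bounded : bounded_set Xi.
Local Notation mu := (domain_measure Xi_open).
Local Notation X := (L2 mu).

Lemma Xi_box : exists2 L : R, 0 < L & forall x, Xi x -> `|x.1| < L /\ `|x.2| < L.
Proof.
have [M [_ hM]] := Xi_bounded.
exists (`|M| + 2) => [|x Xix]; first by rewrite ltr_wpDl.
have : `|x| <= `|M| + 1 by apply: hM => //; rewrite (le_lt_trans (ler_norm _))// ltrDl.
rewrite prod_normE ge_max => /andP[h1 h2].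
by split; [apply: le_lt_trans h1 _|apply: le_lt_trans h2 _]; rewrite ltrD2l ltrDr.
Qed.

Lemma mu_fin : (mu setT < +oo)%E.
Proof.
have [L L0 hL] := Xi_box.
rewrite /domain_measure /mrestr setTI.
apply: (@le_lt_trans _ _ ((@lebesgue_measure R \x @lebesgue_measure R)%E
   ([set` `[-L, L]] `*` [set` `[-L, L]] : set (plane R)))).
  apply: le_measure; rewrite ?inE.
  - exact: (open_measurable_plane Xi_open).
  - by apply: measurableX; exact: measurable_itv.
  - move=> x /hL[]; rewrite !ltr_norml => /andP[? ?] /andP[? ?].
    by split; rewrite /= in_itv/=; apply/andP; split; apply: ltW.
rewrite product_measure1E; try exact: measurable_itv.
have h : (lebesgue_measure (`[(- L)%R, L]%classic : set R) < +oo)%E.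
  by rewrite lebesgue_measure_itv; case: ifP => _; rewrite ?ltry.
by apply: lte_mul_pinfty => //; rewrite ge0_fin_numE.
Qed.

Lemma ae_Xi : \forall xi \ae mu, Xi xi.
Proof.
exists (~` Xi); split.
- by apply: measurableC; exact: (open_measurable_plane Xi_open).
- by rewrite /domain_measure /mrestr setICl measure0.
- by move=> x.
Qed.

Definition quadrant (a b : R) : set (plane R) := `]-oo, a[ `*` `]-oo, b[.

Lemma measurable_quadrant a b : measurable (quadrant a b).
Proof. by apply: measurableX; exact: measurable_itv. Qed.

Lemma rat_below (a : R) : exists q : nat -> rat,
  (forall n, ratr (q n) < a) /\ forall x, x < a -> \forall n \near \oo, x < ratr (q n).
Proof.
have /choice[q hq] : forall n : nat, exists q : rat, a - n.+1%:R^-1 < ratr q < a.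
  move=> n; have : a - n.+1%:R^-1 < a by rewrite ltrBlDr ltrDl invr_gt0.
  by move=> /rat_in_itvoo[q]; rewrite in_itv/=; exists q.
exists q; split=> [n|x xa]; first by have /andP[] := hq n.
have ax : 0 < a - x by rewrite subr_gt0.
have : n.+1%:R^-1 @[n --> \oo] --> (0 : R) by exact: cvg_harmonic.
move=> /cvgrPdist_lt /(_ _ ax); apply: filterS => n; rewrite sub0r normrN gtr0_norm ?invr_gt0//.
move=> h; have /andP[h' _] := hq n; apply: lt_trans h'.
by rewrite ltrBrDr addrC -ltrBrDr.
Qed.

Section quadrants.
Variable M : set X.
Hypothesis M_closed : closed_subspace M.
Hypothesis M_quadrant : forall a b : rat, M (L2_ind mu (quadrant (ratr a) (ratr b))).

Lemma M_quadrant_real (a b : R) : M (L2_ind mu (quadrant a b)).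
Proof.
have [p [p1 p2]] := rat_below a; have [q [q1 q2]] := rat_below b.
apply: (subspace_ind_cvg M_closed mu_fin (A := fun n => quadrant (ratr (p n)) (ratr (q n)))) => //.
- by move=> n; exact: measurable_quadrant.
- exact: measurable_quadrant.
apply: filterE => -[x1 x2]; rewrite /quadrant /=.
have [[h1 h2]|h] := pselect (x1 < a /\ x2 < b).
  apply: filterS2 (p2 _ h1) (q2 _ h2) => n h3 h4; rewrite !in_itv/=.
  by split=> _; split.
apply: filterE => n; rewrite !in_itv/=; split=> -[h3 h4]; last by exfalso; exact: h.
by exfalso; apply: h; split; [exact: lt_trans (p1 n)|exact: lt_trans (q1 n)].
Qed.

Lemma rays_pi : setI_closed (@RGenInftyO.G R).
Proof.
move=> _ _ [a ->] [b ->]; exists (Num.min a b); apply/seteqP; split=> x /=;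
  rewrite !in_itv/= lt_min.
  by move=> [-> ->].
by move=> /andP[].
Qed.

Lemma measurable_rays : (@measurable _ (measurableTypeR R)) = <<s @RGenInftyO.G R >>.
Proof. exact: RGenInftyO.measurableE. Qed.

Lemma ray_cover (x : R) : \forall n \near \oo, x < n%:R.
Proof. by near=> n; near: n; exact: nbhs_infty_gtr. Unshelve. all: by end_near. Qed.

(** The quadrants with rational corners are stable under intersection and generate
    the Borel sets of the plane; the two coordinates are treated one after the
    other. *)
Lemma quadrant_dense : forall x, M x.
Proof.
apply: (subspace_full M_closed mu_fin).
have mf1 : measurable_fun setT (fst : plane R -> measurableTypeR R) by exact: measurable_fst.
have mf2 : measurable_fun setT (snd : plane R -> measurableTypeR R) by exact: measurable_snd.
have mray (b : R) : measurable (snd @^-1` `]-oo, b[ : set (plane R)).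
  by rewrite -[_ @^-1` _]setTI; apply: mf2 => //; exact: measurable_itv.
have MR1 (A : set (measurableTypeR R)) : measurable A ->
    forall b, M (L2_ind mu (fst @^-1` A `&` snd @^-1` `]-oo, b[)).
  move=> mA b; move: A mA.
  apply: (subspace_pi_lambda M_closed mu_fin (d' := _) (T' := measurableTypeR R)
    (f := fst) (C := snd @^-1` `]-oo, b[) (G := @RGenInftyO.G R)) => //.
  - exact: measurable_rays.
  - exact: rays_pi.
  - apply: (subspace_ind_cvg M_closed mu_fin (A := fun n => quadrant n%:R b)) => //.
    + by move=> n; exact: measurable_quadrant.
    + apply: filterE => -[x1 x2]; apply: filterS (ray_cover x1) => n h; rewrite /quadrant /= !in_itv/= h.
      by split=> [[]|].
    + by move=> n; exact: M_quadrant_real.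
  - by move=> _ [a ->]; exact: (M_quadrant_real a b).
have MT : M (L2_ind mu setT).
  apply: (subspace_ind_cvg M_closed mu_fin (A := fun n => quadrant n%:R n%:R)) => //.
    by move=> n; exact: measurable_quadrant.
    apply: filterE => -[x1 x2]; apply: filterS2 (ray_cover x1) (ray_cover x2) => n h1 h2.
    by rewrite /quadrant /= !in_itv/= h1 h2.
  by move=> n; exact: M_quadrant_real.
have mfst (A : set (measurableTypeR R)) : measurable A -> measurable (fst @^-1` A : set (plane R)).
  by move=> mA; rewrite -[_ @^-1` _]setTI; exact: mf1.
have MR2 (A : set (measurableTypeR R)) : measurable A ->
    forall B : set (measurableTypeR R), measurable B ->
    M (L2_ind mu (snd @^-1` B `&` fst @^-1` A)).
  move=> mA.
  apply: (subspace_pi_lambda M_closed mu_fin (d' := _) (T' := measurableTypeR R)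
    (f := snd) (C := fst @^-1` A) (G := @RGenInftyO.G R)) => //.
  - exact: mfst.
  - exact: measurable_rays.
  - exact: rays_pi.
  - apply: (subspace_ind_cvg M_closed mu_fin
      (A := fun n => fst @^-1` A `&` snd @^-1` `]-oo, n%:R[)) => //.
    + by move=> n; apply: measurableI => //; exact: mfst.
    + exact: mfst.
    + apply: filterE => -[x1 x2]; apply: filterS (ray_cover x2) => n h; rewrite /= !in_itv/= h.
      by split=> [[]|].
    + by move=> n; exact: MR1.
  - by move=> _ [b ->]; rewrite setIC; exact: MR1.
move=> A mA; rewrite -[A]setIT -[A]/(id @^-1` A); move: A mA.
apply: (subspace_pi_lambda M_closed mu_fin (d' := _) (T' := plane R)
  (f := id) (C := setT) (G := [set A `*` B | A in (@measurable _ (measurableTypeR R))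
     & B in (@measurable _ (measurableTypeR R))])) => //.
- exact: measurable_prod_measurableType.
- move=> _ _ [A1 mA1 [B1 mB1 <-]] [A2 mA2 [B2 mB2 <-]].
  exists (A1 `&` A2); first exact: measurableI.
  exists (B1 `&` B2); first exact: measurableI.
  by rewrite setXI.
- move=> _ [A mA [B mB <-]]; rewrite setIT.
  have -> : id @^-1` (A `*` B) = snd @^-1` B `&` fst @^-1` A.
    by apply/seteqP; split=> [x [? ?]|x [? ?]].
  exact: MR2.
Qed.

End quadrants.

Definition rat_comb (s : seq (rat * (rat * rat))) : X :=
  \sum_(p <- s) ratr p.1 *: L2_ind mu (quadrant (ratr p.2.1) (ratr p.2.2)).

Lemma L2_separable : exists q : nat -> X, forall x (eps : R), 0 < eps ->
  exists n, `|x - q n| < eps.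
Proof.
pose q n : X := if unpickle n is Some s then rat_comb s else 0.
exists q => x.
suff : forall eps : R, 0 < eps -> exists s, `|x - rat_comb s| < eps.
  by move=> h eps /h[s hs]; exists (pickle s); rewrite /q pickleK.
move: x; apply: (quadrant_dense (M := [set x | forall eps : R, 0 < eps -> exists s, `|x - rat_comb s| < eps])).
  split.
  - by move=> eps eps0; exists [::]; rewrite /rat_comb big_nil subrr normr0.
  - move=> a x y hx hy eps eps0.
    have x1 : 0 < `|x| + 1 by rewrite ltr_wpDl.
    have : a < a + eps / 3 / (`|x| + 1) by rewrite ltrDl !divr_gt0.
    move=> /rat_in_itvoo[r]; rewrite in_itv/= => /andP[ar ra].
    have r1 : 0 < `|ratr r : R| + 1 by rewrite ltr_wpDl.
    have [s hs] := hx (eps / 3 / (`|ratr r : R| + 1)) ltac:(by rewrite !divr_gt0).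
    have [s' hs'] := hy (eps / 3) ltac:(by rewrite divr_gt0).
    exists ([seq (r * p.1, p.2) | p <- s] ++ s').
    have -> : rat_comb ([seq (r * p.1, p.2) | p <- s] ++ s') =
        ratr r *: rat_comb s + rat_comb s'.
      rewrite /rat_comb big_cat big_map scaler_sumr; congr (_ + _).
      by apply: eq_bigr => p _; rewrite scalerA rmorphM.
    have -> : a *: x + y - (ratr r *: rat_comb s + rat_comb s') =
       (a - ratr r) *: x + ratr r *: (x - rat_comb s) + (y - rat_comb s').
      by rewrite scalerBl scalerBr subrKA opprD addrACA.
    have h1 : `|(a - ratr r) *: x| <= eps / 3.
      rewrite normrZ distrC gtr0_norm ?subr_gt0//.
      apply: (@le_trans _ _ ((ratr r - a) * (`|x| + 1))).
        by rewrite ler_wpM2l ?subr_ge0 ?(ltW ar)// lerDl.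
      rewrite -ler_pdivlMr//; lra.
    have h2 : `|ratr r *: (x - rat_comb s)| <= eps / 3.
      rewrite normrZ; apply: (@le_trans _ _ ((`|ratr r : R| + 1) * `|x - rat_comb s|)).
        by rewrite ler_wpM2r// lerDl.
      by rewrite mulrC -ler_pdivlMr// ltW.
    apply: le_lt_trans (ler_normD _ _) _.
    have := ler_normD ((a - ratr r) *: x) (ratr r *: (x - rat_comb s)).
    lra.
  - move=> x h eps eps0.
    have [y hy xy] := h (eps / 2) ltac:(by rewrite divr_gt0).
    have [s hs] := hy (eps / 2) ltac:(by rewrite divr_gt0).
    exists s; have -> : x - rat_comb s = (x - y) + (y - rat_comb s) by rewrite addrA subrK.
    rewrite (le_lt_trans (ler_normD _ _))//; lra.
move=> a b eps eps0; exists [:: (1, (a, b))].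
by rewrite /rat_comb big_seq1 rmorph1 scale1r subrr normr0.
Qed.

End plane_density.

(** * Borel functions with values in L_2 and their integrals *)

Lemma dist_continuous (R : realType) (V : normedModType R) (z : V) :
  continuous (fun x : V => `|x - z|).
Proof.
by move=> x; apply: cvg_norm; apply: cvgB => //; exact: cvg_cst.
Qed.

Section bochner.
Context d (T : measurableType d) (R : realType).
Variable mu : {measure set T -> \bar R}.
Local Notation X := (L2 mu).
Implicit Types x y z v : X.
Hypothesis sep : exists q : nat -> X, forall x (eps : R), 0 < eps ->
  exists n, `|x - q n| < eps.

Context d0 (I : measurableType d0) (nu : {measure set I -> \bar R}).
Variables (D : set I) (mD : measurable D).

Lemma borel_open (A : set X) : open A -> measurable (A : set (borel X)).
Proof. by move=> oA; apply: sub_sigma_algebra. Qed.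

Lemma borel_compR (f : I -> X) (g : X -> R) : borel_fun D f -> continuous g ->
  measurable_fun D (g \o f).
Proof.
move=> bf cg; apply: (measurability _ (RGenOpens.measurableE R)) => _ [_ [a [b ->]] <-].
rewrite comp_preimage; apply: bf => //; apply: borel_open.
by apply: open_comp; [move=> x _; exact: cg|exact: interval_open].
Qed.

Lemma borel_comp (f : I -> X) (g : X -> X) : borel_fun D f -> continuous g ->
  borel_fun D (g \o f).
Proof.
move=> bf cg; apply: (@measurability _ _ _ (borel X) D _ (@open X) erefl) => _ [A oA <-].
rewrite comp_preimage; apply: bf => //; apply: borel_open.
by apply: open_comp => // x _; exact: cg.
Qed.

(** In a separable space an open set is a countable union of balls, so that the
    distances to fixed points detect measurability. *)
Lemma borel_of_dist (f : I -> X) :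
  (forall z, measurable_fun D (fun r => `|f r - z|)) -> borel_fun D f.
Proof.
move=> mf; apply: (@measurability _ _ _ (borel X) D _ (@open X) erefl) => _ [A oA <-].
have [q hq] := sep.
pose B (p : nat * nat) : set X := [set x | `|x - q p.1| < p.2.+1%:R^-1].
pose J := [set p | B p `<=` A].
have -> : A = \bigcup_(p in J) B p.
  apply/seteqP; split=> [x Ax|x [p Jp Bx]]; last exact: Jp.
  have /nbhs_normP[e e0 hA] := open_nbhs_nbhs (conj oA Ax).
  have e2 : 0 < e / 2 by rewrite divr_gt0.
  have [k _ hk] : \forall k \near \oo, k.+1%:R^-1 < e / 2 :> R.
    have : n.+1%:R^-1 @[n --> \oo] --> (0 : R) by exact: cvg_harmonic.
    move=> /cvgrPdist_lt /(_ _ e2); apply: filterS => n.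
    by rewrite sub0r normrN gtr0_norm ?invr_gt0.
  have {}hk : k.+1%:R^-1 < e / 2 := hk k (leqnn _).
  have k0 : 0 < k.+1%:R^-1 :> R by rewrite invr_gt0.
  have [n hn] := hq x _ k0.
  exists (n, k) => // y; rewrite /B /= => yn; apply: hA => /=.
  have -> : x - y = (x - q n) - (y - q n) by rewrite opprB addrA subrK.
  apply: le_lt_trans (ler_normB _ _) _.
  apply: lt_le_trans (ltrD hn yn) _.
  by rewrite [leRHS]splitr; apply: lerD; exact: ltW.
rewrite preimage_bigcup setI_bigcupr.
rewrite bigcup_mkcond; apply: countable_bigcupT_measurable => [|p]; first exact: countableP.
case: ifPn => // _.
have -> : D `&` f @^-1` B p = D `&` (fun r => `|f r - q p.1|) @^-1` `]-oo, p.2.+1%:R^-1[.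
  by apply/seteqP; split=> r [Dr h]; split => //; move: h; rewrite /B /= in_itv.
by apply: mf => //; exact: measurable_itv.
Qed.

Lemma borel_dist (f : I -> X) z : borel_fun D f -> measurable_fun D (fun r => `|f r - z|).
Proof.
move=> bf; apply: (borel_compR (g := fun x => `|x - z|) bf).
exact: dist_continuous.
Qed.

Lemma borel_pieces (q : nat -> X) (f : I -> X) (e : R) : borel_fun D f ->
  (forall x, exists n, `|x - q n| < e) ->
  exists A : nat -> set I, [/\ forall n, measurable (A n), forall n, A n `<=` D,
    trivIset setT A, \bigcup_n A n = D & forall n r, A n r -> `|f r - q n| < e].
Proof.
move=> bf hq.
pose B n := D `&` (fun r => `|f r - q n|) @^-1` `]-oo, e[.
have mB n : measurable (B n) by exact: (borel_dist (q n) bf mD (measurable_itv `]-oo, e[)).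
exists (seqDU B); split.
- by move=> n; apply: (seqDU_measurable (F := B)).
- by move=> n r /(@subset_seqDU _ B n) [].
- exact: trivIset_seqDU.
- rewrite -seqDU_bigcup_eq; apply/seteqP; split=> [r [n _ []]//|r Dr].
  have [n hn] := hq (f r); exists n => //; split => //=; by rewrite in_itv.
- by move=> n r /(@subset_seqDU _ B n) [_] /=; rewrite in_itv.
Qed.

(** Where u is within 1/k of the n-th point of a dense sequence, G r (u r) is
    approximated by G r at that point, which is measurable in r; let k tend to
    infinity. *)
Lemma borel_caratheodory (G : I -> X -> X) (u : I -> X) : borel_fun D u ->
  (forall r, D r -> continuous (G r)) ->
  (forall x z, measurable_fun D (fun r => `|G r x - z|)) ->
  borel_fun D (fun r => G r (u r)).
Proof.
move=> bu cG mG; apply: borel_of_dist => z.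
have [q hq] := sep.
have e0 (k : nat) : 0 < k.+1%:R^-1 :> R by rewrite invr_gt0.
have /choice[A hA] := fun k => borel_pieces bu (fun x => hq x _ (e0 k)).
pose h k N r : R := \sum_(n < N) \1_(A k n) r * `|G r (q n) - z|.
have idx k r : D r -> exists n, A k n r.
  by move=> Dr; have [_ _ _ AD _] := hA k; move: Dr; rewrite -AD => -[n _ ?]; exists n.
have /choice[nn hnn] : forall k, exists n : I -> nat, forall r, D r -> A k (n r) r.
  move=> k; have /choice[n hn] : forall r, exists n, D r -> A k n r.
    by move=> r; have [/(idx k)[n hn]|nD] := pselect (D r); [exists n|exists 0%N].
  by exists n.
have hE k N r : D r -> (nn k r < N)%N -> h k N r = `|G r (q (nn k r)) - z|.
  move=> Dr nN; rewrite /h (bigD1 (Ordinal nN))//= big1 ?addr0.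
    by rewrite indic_in ?mul1r//; exact: hnn.
  move=> i ni; rewrite indic_out ?mul0r// => Air.
  have [_ _ tA _ _] := hA k.
  have e : val i = nn k r by apply: (tA _ _ Logic.I Logic.I); exists r; split => //; exact: hnn.
  by move/eqP : ni; apply; apply/val_inj.
have mh k N : measurable_fun D (h k N).
  have [mA _ _ _ _] := hA k.
  by apply: measurable_sum => n; apply: measurable_funM.
have mhk k : measurable_fun D (fun r => `|G r (q (nn k r)) - z|).
  apply: (measurable_fun_cvg (h := h k)) => // r Dr.
  apply: cvg_near_cst; exists (nn k r).+1 => // N /= hN; exact: hE.
apply: (measurable_fun_cvg (h := fun k r => `|G r (q (nn k r)) - z|)) => // r Dr.
apply/cvgrPdist_lt => e e00.
have [dl dl0 hdl] := (@continuous_atP R X X (G r) (u r)).1 (cG r Dr (u r)) e e00.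
have : n.+1%:R^-1 @[n --> \oo] --> (0 : R) by exact: cvg_harmonic.
move=> /cvgrPdist_lt /(_ _ dl0); apply: filterS => k.
rewrite sub0r normrN gtr0_norm ?invr_gt0// => hk.
apply: le_lt_trans (hdl (q (nn k r)) _).
  apply: le_trans (ler_dist_dist _ _) _.
  by rewrite opprB addrA subrK.
apply: lt_trans hk.
by have [_ _ _ _] := hA k; apply; exact: hnn.
Qed.

Lemma borel_sub_step (s : seq (set I * X)) (f : I -> X) : borel_fun D f ->
  (forall p, p \in s -> measurable p.1) ->
  borel_fun D (fun r => f r - step_fun s r).
Proof.
elim: s f => [|[A v] s IH] f bf hs.
  have -> : (fun r => f r - step_fun [::] r) = f.
    by apply/funext => r; rewrite /step_fun big_nil subr0.
  by [].
have mA : measurable A by apply: (hs (A, v)); rewrite mem_head.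
have -> : (fun r => f r - step_fun ((A, v) :: s) r) =
   (fun r => (f r - (\1_A r : R) *: v) - step_fun s r).
  by apply/funext => r; rewrite /step_fun big_cons opprD addrA.
apply: IH => [|p ps]; last by apply: hs; rewrite in_cons ps orbT.
apply: borel_of_dist => z.
have -> : (fun r => `|f r - (\1_A r : R) *: v - z|) =
   (fun r => \1_A r * `|f r - (v + z)| + (1 - \1_A r) * `|f r - z|).
  apply/funext => r; rewrite indicE; case: (r \in A).
    by rewrite scale1r subrr mul0r addr0 mul1r opprD addrA.
  by rewrite scale0r subr0 subr0 mul0r add0r mul1r.
have m1 : measurable_fun D (\1_A : I -> R) by apply: measurable_indic.
apply: measurable_funD; apply: measurable_funM => //; try exact: borel_dist.
exact: measurable_funB.
Qed.

End bochner.

Lemma half_step (R : realFieldType) (a : R) : 0 < a / 2 -> a / 2 + 2^-1 * a / 2 <= a.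
Proof. lra. Qed.

Lemma two_errors (R : realFieldType) (e1 e2 e a b c : R) :
  - e1 <= a - c -> b - c <= e2 -> e1 + e2 <= e -> b - a <= e.
Proof. lra. Qed.

Section bochner_integral.
Context d (T : measurableType d) (R : realType).
Variable mu : {measure set T -> \bar R}.
Local Notation X := (L2 mu).
Implicit Types x y z v : X.
Hypothesis sep : exists q : nat -> X, forall x (eps : R), 0 < eps ->
  exists n, `|x - q n| < eps.

Lemma dot_continuous v : continuous (fun x : X => dot x v).
Proof.
move=> x; apply/(@continuous_atP R X R^o) => eps eps0.
have v1 : 0 < `|v| + 1 by rewrite ltr_wpDl.
exists (eps / (`|v| + 1)); first by rewrite divr_gt0.
move=> y; rewrite ltr_pdivlMr// -dotBl; apply: le_lt_trans.
by rewrite (le_trans (cauchy_schwarz _ _))// ler_wpM2l// lerDl.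
Qed.

Context d0 (I : measurableType d0) (nu : {measure set I -> \bar R}).
Variables (D : set I) (mD : measurable D).
Hypothesis nuD : (nu D < +oo)%E.

Lemma bounded_integrable (g : I -> R) (K : R) : measurable_fun D g ->
  (forall r, D r -> `|g r| <= K) -> nu.-integrable D (EFin \o g).
Proof.
move=> mg gK; apply: (@le_integrable _ _ _ nu D mD _ (EFin \o cst `|K|)).
- exact/measurable_EFinP.
- by move=> r Dr; rewrite /= lee_fin normr_id (le_trans (gK r Dr))// ler_norm.
- apply/integrableP; split; first by apply/measurable_EFinP; exact: measurable_cst.
  by rewrite /= integral_cst// normr_id lte_mul_pinfty// lee_fin.
Qed.

Definition good_step (s : seq (set I * X)) : Prop :=
  forall p, p \in s -> [/\ measurable p.1, p.1 `<=` D & (nu p.1 < +oo)%E].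

Lemma step_fun_bounded (s : seq (set I * X)) r : `|step_fun s r| <= \sum_(p <- s) `|p.2|.
Proof.
rewrite /step_fun (le_trans (ler_norm_sum _ _ _))//; apply: ler_sum => p _.
rewrite normrZ ler_piMl// indicE; case: (r \in _); by rewrite ?normr1 ?normr0.
Qed.

Lemma borel_step (s : seq (set I * X)) : good_step s -> borel_fun D (step_fun s).
Proof.
move=> gs.
have b0 : borel_fun D (fun=> 0 : X).
  by apply: borel_of_dist => // z; exact: measurable_cst.
have := borel_sub_step sep mD b0 (fun p ps => let: And3 a _ _ := gs p ps in a).
move=> h; have := borel_comp mD h (g := fun x => - x).
have -> : (fun x => - x) \o (fun r => 0 - step_fun s r) = step_fun s.
  by apply/funext => r /=; rewrite sub0r opprK.
apply; move=> x; apply/(@continuous_atP R X X) => eps eps0; exists eps => // y.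
have -> : - x - - y = y - x by rewrite opprK addrC.
by rewrite distrC.
Qed.

Lemma dot_step_int (s : seq (set I * X)) v : good_step s ->
  dot (step_int nu s) v = \int[nu]_(r in D) dot (step_fun s r) v.
Proof.
elim: s => [|[A x] s IH] gs.
  rewrite /step_int big_nil dot0l; under eq_Rintegral do rewrite /step_fun big_nil dot0l.
  by rewrite Rintegral_cst ?mul0r.
have [mA AD nuA] := gs _ (mem_head _ _).
have gs' : good_step s by move=> p ps; apply: gs; rewrite in_cons ps orbT.
rewrite /step_int big_cons dotDl dotZl -/(step_int nu s) IH//=.
have -> : (fun r => dot (step_fun ((A, x) :: s) r) v) =
    (fun r => dot x v * \1_A r + dot (step_fun s r) v).
  by apply/funext => r; rewrite /step_fun big_cons dotDl dotZl mulrC.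
have iA : nu.-integrable D (EFin \o (\1_A : I -> R)).
  apply: (bounded_integrable (K := 1)) => [|r _]; first exact: measurable_indic.
  by rewrite ger0_norm// indicE; case: (r \in _).
rewrite RintegralD//.
- congr (_ + _); rewrite RintegralZl// mulrC; congr (_ * _).
  rewrite /Rintegral; congr fine; rewrite integral_indic// setIidl//.
- exact: integrable_scaleR.
- apply: (bounded_integrable (K := (\sum_(p <- s) `|p.2|) * `|v|)).
    exact: (borel_compR mD (borel_step gs') (@dot_continuous v)).
  move=> r _; rewrite (le_trans (cauchy_schwarz _ _))// ler_wpM2r//.
  exact: step_fun_bounded.
Qed.

Section integrand.
Variables (f : I -> X) (K : R).
Hypothesis bf : borel_fun D f.
Hypothesis fK : forall r, D r -> `|f r| <= K.

Lemma integrable_dot v : nu.-integrable D (EFin \o (fun r => dot (f r) v)).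
Proof.
apply: (bounded_integrable (K := K * `|v|)).
  exact: (borel_compR mD bf (@dot_continuous v)).
by move=> r Dr; rewrite (le_trans (cauchy_schwarz _ _))// ler_wpM2r// fK.
Qed.

Definition step_err (s : seq (set I * X)) := \int[nu]_(r in D) `|f r - step_fun s r|.

Lemma integrable_err s : good_step s ->
  nu.-integrable D (EFin \o (fun r => `|f r - step_fun s r|)).
Proof.
move=> gs; apply: (bounded_integrable (K := K + \sum_(p <- s) `|p.2|)).
  have := borel_dist mD 0 (borel_sub_step sep mD bf (fun p ps => let: And3 a _ _ := gs p ps in a)).
  by apply: eq_measurable_fun => r _; rewrite subr0.
move=> r Dr; rewrite normr_id (le_trans (ler_normB _ _))// lerD ?fK//.
exact: step_fun_bounded.
Qed.

Lemma step_int_err s v : good_step s ->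
  `|dot (step_int nu s) v - \int[nu]_(r in D) dot (f r) v| <= step_err s * `|v|.
Proof.
move=> gs; rewrite dot_step_int// -RintegralB//; last 2 first.
- apply: (bounded_integrable (K := (\sum_(p <- s) `|p.2|) * `|v|)).
    exact: (borel_compR mD (borel_step gs) (@dot_continuous v)).
  move=> r _; rewrite (le_trans (cauchy_schwarz _ _))// ler_wpM2r//.
  exact: step_fun_bounded.
- exact: integrable_dot.
have ie := integrable_err gs.
have mB : measurable_fun D (fun r => dot (step_fun s r) v - dot (f r) v).
  apply: measurable_funB; first exact: (borel_compR mD (borel_step gs) (@dot_continuous v)).
  exact: (borel_compR mD bf (@dot_continuous v)).
have hB r : `|dot (step_fun s r) v - dot (f r) v| <= `|v| * `|f r - step_fun s r|.
  by rewrite -dotBl (le_trans (cauchy_schwarz _ _))// distrC mulrC.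
have iB : nu.-integrable D (EFin \o (fun r => dot (step_fun s r) v - dot (f r) v)).
  apply: le_integrable (integrable_scaleR mD `|v| ie) => //.
    exact/measurable_EFinP.
  by move=> r Dr; rewrite /= lee_fin (le_trans (hB r))// ler_norm.
rewrite (le_trans (le_normr_Rintegral mD iB))// mulrC /step_err -RintegralZl//.
apply: le_Rintegral => //; first exact: integrable_norm.
exact: integrable_scaleR.
Qed.

Lemma bochner_dot w v : is_bochner_integral nu D f w ->
  dot w v = \int[nu]_(r in D) dot (f r) v.
Proof.
move=> [_ [s [gs es ws]]].
have eE n : (\int[nu]_(r in D) (`|f r - step_fun (s n) r|)%:E)%E = (step_err (s n))%:E.
  rewrite /step_err /Rintegral fineK//; apply: integrable_fin_num => //.
  exact: (integrable_err (gs n)).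
have {}es : step_err (s n) @[n --> \oo] --> 0.
  by move: es; under eq_fun do rewrite eE; move/fine_cvgP => [].
apply/eqP; rewrite -subr_eq0 -normr_le0; apply/ler_addgt0Pr => eps eps0; rewrite add0r.
have v1 : 0 < `|v| + 1 by rewrite ltr_wpDl.
have e2 : 0 < eps / 2 / (`|v| + 1) by rewrite !divr_gt0.
have [n _ hn] := filterI ((cvgrPdist_lt _ _).1 es _ e2) ((cvgrPdist_lt _ _).1 ws _ e2).
have [] := hn n (leqnn _).
rewrite sub0r normrN => /ltW h1 /ltW h2.
have -> : dot w v - \int[nu]_(r in D) dot (f r) v = dot (w - step_int nu (s n)) v +
  (dot (step_int nu (s n)) v - \int[nu]_(r in D) dot (f r) v) by rewrite dotBl; ring.
rewrite (le_trans (ler_normD _ _))// [leRHS]splitr; apply: lerD.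
  rewrite (le_trans (cauchy_schwarz _ _))//.
  apply: le_trans (ler_wpM2r (normr_ge0 v) h2) _.
  by rewrite mulrAC ler_pdivrMr// ler_wpM2l ?lerDl// divr_ge0// ltW.
rewrite (le_trans (step_int_err v (gs n)))//.
apply: le_trans (ler_wpM2r (normr_ge0 v) (le_trans (ler_norm _) h1)) _.
by rewrite mulrAC ler_pdivrMr// ler_wpM2l ?lerDl// divr_ge0// ltW.
Qed.

(** The pieces on which f is near a point of a dense sequence exhaust D; finitely
    many of them carry all but a small part of the measure, and f is bounded on the
    rest. *)
Lemma step_approx (eps : R) : 0 < eps -> exists s, good_step s /\ step_err s <= eps.
Proof.
move=> eps0.
pose c := fine (nu D).
have c0 : 0 <= c by exact: fine_ge0.
have cE : nu D = c%:E by rewrite fineK// ge0_fin_numE.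
pose e := eps / 2 / (c + 1).
have c1 : 0 < c + 1 by rewrite ltr_wpDl.
have e0 : 0 < e by rewrite !divr_gt0.
pose K' := `|K| + 1.
have K'0 : 0 < K' by rewrite ltr_wpDl.
have fK' r : D r -> `|f r| <= K'.
  by move=> Dr; rewrite (le_trans (fK Dr))// (le_trans (ler_norm _))// lerDl.
have [q hq] := sep.
have [A [mA AD tA AU hA]] := borel_pieces mD bf (fun x => hq x _ e0).
pose E N := \bigcup_(n < N) A n.
have mE N : measurable (E N) by apply: bigcup_measurable.
have cvE : nu (E n) @[n --> \oo] --> nu D.
  rewrite -AU; have -> : \bigcup_n A n = \bigcup_n E n.
    apply/seteqP; split=> [r [n _ An]|r [n _ [k _ Ak]]]; last by exists k.
    by exists n.+1 => //; exists n => //=.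
  apply: nondecreasing_cvg_mu; [exact: mE|exact: bigcupT_measurable|].
  by move=> m n mn; apply/subsetPset => r [k /= km Ak]; exists k => //=; exact: leq_trans mn.
have [N hN] : exists N, (nu (D `\` E N) <= (eps / 2 / K')%:E)%E.
  have ED N : E N `<=` D by move=> r [n _ /AD].
  have Efin N : nu (E N) \is a fin_num.
    by rewrite ge0_fin_numE// (le_lt_trans _ nuD)// le_measure ?inE.
  move: cvE; rewrite cE => /fine_cvgP[_ /cvgrPdist_lt h].
  have e2 : 0 < eps / 2 / K' by rewrite !divr_gt0.
  have [N _ hN] := h _ e2; exists N.
  have := hN N (leqnn _); rewrite /=.
  have -> : nu (D `\` E N) = (nu D - nu (E N))%E by rewrite measureD// (setIidr (ED N)).
  rewrite cE -(fineK (Efin N)) -EFinB lee_fin => /ltW; apply: le_trans.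
  exact: ler_norm.
pose s := [seq (A n, q n) | n <- iota 0 N].
have gs : good_step s.
  move=> p /mapP[n _ ->] /=; split => //.
  by rewrite (le_lt_trans _ nuD)// le_measure ?inE.
have stepE r n : A n r -> (n < N)%N -> step_fun s r = q n.
  move=> Anr nN; rewrite /step_fun big_map /=.
  rewrite (bigD1_seq n) ?iota_uniq ?mem_iota//= indic_in// scale1r big1 ?addr0// => i ni.
  rewrite indic_out ?scale0r// => Air; move/eqP : ni; apply.
  by apply: tA => //; exists r.
have step0 r : ~ E N r -> step_fun s r = 0.
  move=> nE; rewrite /step_fun big_map big1_seq// => n /andP[_].
  rewrite mem_iota add0n => /= nN; rewrite indic_out ?scale0r// => Anr.
  by apply: nE; exists n.
exists s; split => //.
have ub r : D r -> `|f r - step_fun s r| <= e + K' * \1_(D `\` E N) r.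
  move=> Dr; have [[n /= nN Anr]|nE] := pselect (E N r).
    rewrite (stepE r n Anr nN) (le_trans (ltW (hA n r Anr)))// lerDl.
    by rewrite mulr_ge0 ?(ltW K'0)//.
  by rewrite step0// subr0 indic_in// mulr1 (le_trans (fK' r Dr))// lerDr ltW.
have mDE : measurable (D `\` E N) by exact: measurableD.
have iDE : nu.-integrable D (EFin \o (\1_(D `\` E N) : I -> R)).
  apply: (bounded_integrable (K := 1)) => [|r _]; first exact: measurable_indic.
  by rewrite ger0_norm// indicE; case: (r \in _).
have ie : nu.-integrable D (EFin \o (cst e : I -> R)).
  by apply: (bounded_integrable (K := e)) => // r _; rewrite ger0_norm// ltW.
apply: (@le_trans _ _ (\int[nu]_(r in D) (e + K' * \1_(D `\` E N) r))).
  apply: le_Rintegral => //; first exact: integrable_err.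
  by apply: integrable_addR => //; exact: integrable_scaleR.
rewrite RintegralD//; last exact: integrable_scaleR.
rewrite Rintegral_cst// (RintegralZl _ mD iDE) [leRHS]splitr; apply: lerD.
  by rewrite /e -/c mulrAC ler_pdivrMr// ler_wpM2l ?lerDl// divr_ge0// ltW.
rewrite mulrC -ler_pdivlMr// /Rintegral integral_indic// setIidl; last by move=> r [].
by rewrite -lee_fin fineK// ge0_fin_numE// (le_lt_trans _ nuD)// le_measure ?inE.
Qed.

(** The integrals of step functions approximating f in mean at the rate 2^-n form a
    fast Cauchy sequence. *)
Lemma bochner_exists : exists w, is_bochner_integral nu D f w.
Proof.
have half0 n : 0 < (2^-1) ^+ n / 2 :> R by rewrite divr_gt0// exprn_gt0 ?invr_gt0.
have /choice[s hs] := fun n => step_approx (half0 n).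
have [w hw] : exists w : X, forall n, `|w - step_int nu (s n)| <= 2 * (2^-1) ^+ n.
  apply: L2_cvg_fast => n.
  set v := step_int nu (s n.+1) - step_int nu (s n).
  have [->|v0] := eqVneq v 0; first by rewrite normr0 exprn_ge0 ?invr_ge0.
  have v0' : 0 < `|v| by rewrite normr_gt0.
  rewrite -(ler_pM2r v0') -expr2 L2_normE {1}/v dotBl.
  have h1 := step_int_err v (hs n).1; have h2 := step_int_err v (hs n.+1).1.
  move: h1 h2; rewrite !ler_norml => /andP[h1 _] /andP[_ h2].
  have h3 : (step_err (s n) + step_err (s n.+1)) * `|v| <= (2^-1) ^+ n * `|v|.
    rewrite ler_wpM2r// (le_trans (lerD (hs n).2 (hs n.+1).2))// exprS.
    exact: half_step.
  move: h1 h2 h3; rewrite mulrDl.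
  exact: two_errors.
exists w; split => //; exists s; split.
- by move=> n; exact: (hs n).1.
- have -> : (fun n => (\int[nu]_(x in D) (`|f x - step_fun (s n) x|)%:E)%E) =
      (fun n => (step_err (s n))%:E).
    apply/funext => n; rewrite /step_err /Rintegral fineK//.
    by apply: integrable_fin_num => //; apply: integrable_err; exact: (hs n).1.
  apply: cvg_EFin; first exact: nearW.
  apply: (@squeeze_cvgr _ _ _ _ (cst 0) (fun n => (2^-1) ^+ n)).
  + apply: nearW => n; rewrite Rintegral_ge0//= (le_trans (hs n).2)//.
    by rewrite ler_pdivrMr// ler_peMr ?ler1n// exprn_ge0 ?invr_ge0.
  + exact: cvg_cst.
  + by apply: cvg_expr; rewrite ger0_norm ?invr_ge0//; lra.
- apply/cvgrPdist_le => eps eps0.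
  have : 2 * (2^-1) ^+ n @[n --> \oo] --> (2 * 0 : R).
    by apply: cvgMr; apply: cvg_expr; rewrite ger0_norm ?invr_ge0//; lra.
  rewrite mulr0 => /cvgrPdist_le /(_ _ eps0); apply: filterS => n.
  rewrite sub0r normrN; apply: le_trans; apply: le_trans (hw n) _.
  exact: ler_norm.
Qed.

Lemma bochner_integralP : is_bochner_integral nu D f (bochner_integral nu D f).
Proof. by apply: xgetPex; exact: bochner_exists. Qed.

Lemma dot_bochner v : dot (bochner_integral nu D f) v = \int[nu]_(r in D) dot (f r) v.
Proof. exact: (bochner_dot v bochner_integralP). Qed.

End integrand.
End bochner_integral.

(** * Translation invariance *)

Section translation.
Context (R : realType).
Local Notation leb := (@lebesgue_measure R).
Local Notation leb2 := (leb \x leb)%E.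

Definition shift1 (a : R) : measurableTypeR R -> measurableTypeR R := fun x => x + a.

Lemma measurable_shift1 a : measurable_fun setT (shift1 a).
Proof. by apply: measurable_funD => //; exact: measurable_cst. Qed.

HB.instance Definition _ a := @isMeasurableFun.Build _ _ _ _ (shift1 a) (@measurable_shift1 a).

Lemma shift1_itv (a x y : R) : shift1 a @^-1` `]x, y] = `]x - a, y - a]%classic.
Proof.
by apply/seteqP; split=> z; rewrite /shift1 /= !in_itv/= ltrBlDr lerBrDr.
Qed.

Lemma lebesgue_shift a (A : set (measurableTypeR R)) : measurable A ->
  leb (shift1 a @^-1` A) = leb A.
Proof.
move=> mA; apply/esym.
apply: (@lebesgue_measure_unique R (pushforward leb (shift1 a))) => //.
move=> _ [[x y] _ <-].
transitivity (leb `]x - a, y - a]%classic); last by rewrite /pushforward -(shift1_itv a x y).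
rewrite !lebesgue_measure_itv/= !lte_fin.
rewrite ltrD2r; case: ifP => // _; rewrite -!EFinB; congr EFin; ring.
Qed.

Definition shift2 (e : R * R) : plane R -> plane R := fun x => (x.1 + e.1, x.2 + e.2).

Lemma measurable_shift2 e : measurable_fun setT (shift2 e).
Proof.
apply/measurable_fun_pairP; split.
  apply: (measurable_funD (f := fst : plane R -> R) (g := cst e.1)) => //; exact: measurable_fst.
apply: (measurable_funD (f := snd : plane R -> R) (g := cst e.2)) => //; exact: measurable_snd.
Qed.

HB.instance Definition _ e := @isMeasurableFun.Build _ _ _ _ (shift2 e) (@measurable_shift2 e).

Lemma lebesgue_shift2 e (A : set (plane R)) : measurable A ->
  leb2 (shift2 e @^-1` A) = leb2 A.
Proof.
move=> mA; apply/esym.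
apply: (@product_measure_unique _ _ _ _ R leb leb (pushforward leb2 (shift2 e))) => //.
move=> B C mB mC.
transitivity (leb2 (shift1 e.1 @^-1` B `*` shift1 e.2 @^-1` C)); first by [].
rewrite product_measure1E.
- by congr (_ * _)%E; exact: lebesgue_shift.
- by rewrite -[_ @^-1` _]setTI; apply: measurable_shift1.
- by rewrite -[_ @^-1` _]setTI; apply: measurable_shift1.
Qed.

Lemma Rintegral_shift1 (a : R) (D : set (measurableTypeR R)) (f : R -> R) :
  measurable D -> measurable_fun setT f ->
  leb.-integrable (shift1 a @^-1` D) (EFin \o (f \o shift1 a)) ->
  \int[leb]_(x in shift1 a @^-1` D) f (x + a) = \int[leb]_(x in D) f x.
Proof.
move=> mD mf intf; rewrite /Rintegral; congr fine.
have mf' : measurable_fun setT (EFin \o f) by apply/measurable_EFinP.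
rewrite -[LHS](integral_pushforward (measurable_shift1 a) mf' intf mD).
by apply: eq_measure_integral => A mA _; exact: lebesgue_shift.
Qed.

Lemma Rintegral_shift2 (e : R * R) (D : set (plane R)) (f : plane R -> R) :
  measurable D -> measurable_fun setT f ->
  leb2.-integrable (shift2 e @^-1` D) (EFin \o (f \o shift2 e)) ->
  \int[leb2]_(x in shift2 e @^-1` D) f (shift2 e x) = \int[leb2]_(x in D) f x.
Proof.
move=> mD mf intf; rewrite /Rintegral; congr fine.
have mf' : measurable_fun setT (EFin \o f) by apply/measurable_EFinP.
rewrite -[LHS](integral_pushforward (measurable_shift2 e) mf' intf mD).
by apply: eq_measure_integral => A mA _; exact: lebesgue_shift2.
Qed.

End translation.

(** * Strongly continuous semigroups *)

Lemma max0_dist (R : realFieldType) (r s : R) :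
  `|Num.max r 0 - Num.max s 0| <= `|r - s|.
Proof.
have e x : Num.max x 0 = (x + `|x|) / 2 :> R by rewrite maxr_absE subr0 addr0.
rewrite !e -mulrBl opprD addrACA normrM [`|2^-1|]ger0_norm ?invr_ge0//.
rewrite ler_pdivrMr// mulr_natr mulr2n (le_trans (ler_normD _ _))// lerD2l.
exact: ler_dist_dist.
Qed.

(** The upper right derivative of g is nonpositive: the set of times up to which
    g s <= g 0 + eps s can neither stop nor jump. *)
Lemma dini_nonincreasing (R : realType) (g : R -> R) :
  (forall t, 0 <= t -> forall eps, 0 < eps -> exists2 dl, 0 < dl &
     forall s, 0 <= s -> `|t - s| < dl -> `|g t - g s| < eps) ->
  (forall t, 0 <= t -> forall eps, 0 < eps -> exists2 dl, 0 < dl &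
     forall k, 0 < k < dl -> g (t + k) <= g t + eps * k) ->
  forall t, 0 <= t -> g t <= g 0.
Proof.
move=> cg dg T0 T00; apply/ler_addgt0Pr => e e0.
pose eps := e / (T0 + 1).
have T1 : 0 < T0 + 1 by rewrite ltr_wpDl.
have eps0 : 0 < eps by rewrite divr_gt0.
suff h : g T0 <= g 0 + eps * T0.
  apply: (le_trans h); rewrite lerD2l /eps mulrAC ler_pdivrMr// ler_wpM2l ?lerDl//.
  exact: ltW.
pose E := [set t | 0 <= t <= T0 /\ forall s, 0 <= s <= t -> g s <= g 0 + eps * s].
have E0 : E 0.
  split; first by rewrite lexx.
  move=> s; rewrite -eq_le => /eqP <-; by rewrite mulr0 addr0.
have Eub : ubound E T0 by move=> t [/andP[]].
have hE : has_sup E by split; [exists 0|exists T0].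
pose tau := sup E.
have tau0 : 0 <= tau by apply: ub_le_sup => //; exists T0.
have tauT : tau <= T0 by apply: ge_sup => //; exists 0.
have below s : 0 <= s < tau -> g s <= g 0 + eps * s.
  move=> /andP[s0 st].
  have ts : 0 < tau - s by rewrite subr_gt0.
  have [t [_ ht] st'] := sup_adherent ts hE.
  apply: ht; rewrite s0 ltW//; move: st'; rewrite -/tau; lra.
have attau : g tau <= g 0 + eps * tau.
  have [t00|t0] := eqVneq tau 0; first by rewrite t00 mulr0 addr0.
  have {t0}t0 : 0 < tau by rewrite lt_neqAle eq_sym t0.
  apply/ler_addgt0Pr => c c0.
  have [dl dl0 hdl] := cg tau tau0 c c0.
  pose s := tau - Num.min tau dl / 2.
  have m0 : 0 < Num.min tau dl by rewrite lt_min t0.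
  have m1 : Num.min tau dl <= tau by rewrite ge_min lexx.
  have m2 : Num.min tau dl <= dl by rewrite ge_min lexx orbT.
  have s0 : 0 <= s by rewrite /s; lra.
  have st : s < tau by rewrite /s; lra.
  have := hdl s s0; have -> : tau - s = Num.min tau dl / 2 by rewrite /s; ring.
  rewrite gtr0_norm ?divr_gt0// => /(_ ltac:(lra)).
  rewrite ltr_norml => /andP[_ h1].
  have : 0 <= s < tau by rewrite s0.
  move=> /below h2.
  have h3 : eps * s <= eps * tau by rewrite ler_pM2l// ltW.
  lra.
have [tT|Tt] := ltP tau T0; last first.
  by have -> : T0 = tau by apply/eqP; rewrite eq_le Tt tauT.
exfalso.
have [dl dl0 hdl] := dg tau tau0 eps eps0.
pose k := Num.min (dl / 2) (T0 - tau).
have k0 : 0 < k by rewrite lt_min divr_gt0//= subr_gt0.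
have k1 : k < dl by rewrite gt_min; apply/orP; left; lra.
have k2 : k <= T0 - tau by rewrite ge_min lexx orbT.
have : E (tau + k).
  split; first by apply/andP; split; lra.
  move=> s /andP[s0 sk]; have [st|ts] := ltP s tau; first by apply: below; rewrite s0.
  have [->//|st] := eqVneq s tau.
  have {}st : 0 < s - tau by rewrite subr_gt0 lt_neqAle eq_sym st.
  have := hdl (s - tau); rewrite st/= subrKC => h.
  have {}h : g s <= g tau + eps * (s - tau) by apply: h; lra.
  by rewrite mulrBr in h; lra.
move=> /(ub_le_sup (ex_intro _ T0 Eub)); rewrite -/tau; lra.
Qed.

Section linear_maps.
Context d (T : measurableType d) (R : realType).
Variable mu : {measure set T -> \bar R}.
Local Notation X := (L2 mu).

Lemma linear_bounded (f : X -> X) : linear f -> continuous f ->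
  exists2 K, 0 <= K & forall x, `|f x| <= K * `|x|.
Proof.
move=> lf cf.
have f0 : f 0 = 0.
  by have := lf (-1) 0 0; rewrite scaler0 addr0 scaleN1r addNr.
have fZ a x : f (a *: x) = a *: f x by rewrite -[_ *: x]addr0 lf f0 addr0.
have [dl dl0 hdl] := (@continuous_atP R X X f 0).1 (cf 0) 1 ltr01.
exists (2 / dl) => [|x]; first by rewrite divr_ge0// ltW.
have [->|x0] := eqVneq x 0; first by rewrite f0 !normr0 mulr0.
have x0' : 0 < `|x| by rewrite normr_gt0.
have c0 : 0 < dl / 2 / `|x| by rewrite !divr_gt0.
have [c cE] : exists c, c = dl / 2 / `|x| by eexists.
rewrite -cE in c0.
have := hdl (c *: x); rewrite f0 !sub0r !normrN fZ !normrZ gtr0_norm//.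
rewrite {1}cE divfK ?gt_eqF// ltr_pdivrMr// => /(_ ltac:(lra)) /ltW h.
have -> : 2 / dl * `|x| = c^-1 by rewrite cE; field; rewrite !gt_eqF.
by rewrite -[leRHS]mulr1 -ler_pdivrMl ?invr_gt0// invrK.
Qed.

Lemma linear0' (f : X -> X) : linear f -> f 0 = 0.
Proof.
by move=> lf; have := lf (-1) 0 0; rewrite scaler0 addr0 scaleN1r addNr.
Qed.

Lemma linearB' (f : X -> X) x y : linear f -> f (x - y) = f x - f y.
Proof.
move=> lf; have -> : x - y = (-1) *: y + x by rewrite scaleN1r addrC.
by rewrite lf scaleN1r addrC.
Qed.

Lemma linearZ' (f : X -> X) a x : linear f -> f (a *: x) = a *: f x.
Proof. by move=> lf; rewrite -[_ *: x]addr0 lf linear0'// addr0. Qed.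

Lemma linearD' (f : X -> X) x y : linear f -> f (x + y) = f x + f y.
Proof. by move=> lf; rewrite -{1}[x]scale1r lf scale1r. Qed.

(** The functional x |-> <f x, p> is linear and continuous. *)
Lemma adjointP (f : X -> X) (p : X) : linear f -> continuous f ->
  exists q, forall x, dot (f x) p = dot x q.
Proof.
move=> lf cf; apply: riesz.
  by move=> a x y; rewrite lf dotDl dotZl.
move=> x; apply/(@continuous_atP R X R^o) => eps eps0.
have [dl dl0 hdl] := (@continuous_atP R X R^o (fun z => dot z p) (f x)).1 (@dot_continuous _ _ _ _ p (f x)) eps eps0.
have [dl' dl0' hdl'] := (@continuous_atP R X X f x).1 (cf x) dl dl0.
by exists dl' => // y /hdl' /hdl.
Qed.

End linear_maps.

Section semigroup.
Context d (T : measurableType d) (R : realType).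
Variable mu : {measure set T -> \bar R}.
Local Notation X := (L2 mu).
Variable S : R -> X -> X.
Hypothesis S_C0 : C0_semigroup S.

Lemma S_linear t : 0 <= t -> linear (S t).
Proof. by case: S_C0 => h _ _ _ /h[]. Qed.

Lemma S_continuous t : 0 <= t -> continuous (S t).
Proof. by case: S_C0 => h _ _ _ /h[]. Qed.

Lemma S_add s t x : 0 <= s -> 0 <= t -> S (s + t) x = S s (S t x).
Proof. by case: S_C0 => _ _ h _ s0 t0; rewrite h. Qed.

Lemma S_0 x : S 0 x = x.
Proof. by case: S_C0 => _ -> _ _. Qed.

Lemma S_right0 x (eps : R) : 0 < eps -> exists2 dl, 0 < dl &
  forall t, 0 <= t < dl -> `|S t x - x| < eps.
Proof.
move=> eps0; case: S_C0 => _ _ _ /(_ x) /cvgrPdist_lt /(_ _ eps0) [dl /= dl0 hdl].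
exists dl => // t /andP[]; rewrite le_eqVlt => /predU1P[<-|t0] td.
  by rewrite S_0 subrr normr0.
rewrite distrC; apply: (hdl t) => //=.
by rewrite sub0r normrN gtr0_norm.
Qed.

(** Uniform boundedness principle: otherwise points x_n and times t_n -> 0 would
    contradict the boundedness near 0 of each orbit. *)
Lemma S_bounded_near0 : exists dl M, [/\ 0 < dl, 0 <= M &
  forall t x, 0 <= t <= dl -> `|S t x| <= M * `|x|].
Proof.
apply: contrapT => hn.
have /choice[tx htx] : forall n : nat, exists tx : R * X,
    0 <= tx.1 <= n.+1%:R^-1 /\ n%:R * `|tx.2| < `|S tx.1 tx.2|.
  move=> n; apply: contrapT => h; apply: hn; exists (n.+1%:R^-1), n%:R; split => //.
  move=> t x tn; rewrite leNgt; apply/negP => hh; apply: h; by exists (t, x).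
pose F : set (X -> X) := [set f | exists n, f = S (tx n).1].
have Flin f : F f -> bounded_fun_norm f /\ linear f.
  move=> [n ->]; have [/andP[t0 _] _] := htx n.
  split; last exact: S_linear.
  have [K K0 hK] := linear_bounded (S_linear t0) (@S_continuous _ t0).
  by move=> r; exists (K * r) => x xr; rewrite (le_trans (hK x))// ler_wpM2l.
have Fpt : pointwise_bounded F.
  move=> x; have [dl dl0 hdl] := S_right0 x ltr01.
  have [N _ hN] : \forall n \near \oo, n.+1%:R^-1 < dl :> R.
    have : n.+1%:R^-1 @[n --> \oo] --> (0 : R) by exact: cvg_harmonic.
    move=> /cvgrPdist_lt /(_ _ dl0); apply: filterS => n.
    by rewrite sub0r normrN gtr0_norm ?invr_gt0.
  exists (`|x| + 1 + \sum_(n < N) `|S (tx n).1 x|) => _ [n ->].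
  have s0 : 0 <= \sum_(n < N) `|S (tx n).1 x| by apply: sumr_ge0.
  have [nN|Nn] := ltnP n N.
    rewrite (bigD1 (Ordinal nN))//= addrCA lerDl addr_ge0//.
    by rewrite sumr_ge0.
  have [/andP[t0 tn] _] := htx n.
  have := hdl (tx n).1; rewrite t0 (le_lt_trans tn (hN n Nn)) => /(_ isT) h.
  have -> : S (tx n).1 x = x + (S (tx n).1 x - x) by rewrite addrC subrK.
  rewrite (le_trans (ler_normD _ _))// -addrA lerD2l -[leLHS]addr0 lerD//.
  exact: ltW.
have [M hM] := Banach_Steinhauss Flin Fpt 1.
pose n := (Num.truncn M).+1.
have [/andP[t0 _] h] := htx n.
have x0 : 0 < `|(tx n).2|.
  rewrite normr_gt0; apply/eqP => e; move: h; rewrite e linear0' ?normr0 ?mulr0 ?ltxx//.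
  exact: S_linear.
have := hM _ (ex_intro _ n erefl) (`|(tx n).2|^-1 *: (tx n).2).
rewrite normrZ normfV normr_id mulVf ?gt_eqF// => /(_ (lexx _)).
rewrite linearZ'; last exact: S_linear.
rewrite normrZ normfV normr_id ler_pdivrMl// => h2.
have : M < n%:R by exact: truncnS_gt.
move=> Mn; have := lt_le_trans h h2.
by rewrite mulrC ltr_pM2l// ltNge (ltW Mn).
Qed.

Lemma S_time_continuous x t : 0 <= t -> forall eps : R, 0 < eps -> exists2 dl, 0 < dl &
  forall s, 0 <= s -> `|t - s| < dl -> `|S t x - S s x| < eps.
Proof.
move=> t0 eps eps0.
have [d0 [M [d00 M0 hM]]] := S_bounded_near0.
pose a := Num.max (t - d0) 0.
have a0 : 0 <= a by rewrite le_max lexx orbT.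
have [Ka Ka0 hKa] := linear_bounded (S_linear a0) (@S_continuous _ a0).
have [Kt Kt0 hKt] := linear_bounded (S_linear t0) (@S_continuous _ t0).
pose C := Ka * M + Kt + 1.
have C0 : 0 < C by rewrite ltr_wpDl// addr_ge0// mulr_ge0.
have [dl dl0 hdl] := S_right0 x (divr_gt0 eps0 C0).
exists (Num.min dl d0); first by rewrite lt_min dl0.
move=> s s0; rewrite lt_min => /andP[h1 h2].
have key K y : 0 <= K -> K <= C -> `|y| < eps / C -> K * `|y| < eps.
  move=> K0 KC; rewrite ltr_pdivlMr// mulrC; apply: le_lt_trans.
  by rewrite ler_wpM2r.
have [ts|st] := leP t s.
  have e : S s x = S t (S (s - t) x) by rewrite -S_add ?subr_ge0// addrC subrK.
  rewrite distrC e -linearB'; last exact: S_linear.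
  apply: le_lt_trans (hKt _) _; apply: key => //.
    by have := mulr_ge0 Ka0 M0; rewrite /C; lra.
  by apply: hdl; rewrite subr_ge0 ts/=; move: h1; rewrite ler0_norm ?subr_le0// opprB.
have e : S t x = S s (S (t - s) x).
  by rewrite -S_add// ?subr_ge0 1?ltW// addrC subrK.
rewrite e -linearB'; last exact: S_linear.
have as_ : a <= s.
  rewrite ge_max s0 andbT; move: h2; rewrite gtr0_norm ?subr_gt0//; lra.
have sa : s - a <= d0.
  have : t - d0 <= a by rewrite le_max lexx.
  lra.
have -> : S s (S (t - s) x - x) = S a (S (s - a) (S (t - s) x - x)).
  by rewrite -S_add ?subr_ge0// subrKC.
apply: le_lt_trans (hKa _) _.
apply: le_lt_trans (ler_wpM2l Ka0 (hM _ _ _)) _; first by rewrite subr_ge0 as_.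
rewrite mulrA; apply: key; first exact: mulr_ge0.
  by rewrite /C -addrA lerDl addr_ge0.
by apply: hdl; rewrite subr_ge0 (ltW st)/=; move: h1; rewrite gtr0_norm ?subr_gt0.
Qed.

Lemma S_max_continuous x : continuous (fun r : R => S (Num.max r 0) x).
Proof.
move=> r; apply/(@continuous_atP R R^o X) => eps eps0.
have m0 : 0 <= Num.max r 0 by rewrite le_max lexx orbT.
have [dl dl0 hdl] := S_time_continuous x m0 eps0.
exists dl => // s rs; apply: hdl; first by rewrite le_max lexx orbT.
by apply: le_lt_trans rs; exact: max0_dist.
Qed.

(** The derivative of an orbit at t is the image under S t of its derivative at 0. *)
Lemma generator_step v w t : generator S v w -> 0 <= t -> forall eps : R, 0 < eps ->
  exists2 dl, 0 < dl & forall k, 0 < k < dl ->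
    `|S (t + k) v - S t v - k *: S t w| <= eps * k.
Proof.
move=> gvw t0 eps eps0.
have [K K0 hK] := linear_bounded (S_linear t0) (@S_continuous _ t0).
have e2 : 0 < eps / (K + 1) by rewrite divr_gt0// ltr_wpDl.
have [dl /= dl0 hdl] := (cvgrPdist_lt _ _).1 gvw _ e2.
exists dl => // k /andP[k0 kd].
have -> : S (t + k) v - S t v - k *: S t w = S t (k *: (k^-1 *: (S k v - v) - w)).
  have lS := S_linear t0.
  rewrite (linearZ' _ _ lS) (linearB' _ _ lS) (linearZ' _ _ lS) (linearB' _ _ lS) -S_add ?(ltW k0)//.
  by rewrite scalerBr scalerA mulfV ?gt_eqF// scale1r.
rewrite (le_trans (hK _))// normrZ gtr0_norm// mulrCA mulrC ler_pM2r//.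
have := hdl k; rewrite /= sub0r normrN gtr0_norm// kd k0 => /(_ isT isT) /ltW.
rewrite distrC ler_pdivlMr ?ltr_wpDl// => h; apply: le_trans h.
by rewrite mulrC ler_wpM2l// lerDl.
Qed.

Lemma generator_S v w t : generator S v w -> 0 <= t -> generator S (S t v) (S t w).
Proof.
move=> gvw t0; apply/cvgrPdist_le => eps eps0.
have [dl dl0 hdl] := generator_step gvw t0 eps0.
exists dl => //= k /=; rewrite sub0r normrN => kd k0; rewrite gtr0_norm// in kd.
have := hdl k; rewrite k0 kd => /(_ isT).
have -> : S (t + k) v - S t v - k *: S t w = k *: (k^-1 *: (S k (S t v) - S t v) - S t w).
  rewrite scalerBr scalerA mulfV ?gt_eqF// scale1r -S_add ?(ltW k0)//.
  by rewrite [k + t]addrC.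
by rewrite normrZ gtr0_norm// mulrC ler_pM2r// distrC.
Qed.

End semigroup.

Lemma exchange_sub (R : realFieldType) (a b c e : R) : c + e = a + b -> e - a = b - c.
Proof. lra. Qed.

Lemma regroup_sub (V : zmodType) (a b u w : V) :
  (a - b) - (u - w) = - ((u - a) - (w - b)).
Proof. by rewrite !opprB addrACA [RHS]addrACA [w + a]addrC. Qed.

Section interval_integrals.
Context (R : realType).
Local Notation leb := (@lebesgue_measure R).

Lemma lebesgue_itv_lty (a b : R) : (leb `[a, b]%classic < +oo)%E.
Proof. by rewrite lebesgue_measure_itv; case: ifP => _; rewrite ?ltry. Qed.

Lemma lebesgue_itvE (a k : R) : 0 <= k -> fine (leb `[a, a + k]%classic) = k.
Proof.
rewrite le_eqVlt lebesgue_measure_itv/= lte_fin => /predU1P[<-|k0].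
  by rewrite addr0 ltxx.
by rewrite ltrDl k0 -EFinB /= addrAC subrr add0r.
Qed.

Lemma Rintegral_itv_split (g : R -> R) (a c b : R) : a <= c <= b ->
  leb.-integrable `[a, b] (EFin \o g) ->
  \int[leb]_(r in `[a, b]) g r = \int[leb]_(r in `[a, c]) g r + \int[leb]_(r in `[c, b]) g r.
Proof.
move=> /andP[ac cb] ig.
have := Rintegral_itvB (a := BLeft a) (b := BRight b) (x := c) ig.
rewrite !bnd_simp ac cb => /(_ isT isT).
rewrite Rintegral_itv_obnd_cbnd; first by move=> <-; rewrite addrC subrK.
apply: integrableS ig => //.
  by apply: subset_itvr; rewrite bnd_simp.
Qed.

Lemma continuous_itv_bounded (g : R -> R) (a b : R) : continuous g ->
  exists K, forall r, `[a, b]%classic r -> `|g r| <= K.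
Proof.
move=> cg; have [ab|ba] := leP a b; last first.
  exists 0 => r /=; rewrite in_itv/= => /andP[h1 h2].
  by have := le_trans h1 h2; rewrite leNgt ba.
have cn : continuous (fun r => `|g r|) by move=> r; apply: cvg_norm; exact: cg.
have [c _ hc] := EVT_max ab (continuous_subspaceT cn).
by exists `|g c| => r; exact: hc.
Qed.

End interval_integrals.

Section generator_dense.
Context d (T : measurableType d) (R : realType).
Variable mu : {measure set T -> \bar R}.
Local Notation X := (L2 mu).
Local Notation leb := (@lebesgue_measure R).
Hypothesis sep : exists q : nat -> X, forall x (eps : R), 0 < eps ->
  exists n, `|x - q n| < eps.
Variable S : R -> X -> X.
Hypothesis S_C0 : C0_semigroup S.
Variable x : X.

Let Sp (r : R) : X := S (Num.max r 0) x.

Let Sp_pos (r : R) : 0 <= r -> Sp r = S r x.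
Proof. by move=> r0; rewrite /Sp; congr (S _ x); exact/max_idPl. Qed.

Let Sp_dist (z : X) : continuous (fun r => `|Sp r - z|).
Proof.
move=> r; apply/(@continuous_atP R R^o R^o) => eps eps0.
have [dl dl0 hdl] := (@continuous_atP R R^o X Sp r).1 (@S_max_continuous _ _ _ _ _ S_C0 x r) eps eps0.
exists dl => // s /hdl; apply: le_lt_trans.
by apply: le_trans (ler_dist_dist _ _) _; rewrite opprB addrA subrK.
Qed.

Let Sp_borel (D : set (measurableTypeR R)) : measurable D -> borel_fun D Sp.
Proof.
move=> mD; apply: borel_of_dist => // z; apply: measurable_funTS.
by apply: continuous_measurable_fun; exact: Sp_dist.
Qed.

Let Sp_bounded a b : exists K, forall r, `[a, b]%classic r -> `|Sp r| <= K.
Proof.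
have [K hK] := continuous_itv_bounded a b (@Sp_dist 0).
by exists K => r /hK; rewrite subr0 normr_id.
Qed.

Let mI a b : measurable (`[a, b]%classic : set (measurableTypeR R)).
Proof. exact: measurable_itv. Qed.

Let J_exists : exists J : R -> R -> X, forall a b v,
  dot (J a b) v = \int[leb]_(r in `[a, b]) dot (Sp r) v.
Proof.
exists (fun a b => bochner_integral leb `[a, b] Sp) => a b v.
have [K hK] := Sp_bounded a b.
exact: (dot_bochner sep (mI a b) (lebesgue_itv_lty a b) (Sp_borel (mI a b)) hK).
Qed.

Let int_J a b v : leb.-integrable `[a, b] (EFin \o (fun r => dot (Sp r) v)).
Proof.
have [K hK] := Sp_bounded a b.
exact: (integrable_dot (mI a b) (lebesgue_itv_lty a b) (Sp_borel (mI a b)) hK).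
Qed.

Section mean.
Variable J : R -> R -> X.
Hypothesis dot_J : forall a b v, dot (J a b) v = \int[leb]_(r in `[a, b]) dot (Sp r) v.

Let J_near a k eps : 0 <= a -> 0 < k ->
  (forall r, a <= r <= a + k -> `|S r x - S a x| <= eps) ->
  `|J a (a + k) - k *: S a x| <= k * eps.
Proof.
move=> a0 k0 h; set w := J a (a + k) - k *: S a x.
have [->|w0] := eqVneq w 0.
  rewrite normr0 mulr_ge0 ?(ltW k0)//.
  by apply: le_trans (h a _); rewrite ?normr_ge0// lexx lerDl ltW.
have w0' : 0 < `|w| by rewrite normr_gt0.
rewrite -(ler_pM2r w0') -expr2 L2_normE {1}/w dotBl dotZl dot_J.
have ic (c : R) : leb.-integrable `[a, (a + k)] (EFin \o cst c).
  apply: (bounded_integrable (mI _ _) (lebesgue_itv_lty _ _) (K := `|c|)) => //.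
have -> : k * dot (S a x) w = \int[leb]_(r in `[a, (a + k)]) (cst (dot (S a x) w) r).
  by rewrite Rintegral_cst//= lebesgue_itvE ?(ltW k0)// mulrC.
rewrite -(RintegralB (mI _ _) (int_J _ _ _) (ic _)).
apply: (@le_trans _ _ (\int[leb]_(r in `[a, (a + k)]) (cst (eps * `|w|) r))).
  apply: le_Rintegral => //; first by apply: integrable_subR => //; exact: int_J.
  move=> r /=; rewrite in_itv/= => rak; have /andP[ar _] := rak.
  rewrite -dotBl Sp_pos ?(le_trans a0)// (le_trans (dot_le _ _))// ler_wpM2r//.
  exact: h.
by rewrite Rintegral_cst//= lebesgue_itvE ?(ltW k0)// mulrC mulrA.
Qed.

Let J_shift h k : 0 <= h -> 0 <= k -> S k (J 0 h) - J 0 h = J h (h + k) - J 0 k.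
Proof.
move=> h0 k0; apply: dot_inj => v.
have [q hq] := adjointP v (S_linear S_C0 k0) (@S_continuous _ _ _ _ _ S_C0 k k0).
rewrite (dotBl (S k (J 0 h)) (J 0 h)) (dotBl (J h (h + k)) (J 0 k)) hq.
rewrite (dot_J 0 h q) (dot_J 0 h v) (dot_J h (h + k) v) (dot_J 0 k v).
have e1 : \int[leb]_(r in `[0, h]) dot (Sp r) q = \int[leb]_(r in `[k, (h + k)]) dot (Sp r) v.
  have sE : shift1 k @^-1` `[k, (h + k)] = `[0, h]%classic.
    by apply/seteqP; split=> r; rewrite /shift1 /= !in_itv/= lerDr lerD2r.
  have eqI : {in `[0, h]%classic, forall r, dot (Sp r) q = dot (Sp (r + k)) v}.
    move=> r; rewrite inE /= in_itv/= => /andP[r0 _].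
    by rewrite -hq !Sp_pos ?addr_ge0// addrC (S_add S_C0).
  transitivity (\int[leb]_(r in `[0, h]) dot (Sp (r + k)) v); first exact: eq_Rintegral.
  rewrite -sE.
  have mg : measurable_fun setT (fun r : measurableTypeR R => dot (Sp r) v).
    exact: (borel_compR measurableT (Sp_borel measurableT) (@dot_continuous _ _ _ _ v)).
  apply: (Rintegral_shift1 (f := fun r => dot (Sp r) v)) => //.
  rewrite sE; apply: eq_integrable (int_J 0 h q) => // r r0h /=.
  by rewrite eqI.
have e2 := Rintegral_itv_split (a := 0) (c := k) (b := h + k) _ (int_J 0 (h + k) v).
have e3 := Rintegral_itv_split (a := 0) (c := h) (b := h + k) _ (int_J 0 (h + k) v).
rewrite e1.
have := e2; rewrite k0 lerDr h0 => /(_ isT) e2'.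
have := e3; rewrite h0 lerDl k0 => /(_ isT) e3'.
have {}e2' := etrans (esym e2') e3'.
exact: exchange_sub.
Qed.

(** The averages h^-1 \int_0^h S r x dr tend to x and belong to the domain: the
    difference quotient of such an average telescopes to h^-1 (S h x - x). *)
Lemma mean_dense (eps : R) : 0 < eps ->
  exists v w, generator S v w /\ `|x - v| <= eps.
Proof.
move=> eps0.
have [dl dl0 hdl] := S_right0 S_C0 x eps0.
pose h := dl / 2.
have h0 : 0 < h by rewrite divr_gt0.
have hd : h < dl by rewrite /h; lra.
exists (h^-1 *: J 0 h), (h^-1 *: (S h x - x)); split; last first.
  have : `|J 0 (0 + h) - h *: S 0 x| <= h * eps.
    apply: J_near => // r; rewrite add0r => /andP[r0 rh].
    by rewrite (S_0 S_C0) ltW// hdl// r0 (le_lt_trans rh).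
  rewrite add0r (S_0 S_C0) => hJ.
  have -> : x - h^-1 *: J 0 h = - (h^-1 *: (J 0 h - h *: x)).
    by rewrite scalerBr scalerA mulVf ?gt_eqF// scale1r opprB.
  by rewrite normrN normrZ gtr0_norm ?invr_gt0// ler_pdivrMl.
apply/cvgrPdist_le => e e0.
have e2 : 0 < e * h / 2 by rewrite divr_gt0// mulr_gt0.
have [d1 d10 hd1] := S_time_continuous S_C0 x (ltW h0) e2.
have [d2 d20 hd2] := S_right0 S_C0 x e2.
exists (Num.min d1 d2) => /=; first by rewrite lt_min d10.
move=> k /=; rewrite sub0r normrN => kd k0; move: kd; rewrite gtr0_norm// lt_min => /andP[kd1 kd2].
have -> : h^-1 *: (S h x - x) - k^-1 *: (S k (h^-1 *: J 0 h) - h^-1 *: J 0 h) =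
  - ((h^-1 * k^-1) *: ((J h (h + k) - k *: S h x) - (J 0 k - k *: x))).
  rewrite (linearZ' _ _ (S_linear S_C0 (ltW k0))) -scalerBr (J_shift (ltW h0) (ltW k0)).
  rewrite scalerA [k^-1 * _]mulrC.
  have -> : h^-1 *: (S h x - x) = (h^-1 * k^-1) *: (k *: (S h x - x)).
    by rewrite scalerA -mulrA mulVf ?gt_eqF// mulr1.
  rewrite -scalerBr -scalerN; congr (_ *: _).
  rewrite scalerBr; exact: regroup_sub.
rewrite normrN normrZ gtr0_norm ?mulr_gt0 ?invr_gt0//.
have j1 : `|J h (h + k) - k *: S h x| <= k * (e * h / 2).
  apply: J_near => //; first exact: ltW.
  move=> r /andP[hr rhk]; rewrite distrC ltW// hd1 ?(le_trans (ltW h0))//.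
  by rewrite ler0_norm ?subr_le0// opprB; apply: le_lt_trans kd1; rewrite lerBlDl.
have j2 : `|J 0 k - k *: x| <= k * (e * h / 2).
  have := @J_near 0 k (e * h / 2); rewrite add0r (S_0 S_C0); apply=> // r /andP[r0 rk].
  by rewrite ltW// hd2// r0 (le_lt_trans rk).
have := le_trans (ler_normB _ _) (lerD j1 j2).
rewrite -mulrDr -splitr => hh.
rewrite -invfM ler_pdivrMl ?mulr_gt0//.
apply: le_trans hh _.
have -> : h * k * e = k * (e * h) by ring.
exact: lexx.
Qed.

End mean.

Lemma generator_domain_dense (eps : R) : 0 < eps ->
  exists v w, generator S v w /\ `|x - v| <= eps.
Proof. by have [J dot_J] := J_exists; exact: (mean_dense dot_J). Qed.

End generator_dense.

(** * Lyapunov functions, contraction and positivity *)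

Lemma dini_quadratic (R : realFieldType) (n s eps k e : R) : 0 <= n -> 0 <= s -> 0 < eps ->
  e = eps / (4 * (n + 1)) -> 0 < k < eps / (2 * (s + e + 1) ^+ 2) ->
  2 * n * (e * k) + (k * s + e * k) ^+ 2 <= eps * k.
Proof.
move=> n0 s0 eps0 eE /andP[k0 kd].
have e0 : 0 < e by rewrite eE divr_gt0// mulr_gt0//; lra.
have h1 : 2 * n * e <= eps / 2.
  rewrite eE mulrA ler_pdivrMr; last by rewrite mulr_gt0//; lra.
  nra.
have q0 : 0 < 2 * (s + e + 1) ^+ 2 by rewrite mulr_gt0// exprn_gt0//; lra.
rewrite ltr_pdivlMr// in kd.
have h2 : k * (s + e) ^+ 2 <= eps / 2.
  have : k * (s + e) ^+ 2 <= k * (s + e + 1) ^+ 2.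
    by rewrite ler_pM2l// ler_pXn2r ?nnegrE//; lra.
  lra.
have -> : 2 * n * (e * k) + (k * s + e * k) ^+ 2 = (2 * n * e + k * (s + e) ^+ 2) * k by ring.
by rewrite ler_pM2r//; lra.
Qed.

Lemma min0_add (R : realFieldType) (a c : R) : `|Num.min (a + c) 0| <= `|Num.min a 0 + c|.
Proof.
have [ac|ac] := ltP (a + c) 0; last by rewrite normr0.
rewrite ltr0_norm//; have [a0|a0] := ltP a 0; first by rewrite ltr0_norm.
by rewrite add0r ler_normr; apply/orP; right; lra.
Qed.

Section dissipative.
Context d (T : measurableType d) (R : realType).
Variable mu : {measure set T -> \bar R}.
Local Notation X := (L2 mu).
Hypothesis sep : exists q : nat -> X, forall x (eps : R), 0 < eps ->
  exists n, `|x - q n| < eps.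
Variable S : R -> X -> X.
Hypothesis S_C0 : C0_semigroup S.

(** Along orbits in the domain |P x|^2 is nonincreasing by [dini_nonincreasing], as
    its increment over a short time k is at most 2 k <P x, A x> + o(k).  The
    domain is dense and both sides are continuous in x. *)
Section lyapunov.
Variable P : X -> X.
Hypothesis P_lip : forall x y, `|P x - P y| <= `|x - y|.
Hypothesis P_quad : forall x h, `|P (x + h)| ^+ 2 <= `|P x| ^+ 2 + 2 * dot (P x) h + `|h| ^+ 2.
Hypothesis P_diss : forall v w, generator S v w -> dot w (P v) <= 0.

Lemma lyapunov_domain v w t : generator S v w -> 0 <= t -> `|P (S t v)| <= `|P v|.
Proof.
move=> gvw t0; rewrite -(ler_pXn2r (n := 2))// ?nnegrE//.
rewrite -{2}(S_0 S_C0 v).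
apply: (dini_nonincreasing (g := fun t => `|P (S t v)| ^+ 2)) t0 => {t} t t0 eps eps0.
- pose n := `|P (S t v)|.
  have n0 : 0 <= n by exact: normr_ge0.
  have m0 : 0 < Num.min 1 (eps / (2 * n + 1)).
    by rewrite lt_min ltr01 divr_gt0//; lra.
  have [dl dl0 hdl] := S_time_continuous S_C0 v t0 m0.
  exists dl => // s s0 /(hdl s s0); rewrite lt_min => /andP[h1 h2].
  rewrite ltr_pdivlMr in h2; last lra.
  rewrite subr_sqr normrM (ger0_norm (addr_ge0 (normr_ge0 (P (S t v))) (normr_ge0 (P (S s v))))).
  have h3 : `|(`|P (S t v)| - `|P (S s v)|)| <= `|S t v - S s v|.
    exact: le_trans (ler_dist_dist _ _) (P_lip _ _).
  have h4 : `|P (S t v)| + `|P (S s v)| <= 2 * n + 1.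
    have := le_trans (ler_norm _) (le_trans (ler_dist_dist (P (S s v)) (P (S t v))) (P_lip _ _)).
    rewrite [`|S s v - S t v|]distrC => h4.
    have := le_lt_trans h4 h1; rewrite -/n; lra.
  by apply: le_lt_trans h2; apply: ler_pM; rewrite ?addr_ge0.
- pose n := `|P (S t v)|; pose s := `|S t w|.
  have [e eE] : exists e, e = eps / (4 * (n + 1)) by eexists.
  have n0 : 0 <= n by exact: normr_ge0.
  have s0 : 0 <= s by exact: normr_ge0.
  have e0 : 0 < e by rewrite eE divr_gt0// mulr_gt0//; lra.
  have [dl dl0 hdl] := generator_step S_C0 gvw t0 e0.
  have q0 : 0 < eps / (2 * (s + e + 1) ^+ 2).
    by rewrite divr_gt0// mulr_gt0// exprn_gt0//; lra.
  exists (Num.min dl (eps / (2 * (s + e + 1) ^+ 2))); first by rewrite lt_min dl0.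
  move=> k /andP[k0]; rewrite lt_min => /andP[kd kq].
  have := hdl k; rewrite k0 kd => /(_ isT).
  set r := _ - _ => hr.
  have -> : S (t + k) v = S t v + (k *: S t w + r) by rewrite /r !subrKC.
  have dw := P_diss (generator_S S_C0 gvw t0).
  apply: (le_trans (P_quad _ _)); rewrite -addrA lerD2l.
  have k0q : 0 < k < eps / (2 * (s + e + 1) ^+ 2) by rewrite k0.
  apply: le_trans (dini_quadratic n0 s0 eps0 eE k0q).
  apply: lerD.
    rewrite -mulrA ler_pM2l// dotDr dotZr.
    apply: (@le_trans _ _ (0 + n * (e * k))); last by rewrite add0r.
    apply: lerD; first by rewrite dotC pmulr_rle0.
    by apply: le_trans (dot_le _ _) _; rewrite ler_wpM2l.
  rewrite ler_pXn2r ?nnegrE ?addr_ge0 ?mulr_ge0 ?(ltW k0) ?(ltW e0)//.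
  by rewrite (le_trans (ler_normD _ _))// lerD// normrZ gtr0_norm.
Qed.

Lemma lyapunov x t : 0 <= t -> `|P (S t x)| <= `|P x|.
Proof.
move=> t0; apply/ler_addgt0Pr => eps eps0.
have [K K0 hK] := linear_bounded (S_linear S_C0 t0) (@S_continuous _ _ _ _ _ S_C0 t t0).
have K1 : 0 < K + 1 by rewrite ltr_wpDl.
have e2 : 0 < eps / (K + 1) by rewrite divr_gt0.
have [v [w [gvw xv]]] := generator_domain_dense sep S_C0 x e2.
have h1 := lyapunov_domain gvw t0.
have h2 : `|P (S t x)| <= `|P (S t v)| + `|S t x - S t v|.
  rewrite -lerBlDl; apply: le_trans (ler_norm _) _.
  exact: le_trans (ler_dist_dist _ _) (P_lip _ _).
have h3 : `|P v| <= `|P x| + `|x - v|.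
  rewrite -lerBlDl; apply: le_trans (ler_norm _) _.
  by apply: le_trans (ler_dist_dist _ _) _; rewrite [leRHS]distrC; exact: P_lip.
have h4 : `|S t x - S t v| <= K * `|x - v|.
  by rewrite -(linearB' _ _ (S_linear S_C0 t0)).
have h5 : (K + 1) * `|x - v| <= eps by rewrite mulrC -ler_pdivlMr.
rewrite mulrDl mul1r in h5.
have h6 := le_trans h2 (lerD h1 h4).
apply: (le_trans h6); apply: le_trans (lerD h3 (lexx _)) _.
by rewrite -addrA lerD2l addrC.
Qed.

End lyapunov.

Definition L2_nonneg (x : X) : Prop := \forall xi \ae mu, 0 <= x xi.

Hypothesis mu_fin : (mu setT < +oo)%E.

Definition negpart (x : X) : X := L2_map (fun r => Num.min r 0) x.

Lemma lip1_min0 : lip1 (fun r : R => Num.min r 0).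
Proof.
move=> a b.
have -> : Num.min a 0 - Num.min b 0 = - (Num.max (- a) 0 - Num.max (- b) 0).
  by rewrite -[Num.min a 0]opprK -[Num.min b 0]opprK !oppr_min oppr0 -opprD.
by rewrite normrN (le_trans (max0_dist _ _))// -opprD normrN.
Qed.

(** r |-> (min (r, 0))^2 lies below its tangent parabolas with the same leading
    coefficient. *)
Lemma negpart_quad (x h : X) :
  `|negpart (x + h)| ^+ 2 <= `|negpart x| ^+ 2 + 2 * dot (negpart x) h + `|h| ^+ 2.
Proof.
rewrite -normD2 ler_pXn2r ?nnegrE//; apply: L2_norm_le.
apply: filterS3 (filterI (L2_mapE mu_fin x lip1_min0) (L2_mapE mu_fin (x + h) lip1_min0))
  (L2_addE x h) (L2_addE (negpart x) h) => xi [h1 h2] h3 ->.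
rewrite /negpart h1 h2 h3; set a := x xi; set c := h xi.
exact: min0_add.
Qed.

(** Positivity is the vanishing of a Lipschitz map, hence a closed condition to
    which [lyapunov] applies. *)
Lemma negpart_nonneg x : L2_nonneg x <-> negpart x = 0.
Proof.
split=> [x0|e].
  apply/L2_eqP; apply: filterS3 x0 (L2_mapE mu_fin x lip1_min0) (L2_zeroE mu) => xi h1 h2 ->.
  by rewrite /negpart h2; apply/min_idPr.
have := L2_mapE mu_fin x lip1_min0; rewrite -/(negpart x) e => h.
apply: filterS2 h (L2_zeroE mu) => xi -> /eqP; rewrite eq_minr.
by [].
Qed.

Lemma semigroup_contraction x t : (forall v w, generator S v w -> dot w v <= 0) ->
  0 <= t -> `|S t x| <= `|x|.
Proof.
move=> h; apply: (lyapunov (P := id)) => // {}x k.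
by rewrite normD2.
Qed.

Lemma semigroup_nonneg x t : (forall v w, generator S v w -> dot w (negpart v) <= 0) ->
  0 <= t -> L2_nonneg x -> L2_nonneg (S t x).
Proof.
move=> h t0 /negpart_nonneg x0; apply/negpart_nonneg/eqP.
rewrite -normr_le0 -[leRHS](normr0 X) -x0.
apply: lyapunov => //; last exact: negpart_quad.
by move=> a b; apply: L2_map_lip => //; exact: lip1_min0.
Qed.

End dissipative.

(** * Smooth functions of two variables *)

Lemma shift_continuous_nm (R : realType) (V : normedModType R) (a : V) :
  continuous (fun y : V => y + a).
Proof. by move=> x; apply: cvgD; [exact: cvg_id|exact: cvg_cst]. Qed.

Section smooth_calculus.
Context (R : realType).
Implicit Types (psi phi : R * R -> R).

(** Smoothness quantifies over iterated derivatives.  It is shown by exhibiting a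
    class of functions stable under all directional derivatives. *)
Lemma smooth_coind (P : (R * R -> R) -> Prop) :
  (forall phi, P phi -> [/\ continuous phi, forall x v, derivable phi x v & forall v, P ('D_v phi)]) ->
  forall phi, P phi -> smooth phi.
Proof.
move=> hP phi Pphi vs.
have : P (foldr (fun v f => 'D_v f) phi vs).
  by elim: vs => [//|v vs IH] /=; have [_ _] := hP _ IH; apply.
by move=> /hP[].
Qed.

Lemma smooth_continuous psi : smooth psi -> continuous psi.
Proof. by move=> /(_ [::])[]. Qed.

Lemma smooth_derivable psi x v : smooth psi -> derivable psi x v.
Proof. by move=> /(_ [::])[_]; apply. Qed.

Lemma smooth_derive psi v : smooth psi -> smooth ('D_v psi).
Proof.
move=> h vs; have := h (rcons vs v).
by rewrite -cats1 foldr_cat.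
Qed.

Lemma smooth_cst (c : R) : smooth (cst c).
Proof.
apply: (@smooth_coind (fun phi => exists c, phi = cst c)); last by exists c.
move=> _ [a ->]; split.
- by move=> x; exact: cst_continuous.
- by move=> x v; exact: derivable_cst.
- by move=> v; exists 0; apply/funext => x; rewrite derive_cst.
Qed.

Lemma smoothD psi phi : smooth psi -> smooth phi -> smooth (psi + phi).
Proof.
move=> s1 s2.
apply: (@smooth_coind (fun f => exists g h, [/\ smooth g, smooth h & f = g + h]));
  last by exists psi, phi.
move=> _ [g [h [sg sh ->]]]; split.
- by move=> x; apply: continuousD; exact: smooth_continuous.
- by move=> x v; apply: derivableD; exact: smooth_derivable.
- move=> v; exists ('D_v g), ('D_v h); split; try exact: smooth_derive.
  by apply/funext => x; rewrite deriveD//; exact: smooth_derivable.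
Qed.

Lemma smoothM psi phi : smooth psi -> smooth phi -> smooth (psi * phi).
Proof.
move=> s1 s2.
pose ev (s : seq ((R * R -> R) * (R * R -> R))) : R * R -> R := \sum_(p <- s) p.1 * p.2.
pose good (s : seq ((R * R -> R) * (R * R -> R))) :=
  forall p, List.In p s -> smooth p.1 /\ smooth p.2.
apply: (@smooth_coind (fun f => exists2 s, good s & f = ev s)); last first.
  exists [:: (psi, phi)]; last by rewrite /ev big_seq1.
  by move=> p [<-|//]; exact: (conj s1 s2).
move=> _ [s gs ->].
elim: s gs => [|[f g] s IH] gs.
  rewrite /ev big_nil; have -> : (0 : R * R -> R) = cst 0 by [].
  split; first by move=> x; exact: cst_continuous.
    by move=> x v; exact: derivable_cst.
  move=> v; exists [::] => //; rewrite big_nil.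
  by apply/funext => x; rewrite derive_cst.
have [sf sg] := gs (f, g) (or_introl erefl).
have [cI dI DI] := IH (fun p ps => gs p (or_intror ps)).
have evE : ev ((f, g) :: s) = f * g + ev s by rewrite /ev big_cons.
rewrite evE.
have dfg x v : derivable (f * g) x v by apply: derivableM; exact: smooth_derivable.
split.
- move=> x; apply: continuousD; last exact: cI.
  by apply: continuousM; exact: smooth_continuous.
- by move=> x v; apply: derivableD.
- move=> v; have [s' gs' e'] := DI v.
  exists [:: (f, 'D_v g), (g, 'D_v f) & s'].
    move=> p [<-|[<-|]]; [exact: (conj sf (smooth_derive v sg))
      |exact: (conj sg (smooth_derive v sf))|exact: gs'].
  rewrite /ev !big_cons -/(ev s') -e'; apply/funext => x.
  rewrite deriveD// deriveM; try exact: smooth_derivable.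
  by rewrite -addrA.
Qed.

Lemma smoothX psi n : smooth psi -> smooth (psi ^+ n).
Proof.
move=> sp; elim: n => [|n IH]; first by rewrite expr0; exact: (smooth_cst 1).
by rewrite exprS; exact: smoothM.
Qed.

Lemma smooth_fst : smooth (fst : R * R -> R).
Proof.
apply: (@smooth_coind (fun f => smooth f \/ f = fst)); last by right.
move=> f [sf|->].
  split; [exact: smooth_continuous|by move=> x v; exact: smooth_derivable|].
  by move=> v; left; exact: smooth_derive.
have h (x v : R * R) : (fun h => h^-1 *: ((fst \o shift x) (h *: v) - fst x)) @ 0^' --> v.1.
  apply: cvg_near_cst; near=> t; rewrite /= /shift /= addrK.
  by rewrite scalerA mulVf ?scale1r//; near: t; exact: nbhs_dnbhs_neq.
split; first by move=> x; exact: cvg_fst.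
  by move=> x v; apply/cvg_ex; exists v.1; exact: h.
move=> v; left; have -> : 'D_v (fst : R * R -> R) = cst v.1.
  by apply/funext => x; apply: cvg_lim => //; exact: h.
exact: smooth_cst.
Unshelve. all: by end_near. Qed.

Lemma smooth_snd : smooth (snd : R * R -> R).
Proof.
apply: (@smooth_coind (fun f => smooth f \/ f = snd)); last by right.
move=> f [sf|->].
  split; [exact: smooth_continuous|by move=> x v; exact: smooth_derivable|].
  by move=> v; left; exact: smooth_derive.
have h (x v : R * R) : (fun h => h^-1 *: ((snd \o shift x) (h *: v) - snd x)) @ 0^' --> v.2.
  apply: cvg_near_cst; near=> t; rewrite /= /shift /= addrK.
  by rewrite scalerA mulVf ?scale1r//; near: t; exact: nbhs_dnbhs_neq.
split; first by move=> x; exact: cvg_snd.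
  by move=> x v; apply/cvg_ex; exists v.2; exact: h.
move=> v; left; have -> : 'D_v (snd : R * R -> R) = cst v.2.
  by apply/funext => x; apply: cvg_lim => //; exact: h.
exact: smooth_cst.
Unshelve. all: by end_near. Qed.

Lemma diff_quotient_shift psi (a v x : R * R) :
  (fun h : R => h^-1 *: (((fun y => psi (y + a)) \o shift x) (h *: v) - psi (x + a))) =
  (fun h : R => h^-1 *: ((psi \o shift (x + a)) (h *: v) - psi (x + a))).
Proof. by apply/funext => h /=; congr (_ *: (psi _ - _)); rewrite addrA. Qed.

Lemma derive_shiftE psi (a v x : R * R) : 'D_v (fun y => psi (y + a)) x = 'D_v psi (x + a).
Proof. by rewrite /derive diff_quotient_shift. Qed.

Lemma derivable_shiftE psi (a v x : R * R) :
  derivable (fun y => psi (y + a)) x v = derivable psi (x + a) v.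
Proof. by rewrite /derivable diff_quotient_shift. Qed.

Lemma smooth_shift psi (a : R * R) : smooth psi -> smooth (fun y => psi (y + a)).
Proof.
move=> sp; apply: (@smooth_coind (fun f => exists2 g, smooth g & f = fun y => g (y + a)));
  last by exists psi.
move=> _ [g sg ->]; split.
- rewrite -[fun y => _]/(g \o (fun y => y + a)) => x.
  apply: continuous_comp; first exact: shift_continuous_nm.
  exact: smooth_continuous.
- by move=> x v; rewrite derivable_shiftE; exact: smooth_derivable.
- by move=> v; exists ('D_v g); [exact: smooth_derive|apply/funext => x; rewrite derive_shiftE].
Qed.

Lemma is_derive_line psi (x e : R * R) (s : R) : smooth psi ->
  is_derive s 1 (fun s : R => psi (x + s *: e)) ('D_e psi (x + s *: e)).
Proof.
move=> sp.
have E : (fun h : R => h^-1 *: (((fun s : R => psi (x + s *: e)) \o shift s) (h *: 1) - psi (x + s *: e))) =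
   (fun h : R => h^-1 *: ((psi \o shift (x + s *: e)) (h *: e) - psi (x + s *: e))).
  apply/funext => h /=; congr (_ *: (psi _ - _)).
  by rewrite [h *: 1]mulr1 scalerDl addrCA.
have := @smooth_derivable psi (x + s *: e) e sp; rewrite /derivable => dd.
apply: DeriveDef; first by rewrite /derivable E.
by rewrite /derive E.
Qed.

Lemma line_mvt psi (x e : R * R) (k : R) : smooth psi ->
  exists2 c, `|c| <= `|k| & psi (x + k *: e) - psi x = k * 'D_e psi (x + c *: e).
Proof.
move=> sp; pose f s : R := psi (x + s *: e).
have df (s : R) : is_derive s (1 : R) f ('D_e psi (x + s *: e)) by exact: is_derive_line.
have cf : continuous f.
  move=> s; apply: differentiable_continuous; apply/derivable1_diffP.
  by have [] := df s.
have f0 : f 0 = psi x by rewrite /f scale0r addr0.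
have [k0|k0|k0] := ltgtP 0 k.
- have [c] := MVT k0 (fun s _ => df s) (continuous_subspaceT cf).
  rewrite in_itv/= => /andP[c0 ck] h; exists c; last by rewrite -f0 -/(f k) h subr0 mulrC.
  by rewrite !gtr0_norm// ltW.
- have [c] := MVT k0 (fun s _ => df s) (continuous_subspaceT cf).
  rewrite in_itv/= => /andP[ck c0] h; exists c; last first.
    by rewrite -f0 -/(f k) -opprB h sub0r mulrN opprK mulrC.
  by rewrite !ltr0_norm// lerN2 ltW.
- by exists 0; rewrite -?k0 ?normr0// scale0r addr0 subrr mul0r.
Qed.

(** Two applications of the mean value theorem; only the derivatives along e matter. *)
Lemma line_taylor psi (x e : R * R) (k C : R) : smooth psi ->
  (forall y, `|'D_e ('D_e psi) y| <= C) ->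
  `|psi (x + k *: e) - psi x - k * 'D_e psi x| <= C * k ^+ 2.
Proof.
move=> sp hC; have [c ck ->] := line_mvt x e k sp.
have [c' _] := line_mvt x e c (smooth_derive e sp).
rewrite -mulrBr => ->; rewrite !normrM mulrA mulrC ler_pM ?mulr_ge0//.
by rewrite -[leRHS]real_normK ?num_real// expr2 ler_wpM2l.
Qed.

End smooth_calculus.

(** * Integrals over the domain and over the plane *)

Section plane_measure.
Context (R : realType).
Local Notation leb := (@lebesgue_measure R).
Local Notation leb2 := (leb \x leb)%E.

Lemma continuous_measurable_plane (f : R * R -> R) : continuous f ->
  measurable_fun setT (f : plane R -> R).
Proof.
move=> cf; apply: (measurability _ (RGenOpens.measurableE R)) => _ [_ [a [b ->]] <-].
rewrite setTI; apply: open_measurable_plane.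
by apply: open_comp; [move=> x _; exact: cf|exact: interval_open].
Qed.

Lemma integrable_shift2 (a : R * R) (f : plane R -> R) :
  leb2.-integrable setT (EFin \o f) -> leb2.-integrable setT (EFin \o (f \o shift2 a)).
Proof.
move=> /integrableP[mf fi]; apply/integrableP; split.
  by apply: (measurableT_comp mf); exact: measurable_shift2.
have m0 : measurable_fun setT (abse \o (EFin \o f)) by apply: measurableT_comp.
have := @ge0_integral_pushforward _ _ _ _ R (shift2 a) (measurable_shift2 a) leb2 setT
  (abse \o (EFin \o f)) measurableT m0 (fun _ _ => abse_ge0 _).
rewrite preimage_setT => h.
apply: (@le_lt_trans _ _ (\int[leb2]_(x in setT) (((abse \o (EFin \o f)) \o shift2 a) x))%E).
  exact: lexx.
rewrite -h; apply: le_lt_trans fi; rewrite le_eqVlt; apply/orP; left; apply/eqP.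
by apply: eq_measure_integral => A mA _; exact: lebesgue_shift2.
Qed.

Lemma Rintegral_shift_plane (a : R * R) (f : plane R -> R) :
  leb2.-integrable setT (EFin \o f) ->
  \int[leb2]_x f (shift2 a x) = \int[leb2]_x f x.
Proof.
move=> fi; have mf : measurable_fun setT f by apply/measurable_EFinP; exact: measurable_int fi.
have := @Rintegral_shift2 R a setT f measurableT mf.
by rewrite preimage_setT => -> //; exact: integrable_shift2.
Qed.

Variables (Xi : set (R * R)) (Xi_open : open Xi).
Local Notation mu := (domain_measure Xi_open).

Lemma mXi : measurable (Xi : set (plane R)).
Proof. exact: open_measurable_plane. Qed.

Lemma integrable_domain (f : plane R -> R) : mu.-integrable setT (EFin \o f) ->
  leb2.-integrable setT (EFin \o (f \_ Xi)).
Proof.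
move=> fi.
have -> : EFin \o (f \_ Xi) = (EFin \o f) \_ Xi by rewrite restrict_EFin.
apply: (@integrable_mkcond _ (plane R) R leb2 Xi (EFin \o f) mXi).1.
have fX : mu.-integrable (Xi : set (plane R)) (EFin \o f).
  exact: (integrableS measurableT mXi (@subsetT _ _) fi).
move: fX => /integrableP[mf h]; apply/integrableP; split; first exact: mf.
apply: le_lt_trans h; rewrite le_eqVlt; apply/orP; left; apply/eqP.
apply: eq_measure_integral => A mA AX; rewrite /= /domain_measure /mrestr.
by congr (leb2 _); apply/esym/setIidPl.
Qed.

Lemma integral_domain (f : plane R -> R) : mu.-integrable setT (EFin \o f) ->
  (\int[mu]_x (f x)%:E = \int[leb2]_(x in (Xi : set (plane R))) (f x)%:E)%E.
Proof.
move=> fi.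
have n0 : mu (~` Xi) = 0%E by rewrite /domain_measure /mrestr setICl measure0.
transitivity (\int[mu]_(x in setT `\` ~` Xi) (f x)%:E)%E.
  apply: (negligible_integral _ measurableT fi n0).
  by apply: measurableC; exact: mXi.
rewrite setTD setCK.
apply: eq_measure_integral => A mA AX; rewrite /= /domain_measure /mrestr.
by congr (leb2 _); apply/setIidPl.
Qed.

Lemma Rintegral_domain (f : plane R -> R) : mu.-integrable setT (EFin \o f) ->
  \int[mu]_x f x = \int[leb2]_x (f \_ Xi) x.
Proof.
move=> fi; transitivity (\int[leb2]_(x in (Xi : set (plane R))) f x); last exact: Rintegral_mkcond.
by rewrite /Rintegral (integral_domain fi).
Qed.

Lemma integrable_to_domain (f : plane R -> R) :
  leb2.-integrable setT (EFin \o f) -> mu.-integrable setT (EFin \o f).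
Proof.
move=> /integrableP[mf h]; apply/integrableP; split; first exact: mf.
apply: le_lt_trans h.
have ma : measurable_fun setT (fun x => `|(EFin \o f) x|%E) by apply: measurableT_comp.
apply: ge0_le_measure_integral => // A mA.
by rewrite /= /domain_measure /mrestr; apply: le_measure; rewrite ?inE//; apply: measurableI => //; exact: mXi.
Qed.

End plane_measure.

(** * Test functions *)

Lemma line_cvg (R : realType) (V : normedModType R) (v x : V) :
  (fun h : R => h *: v + x) @ 0^' --> x.
Proof.
apply: cvg_within_filter.
have : h *: v + x @[h --> (0 : R)] --> 0 *: v + x.
  by apply: cvgD; [apply: cvgZ; [exact: cvg_id|exact: cvg_cst]|exact: cvg_cst].
by rewrite scale0r add0r.
Qed.

Lemma line_cvg2 (R : realType) (V : normedModType R) (v x : V) :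
  (fun p : V * R => p.1 + p.2 *: v) @ (x, (0 : R)) --> x.
Proof.
have : (fun p : V * R => p.1 + p.2 *: v) @ (x, (0 : R)) --> x + 0 *: v.
  apply: cvgD; first exact: cvg_fst.
  by apply: cvgZ; [exact: cvg_snd|exact: cvg_cst].
by rewrite scale0r addr0.
Qed.

Section test_functions.
Context (R : realType) (Xi : set (R * R)).
Hypothesis Xi_open : open Xi.
Implicit Types (psi phi zeta : R * R -> R).

Let supp psi : set (R * R) := closure (psi @^-1` [set~ 0]).

Lemma supp_out psi x : ~ supp psi x -> \forall y \near x, psi y = 0.
Proof.
move=> nx.
have oS : open_nbhs x (~` supp psi).
  by split=> //; apply: closed_openC; exact: closed_closure.
have nS : nbhs x (~` supp psi) by exact: open_nbhs_nbhs oS.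
apply: filterS nS => y ny; apply: contrapT => py; apply: ny.
by apply: subset_closure => /=.
Qed.

Lemma supp_eq0 psi x : ~ supp psi x -> psi x = 0.
Proof. by move=> /supp_out /nbhs_singleton. Qed.

Lemma closure_sub_closed (A B : set (R * R)) : closed B -> A `<=` B -> closure A `<=` B.
Proof. by move=> cB AB; rewrite closureE => x; apply. Qed.

(** The support hypothesis is local: phi vanishes at every point near which psi does. *)
Lemma test_sub psi phi : test_function Xi psi -> smooth phi ->
  (forall x, (\forall y \near x, psi y = 0) -> phi x = 0) -> test_function Xi phi.
Proof.
move=> [spsi cpsi Xpsi] sphi h.
have sub : supp phi `<=` supp psi.
  apply: closure_sub_closed; first exact: closed_closure.
  move=> x px; apply: contrapT => /supp_out /h; exact: px.
split=> //; last exact: subset_trans Xpsi.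
apply: subclosed_compact cpsi sub; exact: closed_closure.
Qed.

Lemma test_derive psi v : test_function Xi psi -> test_function Xi ('D_v psi).
Proof.
move=> tpsi; apply: (test_sub tpsi); first by apply: smooth_derive; case: tpsi.
move=> x hx; have px : psi x = 0 by exact: nbhs_singleton hx.
rewrite /derive; apply: cvg_lim => //; apply: cvg_near_cst.
have hn : \forall h \near (0 : R)^', psi (h *: v + x) = 0 by exact: (@line_cvg R (R * R)%type v x _ hx).
apply: filterS hn => h hh.
by rewrite /= /shift hh px subrr scaler0.
Qed.

Lemma test_mul psi phi : test_function Xi psi -> smooth phi -> test_function Xi (psi * phi).
Proof.
move=> tpsi sphi; apply: (test_sub tpsi); first by apply: smoothM => //; case: tpsi.
by move=> x /nbhs_singleton h; rewrite /= mulrfctE h mul0r.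
Qed.

Lemma test_out psi x : test_function Xi psi -> ~ Xi x -> psi x = 0.
Proof. by move=> [_ _ sX] nX; apply: supp_eq0 => /sX. Qed.

Lemma test_bounded psi : test_function Xi psi -> exists2 C, 0 <= C & forall x, `|psi x| <= C.
Proof.
move=> [spsi cpsi _].
have : compact (psi @` supp psi).
  apply: continuous_compact => //; apply: continuous_subspaceT; exact: smooth_continuous.
move=> /(@compact_bounded R R^o) [M [_ hM]].
exists (`|M| + 1); first by rewrite addr_ge0.
move=> x; have [sx|nsx] := pselect (supp psi x); last by rewrite (supp_eq0 nsx) normr0 addr_ge0.
by apply: hM; [rewrite (le_lt_trans (ler_norm _))// ltrDl|exists x].
Qed.

(** A compact set in an open set stays inside under small translations. *)
Lemma test_room psi (e : R * R) : test_function Xi psi -> exists2 h0 : R, 0 < h0 &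
  forall s x, `|s| <= h0 -> supp psi x -> Xi (x + s *: e).
Proof.
move=> [_ cpsi Xpsi].
have : \forall s \near (0 : R), supp psi `<=` (fun x => Xi (x + s *: e)).
  have nc : near_covering (supp psi) by apply/compact_near_coveringP.
  apply: (nc R (nbhs (0 : R)) (fun s x => Xi (x + s *: e))) => x sx.
  exact: (@line_cvg2 R (R * R)%type e x _ (open_nbhs_nbhs (conj Xi_open (Xpsi x sx)))).
move=> /nbhs_normP[r /= r0 hr]; exists (r / 2); first by rewrite divr_gt0.
move=> s x sr; apply: (hr s); rewrite /= sub0r normrN.
by apply: le_lt_trans sr _; rewrite ltr_pdivrMr// ltr_pMr// ltr1n.
Qed.

(** The support of the translate is the translate of the support. *)
Lemma test_shift psi (a : R * R) : test_function Xi psi ->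
  (forall x, supp psi x -> Xi (x + a)) -> test_function Xi (fun x => psi (x - a)).
Proof.
move=> [spsi cpsi Xpsi] h.
pose K := (fun x => x + a) @` supp psi.
have cK : compact K.
  apply: continuous_compact => //; apply: continuous_subspaceT; exact: shift_continuous_nm.
have sub : supp (fun x => psi (x - a)) `<=` K.
  apply: closure_sub_closed; first by apply: compact_closed cK; exact: norm_hausdorff.
  move=> x px; exists (x - a); last by rewrite subrK.
  by apply: subset_closure; exact: px.
split.
- exact: (smooth_shift (- a) spsi).
- by apply: subclosed_compact cK sub; exact: closed_closure.
- by move=> x /sub[z sz <-]; exact: h.
Qed.

End test_functions.

(** * Density of smooth functions *)

Section step_polynomial.
Context (R : realType).

(** Bernoulli's inequality gives pointwise convergence to 1 on [0, 1/2[ and to 0 on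
    ]1/2, 1]; polynomials are smooth, and bounded by 1 on [0, 1]. *)
Definition step_poly (n : nat) (u : R) : R := (1 - u ^+ n) ^+ (2 ^ n).

Lemma bernoulli (x : R) m : 0 <= x <= 1 -> 1 - m%:R * x <= (1 - x) ^+ m.
Proof.
move=> /andP[x0 x1]; elim: m => [|m IH]; first by rewrite expr0 mul0r subr0.
rewrite exprS; apply: (@le_trans _ _ ((1 - x) * (1 - m%:R * x))).
  have -> : m.+1%:R = m%:R + 1 :> R by rewrite natr1.
  have : 0 <= m%:R * x ^+ 2 by rewrite mulr_ge0 ?sqr_ge0.
  nra.
by rewrite ler_wpM2l// subr_ge0.
Qed.

Lemma bernoulli_inv (x : R) m : 0 < x <= 1 -> (0 < m)%N -> (1 - x) ^+ m <= (m%:R * x)^-1.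
Proof.
move=> /andP[x0 x1] m0.
have mx : 0 < m%:R * x by rewrite mulr_gt0// ltr0n.
rewrite -[leRHS]mul1r ler_pdivlMr//.
have h : m%:R * x <= (1 + x) ^+ m.
  have : 1 + m%:R * x <= (1 + x) ^+ m.
    elim: (m) => [|k IH]; first by rewrite expr0 mul0r addr0.
    rewrite exprS; apply: (@le_trans _ _ ((1 + x) * (1 + k%:R * x))).
      have -> : k.+1%:R = k%:R + 1 :> R by rewrite natr1.
      have : 0 <= k%:R * x ^+ 2 by rewrite mulr_ge0 ?sqr_ge0.
      nra.
    by rewrite ler_wpM2l//; lra.
  lra.
apply: (@le_trans _ _ ((1 - x) ^+ m * (1 + x) ^+ m)).
  by rewrite ler_wpM2l// exprn_ge0// subr_ge0.
by rewrite -exprMn; apply: exprn_ile1; nra.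
Qed.

Lemma step_poly_bound n (u : R) : 0 <= u <= 1 -> 0 <= step_poly n u <= 1.
Proof.
move=> /andP[u0 u1].
have un0 : 0 <= u ^+ n by exact: exprn_ge0.
have un1 : u ^+ n <= 1 by exact: exprn_ile1.
apply/andP; split; first by rewrite exprn_ge0// subr_ge0.
by apply: exprn_ile1; lra.
Qed.

Lemma step_poly_lo (u : R) : 0 <= u < 2^-1 -> step_poly n u @[n --> \oo] --> (1 : R).
Proof.
move=> /andP[u0 u1].
apply: (@squeeze_cvgr _ _ _ _ (fun n => 1 - (2 * u) ^+ n) (cst 1)).
- apply: nearW => n; have /andP[_ ->] : 0 <= step_poly n u <= 1 by apply: step_poly_bound; apply/andP; split; lra.
  rewrite andbT exprMn -natrX; apply: bernoulli.
  by rewrite exprn_ge0//= exprn_ile1//; lra.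
- have : 1 - (2 * u) ^+ n @[n --> \oo] --> (1 - 0 : R).
    apply: cvgB; first exact: cvg_cst.
    apply: cvg_expr; rewrite ger0_norm; lra.
  by rewrite subr0.
- exact: cvg_cst.
Qed.

Lemma step_poly_hi (u : R) : 2^-1 < u <= 1 -> step_poly n u @[n --> \oo] --> (0 : R).
Proof.
move=> /andP[u0 u1].
apply: (@squeeze_cvgr _ _ _ _ (cst 0) (fun n => ((2 * u)^-1) ^+ n)).
- apply: nearW => n; have /andP[-> _] : 0 <= step_poly n u <= 1 by apply: step_poly_bound; apply/andP; split; lra.
  rewrite /= exprVn exprMn -natrX; apply: bernoulli_inv; last by rewrite expn_gt0.
  by rewrite exprn_gt0 ?exprn_ile1//; lra.
- exact: cvg_cst.
- have h : 1 < 2 * u by lra.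
  apply: cvg_expr; have h0 : 0 < 2 * u by lra.
  by rewrite normfV gtr0_norm// invf_lt1.
Qed.

End step_polynomial.

(** A single elaboration of the quantifier over almost every point, so that the
    rules below also apply to [domain_measure]. *)
Definition aeP d (T : measurableType d) (R : realType) (mu : {measure set T -> \bar R})
  (P : T -> Prop) : Prop := \forall x \ae mu, P x.

Section aeP.
Context d (T : measurableType d) (R : realType) (mu : {measure set T -> \bar R}).
Implicit Types P Q S : T -> Prop.

Lemma aeS P Q : (forall x, P x -> Q x) -> aeP mu P -> aeP mu Q.
Proof. by rewrite /aeP => PQ; apply: filterS. Qed.

Lemma aeS2 P Q S : (forall x, P x -> Q x -> S x) -> aeP mu P -> aeP mu Q -> aeP mu S.
Proof. by rewrite /aeP => PQ; apply: filterS2. Qed.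

Lemma aeS3 P Q S U : (forall x, P x -> Q x -> S x -> U x) -> aeP mu P -> aeP mu Q ->
  aeP mu S -> aeP mu U.
Proof. by rewrite /aeP => PQ; apply: filterS3. Qed.

Lemma aeI P Q : aeP mu P -> aeP mu Q -> aeP mu (fun x => P x /\ Q x).
Proof. by rewrite /aeP => h1 h2; apply: filterI. Qed.

Lemma ae_all (P : nat -> T -> Prop) : (forall n, aeP mu (P n)) -> aeP mu (fun x => forall n, P n x).
Proof. exact: ae_foralln. Qed.
End aeP.

Section smooth_density.
Context (R : realType) (Xi : set (R * R)) (Xi_open : open Xi).
Hypothesis Xi_bounded : bounded_set Xi.
Local Notation leb := (@lebesgue_measure R).
Local Notation leb2 := (leb \x leb)%E.
Local Notation mu := (domain_measure Xi_open).
Local Notation X := (L2 mu).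

Let mfin := mu_fin Xi_open Xi_bounded.

Lemma aeP_Xi : aeP mu Xi.
Proof. exact: ae_Xi. Qed.

Lemma smooth_bounded_on (P : R * R -> R) : smooth P -> exists2 C, 0 <= C & forall x, Xi x -> `|P x| <= C.
Proof.
move=> sP; have [L L0 hL] := Xi_box Xi_bounded.
pose box : set (R * R) := `[-L, L] `*` `[-L, L].
have cb : compact box by apply: compact_setX; exact: segment_compact.
have : compact (P @` box).
  by apply: continuous_compact => //; apply: continuous_subspaceT; exact: smooth_continuous.
move=> /(@compact_bounded R R^o) [M [_ hM]].
exists (`|M| + 1); first by rewrite addr_ge0.
move=> x Xx; apply: hM; first by rewrite (le_lt_trans (ler_norm _))// ltrDl.
exists x => //; have [h1 h2] := hL x Xx; move: h1 h2; rewrite !ltr_norml.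
move=> /andP[? ?] /andP[? ?]; split; rewrite /= in_itv/=; apply/andP; split; exact: ltW.
Qed.

Lemma smooth_measurable (P : R * R -> R) : smooth P -> measurable_fun setT (P : plane R -> R).
Proof. by move=> sP; apply: continuous_measurable_plane; exact: smooth_continuous. Qed.

Definition smooth_class (P : R * R -> R) : X := L2_of mu P.

Lemma smooth_classE P : smooth P -> aeP mu (fun xi => smooth_class P xi = P xi).
Proof.
move=> sP; have [C _ hC] := smooth_bounded_on sP.
apply: (L2_of_bounded mfin (M := C)); first exact: smooth_measurable.
by apply: aeS aeP_Xi => x; exact: hC.
Qed.

Lemma mu_le_plane (A : set (plane R)) : measurable A -> (mu A <= leb2 A)%E.
Proof.
move=> mA; have mI : measurable (A `&` (Xi : set (plane R))).
  by apply: measurableI => //; exact: (open_measurable_plane Xi_open).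
exact: (le_measure leb2 (mem_set mI) (mem_set mA) (@subIsetl _ A Xi)).
Qed.

Lemma ae_line1 (a : R) : aeP mu (fun x => x.1 != a).
Proof.
exists ([set a] `*` setT : set (plane R)); split.
- by apply: measurableX.
- apply/eqP; rewrite eq_le measure_ge0 andbT.
  apply: (@le_trans _ _ (leb2 ([set a] `*` setT : set (plane R)))).
    by apply: mu_le_plane; exact: measurableX.
  by rewrite product_measure1E// [X in (X * _)%E]lebesgue_measure_set1 mul0e.
- by move=> [x1 x2] /= /negP; rewrite negbK => /eqP ->.
Qed.

Lemma ae_line2 (a : R) : aeP mu (fun x => x.2 != a).
Proof.
exists (setT `*` [set a] : set (plane R)); split.
- by apply: measurableX.
- apply/eqP; rewrite eq_le measure_ge0 andbT.
  apply: (@le_trans _ _ (leb2 (setT `*` [set a] : set (plane R)))).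
    by apply: mu_le_plane; exact: measurableX.
  by rewrite product_measure1E// [X in (_ * X)%E]lebesgue_measure_set1 mule0.
- by move=> [x1 x2] /= /negP; rewrite negbK => /eqP ->.
Qed.

Let M : set X := [set k | forall eps : R, 0 < eps -> exists2 P, smooth P & `|k - smooth_class P| < eps].

Let M_closed : closed_subspace M.
Proof.
have s0 : smooth (cst 0 : R * R -> R) by exact: smooth_cst.
split.
- move=> eps eps0; exists (cst 0) => //.
  have -> : smooth_class (cst 0) = 0.
    by apply/L2_eqP; apply: aeS2 (smooth_classE s0) (L2_zeroE mu) => x -> ->.
  by rewrite subrr normr0.
- move=> a x y hx hy eps eps0.
  have a1 : 0 < `|a| + 1 by rewrite ltr_wpDl.
  have [P sP hP] := hx _ (divr_gt0 (divr_gt0 eps0 (ltr0n R 2)) a1).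
  have [Q sQ hQ] := hy _ (divr_gt0 eps0 (ltr0n R 2)).
  have sac := smooth_cst (R := R) a.
  exists (cst a * P + Q); first exact: (smoothD (smoothM sac sP) sQ).
  have -> : smooth_class (cst a * P + Q) = a *: smooth_class P + smooth_class Q.
    apply/L2_eqP.
    have e1 := smooth_classE (smoothD (smoothM sac sP) sQ).
    apply: aeS3 (aeI e1 (smooth_classE sP)) (smooth_classE sQ)
      (aeI (L2_addE (a *: smooth_class P) (smooth_class Q)) (L2_scaleE a (smooth_class P))).
    by move=> z [-> h1] h2 [-> ->]; rewrite h1 h2.
  have -> : a *: x + y - (a *: smooth_class P + smooth_class Q) = a *: (x - smooth_class P) + (y - smooth_class Q).
    by rewrite opprD addrACA scalerBr.
  apply: le_lt_trans (ler_normD _ _) _; rewrite [ltRHS]splitr; apply: ler_ltD => //.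
  rewrite normrZ; apply: (@le_trans _ _ ((`|a| + 1) * `|x - smooth_class P|)).
    by rewrite ler_wpM2r// lerDl.
  by rewrite mulrC -ler_pdivlMr// ltW.
- move=> x h eps eps0.
  have [y My xy] := h _ (divr_gt0 eps0 (ltr0n R 2)).
  have [P sP hP] := My _ (divr_gt0 eps0 (ltr0n R 2)).
  exists P => //; have -> : x - smooth_class P = (x - y) + (y - smooth_class P) by rewrite addrA subrK.
  by apply: le_lt_trans (ler_normD _ _) _; rewrite [ltRHS]splitr; exact: ltrD.
Qed.

(** The indicator of a quadrant is a bounded limit of products of [step_poly] in the
    two coordinates, rescaled so that the bounded domain lies where those
    polynomials are bounded by 1.  Indicators of quadrants span a dense subspace. *)
Lemma smooth_dense (k : X) (eps : R) : 0 < eps -> exists2 P, smooth P & `|k - smooth_class P| < eps.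
Proof.
suff : forall k, M k by move=> h; exact: h.
apply: (quadrant_dense Xi_bounded M_closed) => a' b'.
set a := ratr a'; set b := ratr b'.
have [L L0 hL] := Xi_box Xi_bounded.
(* affine change of variable sending c to 1/2 and ]-L, L[ into [0, 1] *)
pose u (c t : R) : R := (t - c) / (2 * (L + `|c| + 1)) + 2^-1.
have K0 (c : R) : 0 < L + `|c| + 1 by rewrite addr_gt0// ltr_wpDr.
have u01 (c t : R) : `|t| < L -> 0 <= u c t <= 1.
  rewrite ltr_norml => /andP[t1 t2].
  have [c1 c2] : - `|c| <= c /\ c <= `|c| by split; [rewrite lerNl -normrN ler_norm|exact: ler_norm].
  have : `|(t - c) / (2 * (L + `|c| + 1))| <= 2^-1.
    rewrite normrM normfV (ger0_norm (ltW (mulr_gt0 _ (K0 c))))// ler_pdivrMr ?mulr_gt0//.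
    by rewrite mulrA mulVf// mul1r ler_norml; apply/andP; split; lra.
  by rewrite ler_norml /u => /andP[h1 h2]; apply/andP; split; lra.
have ult (c t : R) : t < c -> u c t < 2^-1.
  move=> tc; rewrite /u gtrDr pmulr_llt0 ?subr_lt0// invr_gt0 mulr_gt0//.
have ugt (c t : R) : c < t -> 2^-1 < u c t.
  move=> tc; rewrite /u ltrDr mulr_gt0 ?subr_gt0// invr_gt0 mulr_gt0//.
pose P n : R * R -> R := (fun x => step_poly n (u a x.1)) * (fun x => step_poly n (u b x.2)).
have sstep n c (f : R * R -> R) : smooth f -> smooth (fun x => step_poly n (u c (f x))).
  move=> sf.
  have -> : (fun x => step_poly n (u c (f x))) = (cst 1 + cst (-1) * ((f + cst (- c)) * cst (2 * (L + `|c| + 1))^-1 + cst 2^-1) ^+ n) ^+ (2 ^ n).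
    by apply/funext => x; rewrite /step_poly /u !fctE mulN1r.
  have sc (c' : R) := smooth_cst (R := R) c'.
  apply: smoothX; apply: smoothD; first exact: sc.
  apply: smoothM; first exact: sc.
  apply: smoothX; apply: smoothD; last exact: sc.
  apply: smoothM; last exact: sc.
  by apply: smoothD => //; exact: sc.
have sP n : smooth (P n).
  by apply: smoothM; apply: sstep; [exact: smooth_fst|exact: smooth_snd].
have PE : aeP mu (fun x => forall n, smooth_class (P n) x = P n x) by apply: ae_all => n; exact: smooth_classE.
have cv : smooth_class (P n) @[n --> \oo] --> L2_ind mu (quadrant a b).
  apply: (L2_bounded_cvg (c := 1) mfin).
    apply: aeS3 (aeI PE aeP_Xi) (aeI (ae_line1 a) (ae_line2 b))
      (L2_indE mfin (measurable_quadrant a b)).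
    move=> x [h Xx] [x1 x2] ->; under eq_fun do rewrite h.
    have [l1 l2] := hL x Xx; have /andP[u0 u1] := u01 a _ l1; have /andP[v0 v1] := u01 b _ l2.
    have c1 : step_poly n (u a x.1) @[n --> \oo] --> ((x.1 < a)%R%:R : R).
      have [xa|ax|xa] := ltgtP x.1 a; last by rewrite xa eqxx in x1.
        by apply: step_poly_lo; rewrite u0 ult.
      by apply: step_poly_hi; rewrite u1 ugt.
    have c2 : step_poly n (u b x.2) @[n --> \oo] --> ((x.2 < b)%R%:R : R).
      have [xa|ax|xa] := ltgtP x.2 b; last by rewrite xa eqxx in x2.
        by apply: step_poly_lo; rewrite v0 ult.
      by apply: step_poly_hi; rewrite v1 ugt.
    have -> : \1_(quadrant a b) x = (x.1 < a)%R%:R * (x.2 < b)%R%:R :> R.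
      rewrite indicE -natrM mulnb; congr (nat_of_bool _)%:R.
      by apply/idP/idP; rewrite inE /quadrant /= !in_itv/=; [move=> [-> ->]|move=> /andP[]].
    exact: cvgM.
  move=> n; apply: aeS2 PE aeP_Xi => x -> Xx.
  have [l1 l2] := hL x Xx.
  have /andP[p0 p1] := step_poly_bound n (u01 a _ l1).
  have /andP[q0 q1] := step_poly_bound n (u01 b _ l2).
  by rewrite ger0_norm ?mulr_ge0// mulr_ile1.
apply: (subspace_cvg M_closed _ cv) => n eps' e0; exists (P n) => //.
by rewrite subrr normr0.
Qed.

End smooth_density.

(** * Translates of square-integrable functions *)

Section multiplication.
Context d (T : measurableType d) (R : realType) (mu : {measure set T -> \bar R}).
Local Notation X := (L2 mu).
Variables (m : T -> R) (C : R).
Hypotheses (mm : measurable_fun setT m) (mC : forall xi, `|m xi| <= C).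

Definition L2_mul (x : X) : X := L2_of mu (fun xi => m xi * x xi).

Lemma L2_mulE (x : X) : aeP mu (fun xi => L2_mul x xi = m xi * x xi).
Proof.
apply: (@L2_ofE_le _ _ _ _ _ (C *: x)); first by apply: measurable_funM => //; exact: L2_measurable.
apply: aeS (L2_scaleE C x) => xi ->; rewrite !normrM ler_wpM2r//.
by rewrite (le_trans (mC xi))// ler_norm.
Qed.

Lemma L2_mul_norm (x : X) : `|L2_mul x| <= C * `|x|.
Proof.
have C0 : 0 <= C := le_trans (normr_ge0 _) (mC point).
rewrite -[in leRHS](ger0_norm C0) -normrZ; apply: L2_norm_le.
apply: aeS2 (L2_mulE x) (L2_scaleE C x) => xi -> ->; rewrite !normrM ler_wpM2r//.
by rewrite (le_trans (mC xi))// ler_norm.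
Qed.

Lemma L2_mul_linear : linear L2_mul.
Proof.
move=> a x y; apply/L2_eqP.
apply: aeS3 (aeI (L2_mulE (a *: x + y)) (L2_addE (a *: x) y))
  (aeI (L2_addE (a *: L2_mul x) (L2_mul y)) (L2_scaleE a (L2_mul x)))
  (aeI (L2_scaleE a x) (aeI (L2_mulE x) (L2_mulE y))).
by move=> xi [-> ->] [-> ->] [-> [-> ->]]; ring.
Qed.

End multiplication.

Section translation.
Context (R : realType) (Xi : set (R * R)) (Xi_open : open Xi).
Hypothesis Xi_bounded : bounded_set Xi.
Local Notation leb := (@lebesgue_measure R).
Local Notation leb2 := (leb \x leb)%E.
Local Notation mu := (domain_measure Xi_open).
Local Notation X := (L2 mu).

(** Where zeta vanishes outside the domain, extension of f by zero makes the change
    of variables in the whole plane available. *)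
Lemma pairing (f zeta : plane R -> R) (a : R * R) :
  (forall x, ~ Xi x -> zeta x = 0) ->
  mu.-integrable setT (EFin \o (fun x => f x * zeta (x - a))) ->
  mu.-integrable setT (EFin \o (fun x => (f \_ Xi) (shift2 a x) * zeta x)) /\
  \int[mu]_x ((f \_ Xi) (shift2 a x) * zeta x) = \int[mu]_x (f x * zeta (x - a)).
Proof.
move=> z0 fi; set F := fun x => f x * zeta (x - a).
set G := fun x => (f \_ Xi) (shift2 a x) * zeta x.
have FX := integrable_domain fi.
have FG : (F \_ Xi) \o shift2 a = G.
  apply/funext => x; rewrite /G /= /F !patchE; case: ifPn => _; last by rewrite mul0r.
  by congr (_ * zeta _); case: x => x1 x2; congr (_, _); rewrite /= addrK.
have Gi : leb2.-integrable setT (EFin \o G) by rewrite -FG; exact: (integrable_shift2 a FX).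
have Gmu := integrable_to_domain Xi_open Gi.
split; first exact: Gmu.
rewrite (Rintegral_domain Gmu) (Rintegral_domain fi) -(Rintegral_shift_plane a FX).
have -> : G \_ Xi = G.
  apply/funext => x; rewrite patchE; case: ifPn => // xX; rewrite /G z0 ?mulr0//.
  by move=> hx; rewrite mem_set in xX.
by rewrite -FG.
Qed.

Definition trans (a : R * R) (v : X) : X := L2_of mu (fun x => ((v : plane R -> R) \_ Xi) (shift2 a x)).

Lemma transE a v : aeP mu (fun x => trans a v x = ((v : plane R -> R) \_ Xi) (shift2 a x)).
Proof.
have h := integrable_shift2 a (integrable_domain (L2_integrable_sqr v)).
have mv : measurable_fun setT ((v : plane R -> R) \_ Xi).
  by apply/(measurable_restrictT _ (mXi Xi_open)); apply: measurable_funTS; exact: L2_measurable.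
apply: L2_ofE; first exact: (measurableT_comp mv (measurable_shift2 a)).
have -> : (fun xi => ((v : plane R -> R) \_ Xi) (shift2 a xi) ^+ 2) =
  ((fun xi => v xi ^+ 2) \_ Xi) \o shift2 a.
  by apply/funext => x; rewrite /= !patchE; case: ifPn; rewrite // expr0n.
exact: (integrable_to_domain Xi_open h).
Qed.

Lemma dot_smooth_class (v : X) (P : R * R -> R) : smooth P -> dot v (smooth_class Xi_open P) = \int[mu]_x (v x * P x).
Proof.
move=> sP; apply: eq_Rintegral_ae; first exact: measurable_L2M.
  by apply: measurable_funM; [exact: L2_measurable|exact: smooth_measurable].
by apply: aeS (smooth_classE Xi_open Xi_bounded sP) => x ->.
Qed.

Lemma integrable_smooth_class (v : X) (P : R * R -> R) : smooth P ->
  mu.-integrable setT (EFin \o (fun x => v x * P x)).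
Proof.
move=> sP; apply: (ae_le_integrable _ (L2_integrableM v (smooth_class Xi_open P))).
  by apply: measurable_funM; [exact: L2_measurable|exact: smooth_measurable].
by apply: aeS (smooth_classE Xi_open Xi_bounded sP) => x ->.
Qed.

Lemma dot_trans (a : R * R) (v : X) (zeta : R * R -> R) : test_function Xi zeta ->
  dot (trans a v) (smooth_class Xi_open zeta) = dot v (smooth_class Xi_open (fun x => zeta (x - a))).
Proof.
move=> tz; have sz : smooth zeta by case: tz.
have sza : smooth (fun x => zeta (x - a)) by exact: (smooth_shift (- a) sz).
rewrite (dot_smooth_class _ sza) (dot_smooth_class _ sz).
have [Gi <-] := @pairing v zeta a (fun x => @test_out _ _ _ x tz) (integrable_smooth_class v sza).
apply: eq_Rintegral_ae.
- by apply: measurable_funM; [exact: L2_measurable|exact: smooth_measurable].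
- by have := measurable_int _ Gi => /measurable_EFinP.
- by apply: aeS (transE a v) => x ->.
Qed.

Lemma norm_smooth_class_shift (a : R * R) (zeta : R * R -> R) : test_function Xi zeta ->
  (forall x, zeta x != 0 -> Xi (x + a)) ->
  `|smooth_class Xi_open (fun x => zeta (x - a))| = `|smooth_class Xi_open zeta|.
Proof.
move=> tz za; have sz : smooth zeta by case: tz.
have sza : smooth (fun x => zeta (x - a)) by exact: (smooth_shift (- a) sz).
set z' := smooth_class _ (fun x => zeta (x - a)).
suff : `|z'| ^+ 2 = `|smooth_class Xi_open zeta| ^+ 2.
  by move=> /eqP; rewrite eqrXn2// => /eqP.
have mz : measurable_fun setT (zeta : plane R -> R) by exact: smooth_measurable.
have mza : measurable_fun setT ((fun x => zeta (x - a)) : plane R -> R) by exact: smooth_measurable.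
have e1 : dot z' z' = \int[mu]_x (zeta (x - a) * zeta (x - a)).
  apply: eq_Rintegral_ae; [exact: measurable_L2M|exact: measurable_funM|].
  by apply: aeS (smooth_classE Xi_open Xi_bounded sza) => x ->.
have e2 : dot (smooth_class Xi_open zeta) (smooth_class Xi_open zeta) = \int[mu]_x (zeta x * zeta x).
  apply: eq_Rintegral_ae; [exact: measurable_L2M|exact: measurable_funM|].
  by apply: aeS (smooth_classE Xi_open Xi_bounded sz) => x ->.
rewrite !L2_normE e1 e2.
have zi : mu.-integrable setT (EFin \o (fun x => zeta (x - a) * zeta (x - a))).
  apply: (ae_le_integrable _ (L2_integrableM z' z')); first exact: measurable_funM.
  by apply: aeS (smooth_classE Xi_open Xi_bounded sza) => x ->.
have [_ <-] := @pairing (fun x => zeta (x - a)) zeta a (fun x => @test_out _ _ _ x tz) zi.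
congr (Rintegral _ _ _); apply/funext => x.
have [->|zx] := eqVneq (zeta x) 0; first by rewrite !mulr0.
congr (_ * _); rewrite patchE mem_set; last exact: za.
by congr zeta; case: x {zx} => x1 x2; congr (_, _); rewrite /= addrK.
Qed.

(** For a nonlinear q with q 0 <> 0, extension by zero and composition with q do not
    commute; they agree on the support of zeta, if that support stays in the domain
    when translated. *)
Lemma dot_map_trans (q : R -> R) (a : R * R) (v : X) (zeta : R * R -> R) : lip1 q -> test_function Xi zeta ->
  (forall x, zeta x != 0 -> Xi (x + a)) ->
  dot (L2_map q (trans a v)) (smooth_class Xi_open zeta) = dot (L2_map q v) (smooth_class Xi_open (fun x => zeta (x - a))).
Proof.
move=> lq tz za; have sz : smooth zeta by case: tz.
have mf := mu_fin Xi_open Xi_bounded.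
have sza : smooth (fun x => zeta (x - a)) by exact: (smooth_shift (- a) sz).
rewrite (dot_smooth_class _ sza) (dot_smooth_class _ sz).
have mq : measurable_fun setT ((fun x => q (v x)) : plane R -> R).
  by apply: measurableT_comp; [exact: lip1_measurable|exact: L2_measurable].
have mza : measurable_fun setT ((fun x => zeta (x - a)) : plane R -> R) by exact: smooth_measurable.
have qi : mu.-integrable setT (EFin \o (fun x => q (v x) * zeta (x - a))).
  apply: (ae_le_integrable _ (integrable_smooth_class (L2_map q v) sza)); first exact: measurable_funM.
  by apply: aeS (L2_mapE mf v lq) => x ->.
have [Gi Ge] := @pairing (fun x => q (v x)) zeta a (fun x => @test_out _ _ _ x tz) qi.
transitivity (\int[mu]_x (q (v x) * zeta (x - a))); last first.
  apply: eq_Rintegral_ae; first exact: measurable_funM.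
    by apply: measurable_funM => //; exact: L2_measurable.
  by apply: aeS (L2_mapE mf v lq) => x ->.
rewrite -Ge; apply: eq_Rintegral_ae.
- by apply: measurable_funM; [exact: L2_measurable|exact: smooth_measurable].
- by have := measurable_int _ Gi => /measurable_EFinP.
- apply: aeS2 (L2_mapE mf (trans a v) lq) (transE a v) => x -> ->.
  have [->|zx] := eqVneq (zeta x) 0; first by rewrite !mulr0.
  have xa : Xi (shift2 a x) by have := za _ zx; case: x {zx}.
  by rewrite !patchE mem_set.
Qed.

End translation.

(** * Difference quotients and weak derivatives *)

(** The increments over n equal steps add up to K h + C h^2 / n. *)
Lemma telescope_abs (R : realType) (w : R -> R) (h K C : R) : 0 <= h -> 0 <= C ->
  (forall s k, 0 <= s -> 0 <= k -> s + k <= h -> `|w (s + k) - w s| <= K * k + C * k ^+ 2) ->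
  `|w h - w 0| <= K * h.
Proof.
move=> h0 C0 hw; apply/ler_addgt0Pl => eps eps0.
(* number of steps for which the accumulated quadratic error is below eps *)
pose N := Num.truncn (C * h ^+ 2 / eps).
have hN : C * h ^+ 2 / N.+1%:R < eps.
  by rewrite ltr_pdivrMr// [X in _ < X]mulrC -ltr_pdivrMr//; exact: truncnS_gt.
have N0 : 0 < N.+1%:R :> R by rewrite ltr0n.
set k := h / N.+1%:R; have k0 : 0 <= k by rewrite divr_ge0// ltW.
have Nk : N.+1%:R * k = h by rewrite mulrC divfK// gt_eqF.
have st n : (n <= N.+1)%N -> `|w (n%:R * k) - w 0| <= n%:R * (K * k + C * k ^+ 2).
  elim: n => [_|n IH nN]; first by rewrite !mul0r subrr normr0.
  have -> : w (n.+1%:R * k) - w 0 = (w (n%:R * k + k) - w (n%:R * k)) + (w (n%:R * k) - w 0).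
    by rewrite addrA subrK -natr1 mulrDl mul1r.
  rewrite -natr1 mulrDl mul1r addrC (le_trans (ler_normD _ _))// lerD//; first exact: IH (ltnW nN).
  apply: hw => //; first by rewrite mulr_ge0.
  by rewrite -{2}[k]mul1r -mulrDl natr1 -Nk ler_wpM2r// ler_nat.
have := st _ (leqnn _); rewrite Nk => /le_trans; apply.
have -> : N.+1%:R * (K * k + C * k ^+ 2) = C * h ^+ 2 / N.+1%:R + K * (N.+1%:R * k).
  by rewrite /k; field; rewrite gt_eqF.
by rewrite Nk lerD2r ltW.
Qed.

Lemma small_zero (R : realType) (N A : R) : 0 <= A ->
  (forall eps, 0 < eps -> exists2 dl, 0 < dl & forall h, 0 < h < dl ->
     h * `|N| <= A * h ^+ 2 + eps * h) -> N = 0.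
Proof.
move=> A0 hN; apply/eqP; rewrite -normr_le0; apply/ler_addgt0Pl => eps eps0; rewrite addr0.
have e2 : 0 < eps / 2 by rewrite divr_gt0.
have [dl dl0 hd] := hN _ e2.
have A1 : 0 < A + 1 by rewrite ltr_wpDl.
pose h := Num.min (dl / 2) (eps / 2 / (A + 1)).
have h0 : 0 < h by rewrite lt_min !divr_gt0.
have hdl : h < dl by rewrite gt_min; apply/orP; left; rewrite ltr_pdivrMr// ltr_pMr// ltr1n.
have := hd h; rewrite h0 hdl => /(_ isT).
have -> : A * h ^+ 2 + eps / 2 * h = h * (A * h + eps / 2) by ring.
rewrite ler_pM2l// => /le_trans; apply.
rewrite [leRHS]splitr lerD2r.
apply: (@le_trans _ _ ((A + 1) * h)); first by apply: ler_wpM2r; [exact: ltW|rewrite lerDl].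
by rewrite mulrC -ler_pdivlMr// ge_min lexx orbT.
Qed.

Section weak_derivative.
Context (R : realType) (Xi : set (R * R)) (Xi_open : open Xi).
Hypothesis Xi_bounded : bounded_set Xi.
Local Notation leb := (@lebesgue_measure R).
Local Notation mu := (domain_measure Xi_open).
Local Notation X := (L2 mu).
Local Notation cl := (smooth_class Xi_open).
Variable e : R * R.

Definition weak_derivative (v g : X) := forall psi, test_function Xi psi ->
  \int[mu]_xi (v xi * 'D_e psi xi) = - \int[mu]_xi (g xi * psi xi).

Definition slide (psi : R * R -> R) (s : R) : R * R -> R := fun x => psi (x - s *: e).

Lemma smooth_slide psi s : smooth psi -> smooth (slide psi s).
Proof. by move=> sp; exact: (smooth_shift (- (s *: e)) sp). Qed.

Lemma slide0 psi : slide psi 0 = psi.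
Proof. by apply/funext => x; rewrite /slide scale0r subr0. Qed.

Lemma derive_slide psi s : 'D_e (slide psi s) = slide ('D_e psi) s.
Proof. by apply/funext => x; exact: derive_shiftE. Qed.

(** Translations of length up to r along e keep the support of psi in the domain. *)
Definition room (psi : R * R -> R) (r : R) := forall s x, `|s| <= r ->
  closure (psi @^-1` [set~ 0]) x -> Xi (x + s *: e).

Lemma room_mul psi P r : room psi r -> room (psi * P) r.
Proof.
move=> h s x sr sx; apply: (h s x sr); apply: closure_subset sx => y /=.
by rewrite mulrfctE => py p0; apply: py; rewrite p0 mul0r.
Qed.

Lemma room_pt psi r s x : room psi r -> `|s| <= r -> psi x != 0 -> Xi (x + s *: e).
Proof. by move=> h sr p0; apply: (h s x sr); apply: subset_closure; apply/eqP. Qed.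

Lemma test_slide psi r s : test_function Xi psi -> room psi r -> `|s| <= r ->
  test_function Xi (slide psi s).
Proof. by move=> tp h sr; apply: test_shift tp _ => x; exact: h. Qed.

(** Second-order Taylor expansion along e, uniform in x and therefore valid in norm. *)
Lemma slide_taylor psi : test_function Xi psi -> exists2 C, 0 <= C & forall (f : X) s k,
  `|dot f (cl (slide psi (s + k))) - dot f (cl (slide psi s)) + k * dot f (cl (slide ('D_e psi) s))|
    <= `|f| * (C * k ^+ 2).
Proof.
move=> tp; have sp : smooth psi by case: tp.
have [C C0 hC] := test_bounded (test_derive e (test_derive e tp)).
set m := fine (mu setT); have m0 : 0 <= m by exact: fine_ge0.
exists (C * Num.sqrt m); first by rewrite mulr_ge0// sqrtr_ge0.
move=> f s k; set a := cl _; set b := cl _; set c := cl _.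
have -> : dot f a - dot f b + k * dot f c = dot f (a - b + k *: c).
  by rewrite dotDr dotBr dotZr.
apply: le_trans (cauchy_schwarz _ _) _; rewrite ler_wpM2l//.
have ck : 0 <= C * k ^+ 2 by rewrite mulr_ge0// sqr_ge0.
have -> : C * Num.sqrt m * k ^+ 2 = C * k ^+ 2 * Num.sqrt m by ring.
have rhs0 : 0 <= C * k ^+ 2 * Num.sqrt m := mulr_ge0 ck (sqrtr_ge0 m).
rewrite -(ler_pXn2r (n := 2)) ?nnegrE//.
rewrite exprMn sqr_sqrtr//; apply: (L2_norm_bounded (mu_fin Xi_open Xi_bounded) ck).
have sd := smooth_derive e sp.
apply: aeS3 (aeI (smooth_classE Xi_open Xi_bounded (smooth_slide (s + k) sp))
  (aeI (smooth_classE Xi_open Xi_bounded (smooth_slide s sp)) (smooth_classE Xi_open Xi_bounded (smooth_slide s sd))))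
  (L2_scaleE k c) (aeI (L2_addE (a - b) (k *: c)) (L2_subE a b)).
move=> x [h1 [h2 h3]] h4 [-> ->]; rewrite h4 h1 h2 h3 /slide.
have := @line_taylor _ psi (x - s *: e) e (- k) C sp hC.
rewrite sqrrN mulNr opprK.
suff -> : x - s *: e + - k *: e = x - (s + k) *: e by [].
by rewrite scaleNr scalerDl opprD addrA.
Qed.

Variables v g : X.
Hypothesis wd : weak_derivative v g.

Lemma wd_dot psi : test_function Xi psi -> dot v (cl ('D_e psi)) = - dot g (cl psi).
Proof.
move=> tp; have sp : smooth psi by case: tp.
by rewrite (dot_smooth_class Xi_bounded _ (smooth_derive e sp)) (dot_smooth_class Xi_bounded _ sp); exact: wd.
Qed.

Local Notation diff h := (trans (h *: e) v - v).

Lemma diff_dot psi r h : test_function Xi psi -> room psi r -> `|h| <= r ->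
  dot (diff h) (cl psi) = dot v (cl (slide psi h)) - dot v (cl (slide psi 0)).
Proof. by move=> tp rp hr; rewrite dotBl slide0 dot_trans. Qed.

(** The function s |-> <v, psi (. - s e)> has derivative <g, psi (. - s e)>, of
    absolute value at most |g| |psi|, by the definition of the weak derivative. *)
Lemma diff_bound_test psi r h : test_function Xi psi -> room psi r -> 0 <= h <= r ->
  `|dot (diff h) (cl psi)| <= `|g| * `|cl psi| * h.
Proof.
move=> tp rp /andP[h0 hr]; have sp : smooth psi by case: tp.
rewrite (diff_dot tp rp); last by rewrite ger0_norm.
have [C C0 hC] := slide_taylor tp.
have vC : 0 <= `|v| * C by rewrite mulr_ge0.
apply: (telescope_abs (w := fun s => dot v (cl (slide psi s))) h0 vC).
move=> s k s0 k0 skh.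
have sr : `|s| <= r by rewrite ger0_norm// (le_trans _ hr)// (le_trans _ skh)// lerDl.
have := hC v s k; rewrite -derive_slide (wd_dot (test_slide tp rp sr)) mulrN.
set A := _ - dot v (cl (slide psi s)) => hA.
have -> : A = (A - k * dot g (cl (slide psi s))) + k * dot g (cl (slide psi s)) by rewrite subrK.
apply: le_trans (ler_normD _ _) _; rewrite addrC lerD//; last by rewrite -mulrA.
rewrite normrM (ger0_norm k0) mulrC ler_wpM2r//.
apply: le_trans (cauchy_schwarz _ _) _; rewrite ler_wpM2l//.
by rewrite /slide norm_smooth_class_shift// => x; exact: (room_pt rp sr).
Qed.

Lemma diff_taylor_test psi r : test_function Xi psi -> room psi r ->
  exists2 C, 0 <= C & forall h, 0 <= h <= r ->
  `|dot (diff h) (cl psi) - h * dot g (cl psi)| <= C * h ^+ 2.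
Proof.
move=> tp rp; have [C C0 hC] := slide_taylor tp.
exists (`|v| * C); first by rewrite mulr_ge0.
move=> h /andP[h0 hr]; rewrite (diff_dot tp rp); last by rewrite ger0_norm.
by have := hC v 0 h; rewrite add0r !slide0 wd_dot// mulrN mulrA.
Qed.

Variables (psi : R * R -> R) (r C : R).
Hypotheses (tpsi : test_function Xi psi) (rpsi : room psi r) (r_gt0 : 0 < r)
  (psiC : forall x, `|psi x| <= C).
Local Notation mpsi := (L2_mul (mu := mu) psi).

Let C0 : 0 <= C := le_trans (normr_ge0 _) (psiC 0).
Let spsi : smooth psi. Proof. by case: tpsi. Qed.
Let mm : measurable_fun setT (psi : plane R -> R). Proof. exact: smooth_measurable. Qed.

Lemma mul_smooth_class P : smooth P -> mpsi (cl P) = cl (psi * P).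
Proof.
move=> sP; apply/L2_eqP.
apply: aeS3 (L2_mulE mm psiC (cl P)) (smooth_classE Xi_open Xi_bounded sP)
  (smooth_classE Xi_open Xi_bounded (smoothM spsi sP)).
by move=> x -> -> ->.
Qed.

Lemma mpsi_norm (k : X) : `|mpsi k| <= C * `|k|.
Proof. exact: (L2_mul_norm mm psiC). Qed.

Lemma mpsiB (k l : X) : mpsi (k - l) = mpsi k - mpsi l.
Proof. exact: (linearB' _ _ (L2_mul_linear mm psiC)). Qed.

(** For k smooth, psi k is a test function and [diff_bound_test] applies.  Both sides
    are continuous in k. *)
Lemma diff_bound (k : X) (h : R) : 0 <= h <= r ->
  `|dot (diff h) (mpsi k)| <= `|g| * `|mpsi k| * h.
Proof.
move=> hr; have h0 : 0 <= h by case/andP: hr.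
apply/ler_addgt0Pl => eps eps0; set w := diff h.
pose K := (`|w| + `|g| * h) * C; have K0 : 0 <= K by rewrite mulr_ge0// addr_ge0// mulr_ge0.
have K1 : 0 < K + 1 by rewrite ltr_wpDl.
have [P sP hP] := smooth_dense Xi_bounded k (divr_gt0 eps0 K1).
have tP := test_mul tpsi sP.
have b1 := diff_bound_test tP (room_mul (P := P) rpsi) hr.
rewrite -/w -(mul_smooth_class sP) in b1.
have hd : `|mpsi k - mpsi (cl P)| <= C * `|k - cl P| by rewrite -mpsiB; exact: mpsi_norm.
have -> : dot w (mpsi k) = dot w (mpsi k - mpsi (cl P)) + dot w (mpsi (cl P)).
  by rewrite dotBr subrK.
apply: le_trans (ler_normD _ _) _.
have h1 : `|dot w (mpsi k - mpsi (cl P))| <= `|w| * (C * `|k - cl P|).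
  by apply: le_trans (cauchy_schwarz _ _) _; rewrite ler_wpM2l.
have h2 : `|mpsi (cl P)| <= `|mpsi k| + C * `|k - cl P|.
  have -> : mpsi (cl P) = mpsi k - (mpsi k - mpsi (cl P)) by rewrite subKr.
  exact: le_trans (ler_normB _ _) (lerD (lexx _) hd).
have h3 : `|dot w (mpsi (cl P))| <= `|g| * (`|mpsi k| + C * `|k - cl P|) * h.
  by apply: le_trans b1 _; rewrite ler_wpM2r// ler_wpM2l.
apply: le_trans (lerD h1 h3) _.
have -> : `|w| * (C * `|k - cl P|) + `|g| * (`|mpsi k| + C * `|k - cl P|) * h =
  K * `|k - cl P| + `|g| * `|mpsi k| * h by rewrite /K; ring.
rewrite lerD2r; apply: (@le_trans _ _ ((K + 1) * `|k - cl P|)).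
  by rewrite ler_wpM2r// lerDl.
by rewrite mulrC -ler_pdivlMr// ltW.
Qed.

(** The bound of [diff_bound] allows the limit of difference quotients to be taken
    for smooth k close to a given k. *)
Lemma diff_taylor (k : X) (eps : R) : 0 < eps -> exists2 dl, 0 < dl & forall h, 0 < h < dl ->
  `|dot (diff h) (mpsi k) - h * dot g (mpsi k)| <= eps * h.
Proof.
move=> eps0.
pose K := 2 * `|g| * C; have K0 : 0 <= K by rewrite !mulr_ge0.
have K1 : 0 < K + 1 by rewrite ltr_wpDl.
have e2 : 0 < eps / 2 by rewrite divr_gt0.
have [P sP hP] := smooth_dense Xi_bounded k (divr_gt0 e2 K1).
have tP := test_mul tpsi sP.
have [A A0 hA] := diff_taylor_test tP (room_mul (P := P) rpsi).
have A1 : 0 < A + 1 by rewrite ltr_wpDl.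
exists (Num.min r (eps / 2 / (A + 1))); first by rewrite lt_min r_gt0 divr_gt0.
move=> h /andP[h0]; rewrite lt_min => /andP[hr hh].
have hr' : 0 <= h <= r by rewrite !ltW.
have h0' := ltW h0.
have := hA h hr'; rewrite -(mul_smooth_class sP) => hA'.
set z := mpsi k - mpsi (cl P).
have zE : mpsi k = z + mpsi (cl P) by rewrite subrK.
have zn : `|z| <= C * `|k - cl P| by rewrite /z -mpsiB; exact: mpsi_norm.
have h1 : `|dot (diff h) z| <= `|g| * (C * `|k - cl P|) * h.
  rewrite /z -mpsiB; apply: le_trans (diff_bound _ hr') _.
  by rewrite ler_wpM2r// ler_wpM2l// mpsi_norm.
have h2 : `|h * dot g z| <= `|g| * (C * `|k - cl P|) * h.
  rewrite normrM gtr0_norm// mulrC ler_wpM2r//.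
  by apply: le_trans (cauchy_schwarz _ _) _; rewrite ler_wpM2l.
have -> : dot (diff h) (mpsi k) - h * dot g (mpsi k) =
  (dot (diff h) z - h * dot g z) + (dot (diff h) (mpsi (cl P)) - h * dot g (mpsi (cl P))).
  by rewrite zE !dotDr mulrDr opprD addrACA.
apply: le_trans (ler_normD _ _) _.
apply: le_trans (lerD (ler_normB _ _) hA') _.
apply: le_trans (lerD (lerD h1 h2) (lexx _)) _.
have -> : `|g| * (C * `|k - cl P|) * h + `|g| * (C * `|k - cl P|) * h + A * h ^+ 2 =
  (K * `|k - cl P| + A * h) * h by rewrite /K; ring.
rewrite ler_wpM2r// [leRHS]splitr lerD//.
  apply: (@le_trans _ _ ((K + 1) * `|k - cl P|)); first by rewrite ler_wpM2r// lerDl.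
  by rewrite mulrC -ler_pdivlMr// ltW.
apply: (@le_trans _ _ ((A + 1) * h)); first by apply: ler_wpM2r; [exact: ltW|rewrite lerDl].
by rewrite mulrC -ler_pdivlMr// ltW.
Qed.

End weak_derivative.

(** * The chain rule for weak derivatives *)

Lemma measurable_sg (R : realType) : measurable_fun setT (Num.sg : R -> R).
Proof.
apply: nondecreasing_measurable => // x y.
have sgE (z : R) : Num.sg z = (0 < z)%R%:R - (z < 0)%R%:R.
  by have [z0|z0|->] := ltgtP z 0; rewrite ?sgr0 ?(ltr0_sg z0) ?(gtr0_sg z0)// ?subr0 ?sub0r ?subrr.
move=> xy; rewrite !sgE lerB// ler_nat.
  by case: (ltP 0 x) => // x0; rewrite (lt_le_trans x0 xy).
by case: (ltP y 0) => // y0; rewrite (le_lt_trans xy y0).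
Qed.

(** The difference of q (v) over a translation is kappa (v) times that of v, up to an
    error L times its square, which is O(h^2) in the mean by [diff_sqr_bound].
    Tested against psi, the main term converges to <kappa (v) g, psi> by
    [diff_taylor] with k = kappa (v), and the left side to - <q (v), D psi>. *)
Section chain_rule.
Context (R : realType) (Xi : set (R * R)) (Xi_open : open Xi).
Hypothesis Xi_bounded : bounded_set Xi.
Local Notation mu := (domain_measure Xi_open).
Local Notation X := (L2 mu).
Local Notation cl := (smooth_class Xi_open).
Variables (e : R * R) (v g : X).
Hypothesis wd : weak_derivative e v g.
Local Notation mul := (L2_mul (mu := mu)).
Local Notation diff h := (trans (h *: e) v - v).

(** Take k = sgn (psi) w, with w the difference of v and its translate, in
    [diff_bound]: if I is the integral of |psi| w^2, then I <= h |g| |psi w|, while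
    |psi w|^2 <= C I. *)
Lemma diff_sqr_bound (psi : R * R -> R) (r C : R) : test_function Xi psi -> room Xi e psi r -> 0 < r ->
  (forall x, `|psi x| <= C) ->
  exists2 K, 0 <= K & forall h, 0 <= h <= r ->
    dot (diff h) (mul (fun x => `|psi x|) (diff h)) <= K * h ^+ 2.
Proof.
move=> tp rp r0 hC; have sp : smooth psi by case: tp.
have C0 : 0 <= C := le_trans (normr_ge0 _) (hC 0).
have mm : measurable_fun setT (psi : plane R -> R) by exact: smooth_measurable.
have ma : measurable_fun setT ((fun x => `|psi x|) : plane R -> R) by exact: measurableT_comp.
have aC x : `| `|psi x| | <= C by rewrite normr_id.
have ms : measurable_fun setT ((fun x => Num.sg (psi x)) : plane R -> R).
  by apply: measurableT_comp => //; exact: measurable_sg.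
have sC x : `|Num.sg (psi x)| <= 1 by rewrite normr_sg lern1 leq_b1.
exists (`|g| ^+ 2 * C); first by rewrite mulr_ge0// sqr_ge0.
move=> h hr; have h0 : 0 <= h by case/andP: hr.
set w : X := diff h; set z := mul _ w; set I := dot w z.
have zE : mul psi (mul (fun x => Num.sg (psi x)) w) = z.
  apply/L2_eqP; apply: aeS3 (L2_mulE mm hC (mul (fun x => Num.sg (psi x)) w))
    (L2_mulE ms sC w) (L2_mulE ma aC w).
  by move=> x -> -> ->; rewrite mulrA [psi x * _]mulrC -normrEsg.
have b1 := diff_bound Xi_bounded wd tp rp hC (mul (fun x => Num.sg (psi x)) w) hr.
rewrite zE -/w -/I in b1.
have I0 : 0 <= I.
  rewrite /I /dot; have -> : (0 : R) = \int[mu]_x (fun=> 0 : R) x by rewrite /Rintegral integral0.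
  apply: ae_le_Rintegral; [exact: integrable_cst (mu_fin Xi_open Xi_bounded) 0|exact: L2_integrableM|].
  by apply: aeS (L2_mulE ma aC w) => x ->; rewrite mulrCA mulr_ge0// -expr2 sqr_ge0.
have b2 : `|z| ^+ 2 <= C * I.
  rewrite L2_normE /I -dotZr; apply: ae_le_Rintegral; [exact: L2_integrableM|exact: L2_integrableM|].
  apply: aeS2 (L2_mulE ma aC w) (L2_scaleE C z) => x h1 ->; rewrite h1.
  have -> : `|psi x| * w x * (`|psi x| * w x) = `|psi x| * (`|psi x| * w x ^+ 2) by ring.
  have -> : w x * (C * (`|psi x| * w x)) = C * (`|psi x| * w x ^+ 2) by ring.
  by rewrite ler_wpM2r// mulr_ge0// sqr_ge0.
have b3 : I ^+ 2 <= (`|g| * h) ^+ 2 * (C * I).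
  apply: (@le_trans _ _ ((`|g| * h) ^+ 2 * `|z| ^+ 2)); last by rewrite ler_wpM2l// sqr_ge0.
  rewrite -exprMn -[I ^+ 2]real_normK ?num_real// ler_pXn2r ?nnegrE ?mulr_ge0//.
  by apply: le_trans b1 _; rewrite le_eqVlt; apply/orP; left; apply/eqP; ring.
have [->|In0] := eqVneq I 0; first by rewrite !mulr_ge0// sqr_ge0.
have Ip : 0 < I by rewrite lt_def In0.
have b4 : I * I <= `|g| ^+ 2 * C * h ^+ 2 * I.
  by rewrite -expr2; apply: le_trans b3 _; rewrite le_eqVlt; apply/orP; left; apply/eqP; ring.
by rewrite ler_pM2r in b4.
Qed.

Variables (q kappa : R -> R) (L : R).
Hypotheses (lq : lip1 q) (mk : measurable_fun setT kappa) (k1 : forall a, `|kappa a| <= 1)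
  (L0 : 0 <= L) (qL : forall a b, `|q a - q b - kappa b * (a - b)| <= L * (a - b) ^+ 2).

Lemma chain_rule : weak_derivative e (L2_map q v) (mul (fun x => kappa (v x)) g).
Proof.
move=> psi tp; have sp : smooth psi by case: tp.
have mfin := mu_fin Xi_open Xi_bounded.
have [r r0 rp0] := test_room Xi_open e tp.
have rp : room Xi e psi r := rp0.
have [C C0 hC] := test_bounded tp.
have mm : measurable_fun setT (psi : plane R -> R) by exact: smooth_measurable.
have ma : measurable_fun setT ((fun x => `|psi x|) : plane R -> R) by exact: measurableT_comp.
have aC x : `| `|psi x| | <= C by rewrite normr_id.
have mkv : measurable_fun setT (fun x : plane R => kappa (v x)).
  by apply: measurableT_comp => //; exact: L2_measurable.
have k1v x : `|kappa (v x)| <= 1 by exact: k1.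
set f := L2_map q v; pose k : X := L2_of mu (fun x => kappa (v x)).
have kE : aeP mu (fun x => k x = kappa (v x)).
  by apply: (L2_of_bounded mfin (M := 1)) => //; apply: aeS (aeP_Xi Xi_open) => x _.
have mulC (w : X) : dot (mul (fun x => kappa (v x)) w) (cl psi) = dot w (mul psi k).
  apply: eq_Rintegral_ae; [exact: measurable_L2M|exact: measurable_L2M|].
  apply: aeS3 (aeI (L2_mulE mkv k1v w) (smooth_classE Xi_open Xi_bounded sp)) kE (L2_mulE mm hC k).
  by move=> x [-> ->] h ->; rewrite h; ring.
rewrite -(dot_smooth_class Xi_bounded _ (smooth_derive e sp)) -(dot_smooth_class Xi_bounded _ sp).
suff : dot f (cl ('D_e psi)) + dot (mul (fun x => kappa (v x)) g) (cl psi) = 0.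
  by move=> /eqP; rewrite addr_eq0 => /eqP.
rewrite mulC.
have [C1 C10 hC1] := slide_taylor Xi_open Xi_bounded e tp.
have [C3 C30 hC3] := diff_sqr_bound tp rp r0 hC.
apply: (@small_zero _ _ (`|f| * C1 + L * C3)); first by rewrite addr_ge0 ?mulr_ge0.
move=> eps eps0.
have [dl dl0 hdl] := diff_taylor Xi_bounded wd tp rp r0 hC k eps0.
exists (Num.min r dl); first by rewrite lt_min r0.
move=> h /andP[h0]; rewrite lt_min => /andP[hr hh].
have h0' := ltW h0; have hr' : 0 <= h <= r by rewrite h0' ltW.
have := hC1 f 0 h; rewrite add0r !slide0.
have -> : dot f (cl (slide e psi h)) = dot (L2_map q (trans (h *: e) v)) (cl psi).
  rewrite (dot_map_trans Xi_bounded v lq tp)// => x; apply: (room_pt rp).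
  by rewrite ger0_norm// ltW.
set fh := L2_map q _; set w : X := diff h => i1.
have i3 : `|dot w (mul psi k) - h * dot g (mul psi k)| <= eps * h by apply: hdl; rewrite h0.
(* the remainder of the first-order expansion of q, quadratic in w *)
pose Z : X := fh - f - mul (fun x => kappa (v x)) w.
have ZE : aeP mu (fun x => `|Z x| <= L * w x ^+ 2).
  apply: aeS3 (aeI (L2_subE (fh - f) (mul (fun x => kappa (v x)) w)) (L2_subE fh f))
    (aeI (L2_mulE mkv k1v w) (L2_mapE mfin v lq))
    (aeI (L2_mapE mfin (trans (h *: e) v) lq) (L2_subE (trans (h *: e) v) v)).
  by move=> x [-> ->] [-> ->] [-> ->]; exact: qL.
have ZB (Y : X) : aeP mu (fun x => `|Y x| <= L * w x ^+ 2) ->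
    dot Y (cl psi) <= L * (C3 * h ^+ 2).
  move=> YE; apply: (@le_trans _ _ (L * dot w (mul (fun x => `|psi x|) w))); last first.
    by rewrite ler_wpM2l// hC3.
  rewrite -dotZr; apply: ae_le_Rintegral; [exact: L2_integrableM|exact: L2_integrableM|].
  apply: aeS3 YE (aeI (L2_mulE ma aC w) (smooth_classE Xi_open Xi_bounded sp)) (L2_scaleE L (mul (fun x => `|psi x|) w)).
  move=> x Yx [h1 ->] ->; rewrite h1.
  have -> : w x * (L * (`|psi x| * w x)) = L * w x ^+ 2 * `|psi x| by ring.
  by rewrite (le_trans (ler_norm _))// normrM ler_wpM2r.
have i2 : `|dot (fh - f) (cl psi) - dot w (mul psi k)| <= L * (C3 * h ^+ 2).
  rewrite -mulC -dotBl -/Z ler_norml lerNl -dotNl; apply/andP; split; apply: ZB => //.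
  by apply: aeS2 ZE (L2_oppE Z) => x hx ->; rewrite normrN.
rewrite dotBl in i2.
move: i1 i2 i3; set a := dot fh _; set b := dot f (cl psi); set c := dot f _; set d := dot w _; set d' := dot g _.
move=> i1 i2 i3; rewrite -[h in leLHS](ger0_norm h0') -normrM.
have -> : h * (c + d') = (a - b + h * c) - (a - b - d) - (d - h * d') by ring.
apply: le_trans (ler_normB _ _) _; apply: lerD; last exact: i3.
apply: le_trans (ler_normB _ _) _; apply: le_trans (lerD i1 i2) _.
by rewrite le_eqVlt; apply/orP; left; apply/eqP; ring.
Qed.

End chain_rule.

(** * Dissipativity of the Neumann Laplacian *)

Section smooth_negative_part.
Context (R : realType) (eps : R).
Hypothesis eps_gt0 : 0 < eps.

Definition soft_abs (r : R) : R := Num.sqrt (r ^+ 2 + eps ^+ 2).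

Lemma soft_abs_sqr r : soft_abs r ^+ 2 = r ^+ 2 + eps ^+ 2.
Proof. by rewrite sqr_sqrtr// addr_ge0// sqr_ge0. Qed.

Lemma soft_abs_ge r : eps <= soft_abs r /\ `|r| <= soft_abs r.
Proof.
have s0 : 0 <= soft_abs r by exact: sqrtr_ge0.
split; rewrite -(ler_pXn2r (n := 2)) ?nnegrE//; rewrite ?(ltW eps_gt0)// soft_abs_sqr.
  by rewrite lerDr sqr_ge0.
by rewrite real_normK ?num_real// lerDl sqr_ge0.
Qed.

Lemma soft_abs_lip a b : `|soft_abs a - soft_abs b| <= `|a - b|.
Proof.
have [ea aa] := soft_abs_ge a; have [eb bb] := soft_abs_ge b.
have p : 0 < soft_abs a + soft_abs b by rewrite addr_gt0// (lt_le_trans eps_gt0).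
rewrite -(ler_pM2r p); have -> : `|soft_abs a - soft_abs b| * (soft_abs a + soft_abs b) = `|a - b| * `|a + b|.
  rewrite -[in LHS](gtr0_norm p) -!normrM -!subr_sqr !soft_abs_sqr; congr (`|_|); ring.
rewrite ler_wpM2l// (le_trans (ler_normD _ _))// lerD//.
Qed.

Lemma soft_abs_near r : `|soft_abs r - `|r| | <= eps.
Proof.
have [_ h] := soft_abs_ge r; rewrite ger0_norm ?subr_ge0// lerBlDr.
rewrite -(ler_pXn2r (n := 2)) ?nnegrE ?sqrtr_ge0//; last by rewrite addr_ge0// ltW.
rewrite soft_abs_sqr sqrrD real_normK ?num_real//.
have : 0 <= eps * `|r| by rewrite mulr_ge0// ltW.
by lra.
Qed.

(** The error is (A B - a b - eps^2) / B, with A and B the values at a and b; its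
    numerator lies between 0 and (a - b)^2 / 2 by the Cauchy-Schwarz inequality in
    the plane for (a, eps) and (b, eps), and by the inequality of arithmetic and
    geometric means. *)
Lemma soft_abs_taylor a b :
  `|soft_abs a - soft_abs b - b / soft_abs b * (a - b)| <= (2 * eps)^-1 * (a - b) ^+ 2.
Proof.
have [ea aa] := soft_abs_ge a; have [eb bb] := soft_abs_ge b.
set A := soft_abs a in ea aa *; set B := soft_abs b in eb bb *.
have A2 : A ^+ 2 = a ^+ 2 + eps ^+ 2 by exact: soft_abs_sqr.
have B2 : B ^+ 2 = b ^+ 2 + eps ^+ 2 by exact: soft_abs_sqr.
have B0 : 0 < B by exact: lt_le_trans eb.
have A0 : 0 < A by exact: lt_le_trans ea.
have -> : A - B - b / B * (a - b) = (A * B - a * b - (B ^+ 2 - b ^+ 2)) / B.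
  by field; rewrite gt_eqF.
have -> : B ^+ 2 - b ^+ 2 = eps ^+ 2 by rewrite B2; ring.
have h1 : a * b + eps ^+ 2 <= A * B.
  apply: le_trans (ler_norm _) _.
  have AB0 : 0 <= A * B := mulr_ge0 (ltW A0) (ltW B0).
  rewrite -(ler_pXn2r (n := 2)) ?nnegrE//.
  rewrite real_normK ?num_real// exprMn A2 B2 -subr_ge0.
  have -> : (a ^+ 2 + eps ^+ 2) * (b ^+ 2 + eps ^+ 2) - (a * b + eps ^+ 2) ^+ 2 = (eps * (a - b)) ^+ 2 by ring.
  exact: sqr_ge0.
have h2 : 2 * (A * B - a * b - eps ^+ 2) <= (a - b) ^+ 2.
  rewrite -subr_ge0; have -> : (a - b) ^+ 2 - 2 * (A * B - a * b - eps ^+ 2) =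
    (A - B) ^+ 2 + ((a ^+ 2 + eps ^+ 2) - A ^+ 2) + ((b ^+ 2 + eps ^+ 2) - B ^+ 2) by ring.
  by rewrite A2 B2 !subrr !addr0 sqr_ge0.
have N0 : 0 <= A * B - a * b - eps ^+ 2 by lra.
have Bi : 0 <= B^-1 by rewrite invr_ge0 ltW.
rewrite (ger0_norm (mulr_ge0 N0 Bi)).
have -> : (2 * eps)^-1 * (a - b) ^+ 2 = 2^-1 * (a - b) ^+ 2 * eps^-1 by rewrite invfM; ring.
have N1 : A * B - a * b - eps ^+ 2 <= 2^-1 * (a - b) ^+ 2 by lra.
have Be : B^-1 <= eps^-1 by rewrite lef_pV2.
exact: ler_pM N0 Bi N1 Be.
Qed.

(** A smooth function within eps / 2 of min (r, 0), as min (r, 0) = (r - |r|) / 2. *)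
Definition soft_neg (r : R) : R := (r - soft_abs r) / 2.
Definition soft_neg' (r : R) : R := (1 - r / soft_abs r) / 2.

Lemma soft_neg_lip : lip1 soft_neg.
Proof.
move=> a b; have h := soft_abs_lip a b.
have -> : soft_neg a - soft_neg b = ((a - b) - (soft_abs a - soft_abs b)) / 2 by rewrite /soft_neg; ring.
rewrite normrM (ger0_norm (x := 2^-1)) ?invr_ge0// ler_pdivrMr//.
apply: le_trans (ler_normB _ _) _; rewrite mulr_natr mulr2n lerD//.
Qed.

Lemma soft_neg_near r : `|soft_neg r - Num.min r 0| <= eps.
Proof.
have h := soft_abs_near r.
have -> : soft_neg r - Num.min r 0 = - ((soft_abs r - `|r|) / 2).
  rewrite /soft_neg; have [r0|r0] := leP r 0; first by rewrite ler0_norm//; field.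
  by rewrite gtr0_norm//; field.
rewrite normrN normrM (ger0_norm (x := 2^-1)) ?invr_ge0// ler_pdivrMr//.
by apply: le_trans h _; rewrite ler_pMr// ler1n.
Qed.

Lemma soft_neg'_01 r : 0 <= soft_neg' r <= 1.
Proof.
have [ee h] := soft_abs_ge r; have s0 : 0 < soft_abs r by exact: lt_le_trans ee.
have : `|r / soft_abs r| <= 1 by rewrite normrM normfV (gtr0_norm s0) ler_pdivrMr// mul1r.
by rewrite ler_norml /soft_neg' => /andP[? ?]; apply/andP; split; lra.
Qed.

Lemma soft_neg_taylor a b :
  `|soft_neg a - soft_neg b - soft_neg' b * (a - b)| <= (2 * eps)^-1 * (a - b) ^+ 2.
Proof.
have h := soft_abs_taylor a b.
have -> : soft_neg a - soft_neg b - soft_neg' b * (a - b) =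
   - ((soft_abs a - soft_abs b - b / soft_abs b * (a - b)) / 2).
  by rewrite /soft_neg /soft_neg'; move: (b / _) => z; field.
rewrite normrN normrM (ger0_norm (x := 2^-1)) ?invr_ge0// ler_pdivrMr//.
apply: le_trans h _; apply: ler_peMr; last by rewrite ler1n.
by rewrite mulr_ge0 ?sqr_ge0// invr_ge0 mulr_ge0// ltW.
Qed.

Lemma measurable_soft_neg' : measurable_fun setT soft_neg'.
Proof.
have ms : measurable_fun setT soft_abs by apply: lip1_measurable; exact: soft_abs_lip.
have -> : soft_neg' = (fun r => (1 - r * (soft_abs r)^-1) * 2^-1) by [].
apply: measurable_funM => //; apply: measurable_funB => //; apply: measurable_funM => //.
apply: continuous_measurable_fun => r; apply: cvgV; last first.
  exact: (lip1_continuous soft_abs_lip).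
by have [ee _] := soft_abs_ge r; rewrite gt_eqF// (lt_le_trans eps_gt0).
Qed.
End smooth_negative_part.

Section dissipativity.
Context (R : realType) (Xi : set (R * R)) (Xi_open : open Xi).
Hypothesis Xi_bounded : bounded_set Xi.
Local Notation mu := (domain_measure Xi_open).
Local Notation X := (L2 mu).
Local Notation mul := (L2_mul (mu := mu)).
Variables (rho : R) (v z : X).
Hypotheses (rho_ge0 : 0 <= rho) (Avz : neumann_operator rho v z).

Lemma dot_ge0 (x y : X) : (\forall xi \ae mu, 0 <= x xi * y xi) -> 0 <= dot x y.
Proof.
move=> h; have -> : (0 : R) = \int[mu]_x (fun=> 0 : R) x by rewrite /Rintegral integral0.
apply: ae_le_Rintegral; [exact: integrable_cst (mu_fin Xi_open Xi_bounded) 0|exact: L2_integrableM|exact: h].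
Qed.

Lemma neumann_dissipative : dot z v <= 0.
Proof.
case: Avz => w [[g [wg _ gr]] ->].
rewrite dotBl dotZl (gr v g wg) -!L2_normE subr_le0.
apply: (@le_trans _ _ 0); last by rewrite mulr_ge0// sqr_ge0.
by rewrite oppr_le0 addr_ge0// sqr_ge0.
Qed.

(** Green's formula with the test function soft_neg (v), of weak gradient
    soft_neg' (v) g with soft_neg' >= 0. *)
Lemma neumann_soft_neg eps w : 0 < eps -> neumann_laplacian v w ->
  dot w (L2_map (soft_neg eps) v) <= 0.
Proof.
move=> eps0 [g [wg _ gr]].
have mk : measurable_fun setT (fun x : plane R => soft_neg' eps (v x)).
  by apply: measurableT_comp; [exact: measurable_soft_neg'|exact: L2_measurable].
have k1 r : `|soft_neg' eps r| <= 1.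
  by have /andP[? ?] := soft_neg'_01 eps0 r; rewrite ger0_norm.
pose kg i := mul (fun x => soft_neg' eps (v x)) i.
have L0 : 0 <= (2 * eps)^-1 by rewrite invr_ge0 mulr_ge0// ltW.
have ch e i : weak_derivative e v i -> weak_derivative e (L2_map (soft_neg eps) v) (kg i).
  move=> wd; apply: (chain_rule Xi_bounded wd (soft_neg_lip eps0) (measurable_soft_neg' eps0) k1 L0).
  exact: soft_neg_taylor.
have kgE i : 0 <= dot i (kg i).
  apply: dot_ge0; apply: aeS (L2_mulE mk (fun x => k1 (v x)) i) => x ->.
  by rewrite mulrCA mulr_ge0// -?expr2 ?sqr_ge0//; case/andP: (soft_neg'_01 eps0 (v x)).
rewrite (gr (L2_map (soft_neg eps) v) (kg g.1, kg g.2)).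
  by rewrite oppr_le0 addr_ge0// kgE.
have w1 : weak_derivative (1, 0) v g.1 by move=> psi tp; have [h _] := wg psi tp; exact: h.
have w2 : weak_derivative (0, 1) v g.2 by move=> psi tp; have [_ h] := wg psi tp; exact: h.
move=> psi tp; split.
- exact: (ch _ _ w1 psi tp).
- exact: (ch _ _ w2 psi tp).
Qed.

(** Limit of [neumann_soft_neg] as eps tends to 0.  The term - rho v contributes
    - rho |min (v, 0)|^2. *)
Lemma neumann_negpart : dot z (negpart v) <= 0.
Proof.
have mf := mu_fin Xi_open Xi_bounded.
case: Avz => w [lap ->]; rewrite dotBl dotZl.
have vn : 0 <= dot v (negpart v).
  apply: dot_ge0; apply: aeS (L2_mapE mf v (lip1_min0 (R := R))) => x ->.
  by have [x0|x0] := leP (v x) 0; [rewrite -expr2 sqr_ge0|rewrite mulr0].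
rewrite subr_le0; apply: (@le_trans _ _ 0); last by rewrite mulr_ge0.
set m := Num.sqrt (fine (mu setT)).
have m0 : 0 <= m by exact: sqrtr_ge0.
apply/ler_addgt0Pl => eta eta0; rewrite addr0.
have K1 : 0 < `|w| * m + 1 by rewrite ltr_wpDl// mulr_ge0.
set eps := eta / (`|w| * m + 1); have eps0 : 0 < eps by exact: divr_gt0.
have h := neumann_soft_neg eps0 lap.
have -> : negpart v = L2_map (soft_neg eps) v - (L2_map (soft_neg eps) v - negpart v) by rewrite subKr.
rewrite dotBr -[leRHS]add0r lerD//.
have n1 : `|L2_map (soft_neg eps) v - negpart v| <= eps * m.
  rewrite -(ler_pXn2r (n := 2)) ?nnegrE ?(mulr_ge0 (ltW eps0) m0)//.
  rewrite exprMn sqr_sqrtr ?fine_ge0//.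
  apply: (L2_norm_bounded mf (ltW eps0)).
  apply: aeS3 (L2_subE (L2_map (soft_neg eps) v) (negpart v)) (L2_mapE mf v (soft_neg_lip eps0))
    (L2_mapE mf v (lip1_min0 (R := R))) => x -> -> hn; rewrite /negpart hn.
  exact: soft_neg_near.
rewrite -dotNr; apply: le_trans (dot_le _ _) _; rewrite normrN.
apply: (@le_trans _ _ (`|w| * (eps * m))); first by rewrite ler_wpM2l.
have -> : `|w| * (eps * m) = (`|w| * m) * eps by ring.
apply: (@le_trans _ _ ((`|w| * m + 1) * eps)); first by rewrite ler_wpM2r ?ltW// ltrDl.
by rewrite /eps mulrC divfK// gt_eqF.
Qed.

End dissipativity.

(** * Controls with values in the range *)

Lemma affine_continuous (R : realType) (V : normedModType R) (s : R) (a : V) :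
  continuous (fun x : V => s *: x + a).
Proof.
by move=> x; apply: cvgD; [apply: cvgZ; [exact: cvg_cst|exact: cvg_id]|exact: cvg_cst].
Qed.

Section borel_more.
Context d (T : measurableType d) (R : realType).
Variable mu : {measure set T -> \bar R}.
Local Notation X := (L2 mu).
Hypothesis sep : exists q : nat -> X, forall x (eps : R), 0 < eps ->
  exists n, `|x - q n| < eps.
Context d0 (I : measurableType d0) (nu : {measure set I -> \bar R}).
Variables (D : set I) (mD : measurable D).

Lemma borel_if (A : set I) (f g : I -> X) : measurable A -> borel_fun D f -> borel_fun D g ->
  borel_fun D (fun r => if r \in A then f r else g r).
Proof.
move=> mA bf bg; apply: borel_of_dist => // z.
have -> : (fun r => `|(if r \in A then f r else g r) - z|) =
  (fun r => \1_A r * `|f r - z| + (1 - \1_A r) * `|g r - z|).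
  apply/funext => r; rewrite indicE; case: ifP => _; first by rewrite mul1r subrr mul0r addr0.
  by rewrite mul0r add0r subr0 mul1r.
have m1 : measurable_fun D (\1_A : I -> R) by exact: measurable_indic.
apply: measurable_funD; apply: measurable_funM => //; try exact: borel_dist.
exact: measurable_funB.
Qed.

Lemma is_bochner_ae (f g : I -> X) w : borel_fun D f -> borel_fun D g ->
  aeP nu (fun r => D r -> f r = g r) ->
  is_bochner_integral nu D f w -> is_bochner_integral nu D g w.
Proof.
move=> bf bg fg [_ [s [hs hi hw]]]; split=> //; exists s; split=> //.
suff -> : (fun n => (\int[nu]_(x in D) (`|g x - step_fun (s n) x|)%:E)%E) =
    (fun n => (\int[nu]_(x in D) (`|f x - step_fun (s n) x|)%:E)%E) by exact: hi.
apply/funext => n.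
have ms (h : I -> X) : borel_fun D h -> measurable_fun D (fun r => (`|h r - step_fun (s n) r|)%:E).
  move=> bh; apply/measurable_EFinP.
  have := borel_dist mD 0 (borel_sub_step sep mD bh (fun p ps => let: And3 a _ _ := hs n p ps in a)).
  by apply: eq_measurable_fun => r _; rewrite subr0.
apply: ae_eq_integral => //; [exact: ms|exact: ms|].
by apply: aeS fg => r h Dr; rewrite /= h.
Qed.

(** Holds although [bochner_integral] is defined by choice: the two integrands have
    the same integrals, hence the same chosen one. *)
Lemma bochner_integral_ae (f g : I -> X) : borel_fun D f -> borel_fun D g ->
  aeP nu (fun r => D r -> f r = g r) -> bochner_integral nu D f = bochner_integral nu D g.
Proof.
move=> bf bg fg; rewrite /bochner_integral; 
suff -> : is_bochner_integral nu D f = is_bochner_integral nu D g by [].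
apply/seteqP; split=> w; first exact: is_bochner_ae.
by apply: is_bochner_ae => //; apply: aeS fg => r h Dr; rewrite h.
Qed.

End borel_more.

Section adjoint.
Context d (T : measurableType d) (R : realType).
Variable mu : {measure set T -> \bar R}.
Local Notation X := (L2 mu).

(** The choice in [adjoint] is made in a nonempty set. *)
Lemma dot_adjoint (A : X -> X) (x z : X) : linear A -> continuous A ->
  dot (A x) z = dot x (adjoint A z).
Proof. by move=> lA cA; have := @xgetPex X 0 _ (adjointP z lA cA); exact. Qed.

End adjoint.

Section controls.
Context d (T : measurableType d) (R : realType).
Variable mu : {measure set T -> \bar R}.
Local Notation X := (L2 mu).
Local Notation leb := (@lebesgue_measure R).
Hypothesis mu_fin : (mu setT < +oo)%E.
Variable U : R.
Hypothesis U_gt0 : 0 < U.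

Definition clip (x : X) : X := L2_map (fun r => Num.min (Num.max r 0) U) x.

Lemma lip1_clip : lip1 (fun r : R => Num.min (Num.max r 0) U).
Proof.
move=> a b; have h : `|Num.max a 0 - Num.max b 0| <= `|a - b| by exact: max0_dist.
apply: le_trans h; move: (Num.max a 0) (Num.max b 0) => {}a {}b.
have [a1|a1] := leP a U; have [b1|b1] := leP b U => //.
- by rewrite !ler0_norm; lra.
- by rewrite !ger0_norm; lra.
- by rewrite subrr normr0.
Qed.

Lemma clip_in_range x : in_range U (clip x).
Proof.
apply: aeS (L2_mapE mu_fin x lip1_clip) => xi.
rewrite /clip => ->; rewrite le_min ge_min lexx orbT andbT le_max lexx orbT /=.
exact: ltW.
Qed.

Lemma clip_id x : in_range U x -> clip x = x.
Proof.
move=> hx; apply/L2_eqP; apply: aeS2 hx (L2_mapE mu_fin x lip1_clip) => xi /andP[x0 xU].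
by rewrite /clip => ->; rewrite (max_idPl x0); apply/min_idPl.
Qed.

Lemma clip_continuous : continuous clip.
Proof. exact: (L2_map_continuous mu_fin lip1_clip). Qed.

Lemma clip_lip x y : `|clip x - clip y| <= `|x - y|.
Proof. exact: (L2_map_lip mu_fin x y lip1_clip). Qed.

Lemma in_range_norm : exists2 M, 0 <= M & forall x : X, in_range U x -> `|x| <= M.
Proof.
exists (U * Num.sqrt (fine (mu setT))); first by rewrite mulr_ge0 ?sqrtr_ge0// ltW.
move=> x hx; have r0 : 0 <= U * Num.sqrt (fine (mu setT)) by rewrite mulr_ge0 ?sqrtr_ge0// ltW.
rewrite -(ler_pXn2r (n := 2)) ?nnegrE// exprMn sqr_sqrtr ?fine_ge0//.
apply: (L2_norm_bounded mu_fin (ltW U_gt0)).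
by apply: aeS hx => xi /andP[x0 xU]; rewrite ger0_norm.
Qed.

Lemma in_range_cvx (x y : X) (s : R) : 0 <= s <= 1 -> in_range U x -> in_range U y ->
  in_range U (s *: x + (1 - s) *: y).
Proof.
move=> /andP[s0 s1] hx hy.
apply: aeS3 (aeI hx hy) (L2_addE (s *: x) ((1 - s) *: y)) (aeI (L2_scaleE s x) (L2_scaleE (1 - s) y)).
move=> xi [/andP[x0 xU] /andP[y0 yU]] -> [-> ->]; apply/andP; split; first by rewrite addr_ge0 ?mulr_ge0//; lra.
have -> : U = s * U + (1 - s) * U by ring.
by rewrite lerD// ler_wpM2l//; lra.
Qed.

Hypothesis sep : exists q : nat -> X, forall x (eps : R), 0 < eps ->
  exists n, `|x - q n| < eps.

(** Admissible controls are constrained only almost everywhere on a time interval;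
    requiring the constraint at every time makes it possible to glue controls and
    to form convex combinations without exceptional sets.  [control_rep] shows that
    nothing is lost. *)
Definition control (u : R -> X) : Prop :=
  borel_fun (setT : set (measurableTypeR R)) u /\ forall r, in_range U (u r).

Lemma control_borel (D : set (measurableTypeR R)) u : control u -> borel_fun D u.
Proof. by move=> [bu _]; exact: (measurable_funS measurableT (@subsetT _ D) bu). Qed.

Lemma control_if (A : set (measurableTypeR R)) u v : measurable A -> control u -> control v ->
  control (fun r => if r \in A then u r else v r).
Proof.
move=> mA [bu ru] [bv rv]; split; first exact: borel_if.
by move=> r; case: ifP.
Qed.

Lemma control_cst x : in_range U x -> control (fun=> x).
Proof. by move=> rx; split=> //; apply: measurable_cst. Qed.

Lemma control_cvx u v (s : R) : 0 <= s <= 1 -> control u -> control v ->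
  control (fun r => s *: u r + (1 - s) *: v r).
Proof.
move=> s01 [bu ru] [bv rv]; split; last by move=> r; exact: in_range_cvx.
have -> : (fun r => s *: u r + (1 - s) *: v r) = (fun r => (1 - s) *: v r + s *: u r).
  by apply/funext => r; rewrite addrC.
apply: (@borel_caratheodory _ _ _ mu sep _ (measurableTypeR R) setT measurableT (fun r x => (1 - s) *: x + s *: u r) v bv).
  by move=> r _; exact: (@affine_continuous R X).
move=> x z.
have cH : continuous (fun y : X => `|s *: y + (1 - s) *: x - z|).
  move=> y; exact: (@continuous_comp X X R^o _ _ y (@affine_continuous R X s _ y) (@dist_continuous R X z _)).
move: (borel_compR measurableT bu cH); apply: eq_measurable_fun => r _ /=.
by rewrite [(1 - s) *: x + _]addrC.
Qed.

(** Extend by 0 and clip all values into the range. *)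
Lemma control_rep (D : set (measurableTypeR R)) u : measurable D -> borel_fun D u ->
  aeP leb (fun r => D r -> in_range U (u r)) ->
  exists2 u', control u' & aeP leb (fun r => D r -> u r = u' r).
Proof.
move=> mD bu hu; exists (clip \o (patch (fun=> 0) D u)).
  split; last by move=> r; exact: clip_in_range.
  apply: borel_comp => //; last exact: clip_continuous.
  rewrite /borel_fun -(setUv D); apply/measurable_funU => //; first exact: measurableC.
  split.
    by apply: eq_measurable_fun bu => r rD; rewrite patchE rD.
  have : measurable_fun (~` D) ((fun=> (0 : X)) : measurableTypeR R -> borel X) by exact: measurable_cst.
  by apply: eq_measurable_fun => r; rewrite inE => rD; rewrite patchE memNset.
apply: aeS hu => r hr Dr /=; rewrite patchE mem_set//.
by rewrite clip_id//; exact: hr.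
Qed.

End controls.

(** * The input map of the control system *)

Lemma aeW d (T : measurableType d) (R : realType) (mu : {measure set T -> \bar R})
  (P : T -> Prop) : (forall x, P x) -> aeP mu P.
Proof. by rewrite /aeP => h; apply: filterE. Qed.

Lemma congr2 (A1 A2 A3 : Type) (f : A1 -> A2 -> A3) a b c e : a = b -> c = e -> f a c = f b e.
Proof. by move=> -> ->. Qed.

Section states.
Context d (E : measurableType d) (R : realType).
Variable mu : {measure set E -> \bar R}.
Local Notation X := (L2 mu).
Local Notation leb := (@lebesgue_measure R).
Hypothesis mu_fin : (mu setT < +oo)%E.
Hypothesis sep : exists q : nat -> X, forall x (eps : R), 0 < eps ->
  exists n, `|x - q n| < eps.
Variables (U : R) (S : R -> X -> X) (B : X -> X) (KB : R).
Hypotheses (U_gt0 : 0 < U) (S_C0 : C0_semigroup S)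
  (S_contr : forall t x, 0 <= t -> `|S t x| <= `|x|)
  (S_nonneg : forall t x, 0 <= t -> L2_nonneg x -> L2_nonneg (S t x))
  (B_linear : linear B) (KB_ge0 : 0 <= KB) (B_bound : forall x, `|B x| <= KB * `|x|)
  (B_nonneg : forall x, L2_nonneg x -> L2_nonneg (B x)).
Local Notation control := (control U).
Local Notation itv t s := (`[t, s]%classic : set (measurableTypeR R)).

Lemma B_continuous : continuous B.
Proof.
move=> x; apply/(@continuous_atP R X X) => eps eps0; exists (eps / (KB + 1)).
  by rewrite divr_gt0// ltr_wpDl.
move=> y; rewrite -(linearB' _ _ B_linear) ltr_pdivlMr ?ltr_wpDl// => h.
apply: le_lt_trans (B_bound _) (le_lt_trans _ h).
by rewrite mulrC ler_wpM2l// lerDl.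
Qed.

(** The contribution to the state at time s of the control applied at time r.  The
    maximum extends it to r > s, so that it is jointly defined for all times. *)
Definition push (s : R) (u : R -> X) (r : R) : X := S (Num.max (s - r) 0) (B (u r)).

Let max_ge0 (r : R) : 0 <= Num.max r 0.
Proof. by rewrite le_max lexx orbT. Qed.

Lemma S_max_measurable (s : R) (x z : X) (D : set (measurableTypeR R)) :
  measurable D -> measurable_fun D (fun r => `|S (Num.max (s - r) 0) x - z|).
Proof.
move=> mD; apply: measurable_funTS; apply: continuous_measurable_fun.
move=> r; apply/(@continuous_atP R R^o R^o) => eps eps0.
have [dl dl0 hdl] := (@continuous_atP R R^o X _ (s - r)).1 (@S_max_continuous _ _ _ _ _ S_C0 x (s - r)) eps eps0.
exists dl => // r' rr'; have /hdl : `|s - r - (s - r')| < dl.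
  by rewrite opprB addrC addrA subrK distrC.
apply: le_lt_trans; apply: le_trans (ler_dist_dist _ _) _.
by rewrite opprB addrA subrK.
Qed.

Lemma push_borel s u (D : set (measurableTypeR R)) : measurable D -> borel_fun D u ->
  borel_fun D (push s u).
Proof.
move=> mD bu.
apply: (@borel_caratheodory _ _ _ mu sep _ (measurableTypeR R) D mD
  (fun r x => S (Num.max (s - r) 0) (B x)) u bu).
- move=> r _ x; apply: (@continuous_comp X X X B _ x (B_continuous (x:=x))).
  exact: (S_continuous S_C0 (max_ge0 _)).
- by move=> x z; exact: S_max_measurable.
Qed.

(** The state reached at time s from 0 at time t.  The lock prevents the unfolding
    of the chosen integral during unification. *)
Definition input_map (t s : R) (u : R -> X) : X :=
  locked (bochner_integral leb (itv t s) (push s u)).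

Let mI a b : measurable (itv a b). Proof. exact: measurable_itv. Qed.

Lemma push_itv t s u r : itv t s r -> S (s - r) (B (u r)) = push s u r.
Proof.
rewrite /= in_itv/= => /andP[_ rs]; rewrite /push; congr (S _ _).
by apply/esym/max_idPl; rewrite subr_ge0.
Qed.

Lemma mildE t y u s : borel_fun (itv t s) u -> mild S B t y u s = S (s - t) y + input_map t s u.
Proof.
move=> bu.
suff h : bochner_integral leb (itv t s) (fun r => S (s - r) (B (u r))) = input_map t s u by rewrite -h.
rewrite /input_map -lock.
have bp := push_borel s (mI t s) bu.
apply: (bochner_integral_ae sep (mI t s)) => //.
  by apply: eq_measurable_fun bp => r; rewrite inE => rI; rewrite (push_itv _ rI).
by apply: aeW => r; exact: push_itv.
Qed.

Lemma input_map_ae t s u u' : borel_fun (itv t s) u -> borel_fun (itv t s) u' ->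
  aeP leb (fun r => itv t s r -> u r = u' r) -> input_map t s u = input_map t s u'.
Proof.
move=> bu bu' uu'.
have pp : aeP leb (fun r => itv t s r -> push s u r = push s u' r).
  by apply: aeS uu' => r h rI; rewrite /push h.
by rewrite /input_map (bochner_integral_ae sep (mI t s) (push_borel s (mI t s) bu) (push_borel s (mI t s) bu') pp).
Qed.

Variable M : R.
Hypotheses (M_ge0 : 0 <= M) (M_bound : forall x : X, in_range U x -> `|x| <= M).

Lemma push_bound s u r : control u -> `|push s u r| <= KB * M.
Proof.
move=> [_ ru]; apply: le_trans (S_contr _ (max_ge0 _)) _.
by apply: le_trans (B_bound _) _; rewrite ler_wpM2l// M_bound.
Qed.

Lemma integrable_push t s s' u v : control u -> leb.-integrable (itv t s) (EFin \o (fun r => dot (push s' u r) v)).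
Proof.
move=> gu; have bp := push_borel s' (mI t s) (control_borel (D := itv t s) gu).
exact: (integrable_dot (mI t s) (lebesgue_itv_lty t s) bp (fun r _ => push_bound s' r gu)).
Qed.

Lemma dot_input_map t s u v : control u -> dot (input_map t s u) v = \int[leb]_(r in itv t s) dot (push s u r) v.
Proof.
move=> gu; have bp := push_borel s (mI t s) (control_borel (D := itv t s) gu).
rewrite /input_map -lock.
exact: (dot_bochner sep (mI t s) (lebesgue_itv_lty t s) bp (fun r _ => push_bound s r gu)).
Qed.

Lemma input_map_bound : exists2 K, 0 <= K & forall t s u, t <= s -> control u -> `|input_map t s u| <= (s - t) * K.
Proof.
exists (KB * M); first by rewrite mulr_ge0.
move=> t s u ts gu.
have st : 0 <= s - t by rewrite subr_ge0.
have [->|g0] := eqVneq (input_map t s u) 0; first by rewrite normr0 !mulr_ge0.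
have gp : 0 < `|input_map t s u| by rewrite normr_gt0.
rewrite -(ler_pM2r gp) -expr2 L2_normE dot_input_map//.
apply: (@le_trans _ _ (\int[leb]_(r in itv t s) (KB * M * `|input_map t s u|))).
  apply: le_Rintegral => //; first exact: integrable_push.
    exact: (bounded_integrable (mI t s) (lebesgue_itv_lty t s) (K := `|KB * M * `|input_map t s u| |)).
  by move=> r _; apply: le_trans (dot_le _ _) _; rewrite ler_wpM2r// push_bound.
rewrite Rintegral_cst//.
have -> : fine (leb (itv t s)) = s - t by rewrite -[in RHS](lebesgue_itvE t st) subrKC.
by rewrite le_eqVlt; apply/orP; left; apply/eqP; ring.
Qed.

(** The cone of nonnegative functions is self-dual: test with - min (x, 0). *)
Lemma nonneg_dual (x : X) : (forall v, L2_nonneg v -> 0 <= dot x v) -> L2_nonneg x.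
Proof.
move=> h; apply/(negpart_nonneg mu_fin); apply/eqP; rewrite -normr_eq0 -sqrf_eq0.
have e : dot x (negpart x) = `|negpart x| ^+ 2.
  rewrite L2_normE; apply: eq_Rintegral_ae; [exact: measurable_L2M|exact: measurable_L2M|].
  apply: aeS (L2_mapE mu_fin x (lip1_min0 (R := R))) => xi; rewrite /negpart => ->.
  by case: leP => // _; rewrite !mulr0.
have := h (- negpart x); rewrite dotNr e => hn; apply/eqP/le_anti; rewrite sqr_ge0 andbT.
rewrite -oppr_ge0; apply: hn.
apply: aeS2 (L2_oppE (negpart x)) (L2_mapE mu_fin x (lip1_min0 (R := R))) => xi ->.
by rewrite /negpart => ->; rewrite oppr_ge0 ge_min lexx orbT.
Qed.

Lemma dot_nonneg (x v : X) : L2_nonneg x -> L2_nonneg v -> 0 <= dot x v.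
Proof.
move=> hx hv; have -> : (0 : R) = \int[mu]_x (fun=> 0 : R) x by rewrite /Rintegral integral0.
apply: ae_le_Rintegral; [exact: integrable_cst mu_fin 0|exact: L2_integrableM|].
by apply: aeS2 hx hv => xi x0 v0; rewrite mulr_ge0.
Qed.

Lemma input_map_nonneg t s u : control u -> L2_nonneg (input_map t s u).
Proof.
move=> gu; apply: nonneg_dual => v v0; rewrite dot_input_map//; apply: Rintegral_ge0 => r _.
apply: dot_nonneg => //; apply: S_nonneg => //; apply: B_nonneg.
by apply: aeS (gu.2 r) => xi /andP[].
Qed.

Lemma push_push s s' u r : r <= s <= s' -> S (s' - s) (push s u r) = push s' u r.
Proof.
move=> /andP[rs ss']; rewrite /push !(max_idPl _) ?subr_ge0//; last exact: le_trans ss'.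
rewrite -S_add ?subr_ge0//; by congr (S _ _); rewrite addrA subrK.
Qed.

Lemma input_map_split t s s' u : t <= s <= s' -> control u ->
  input_map t s' u = S (s' - s) (input_map t s u) + input_map s s' u.
Proof.
move=> /andP[ts ss'] gu; have h0 : 0 <= s' - s by rewrite subr_ge0.
have lS := S_linear S_C0 h0; have cS := S_continuous S_C0 h0.
apply: dot_inj => v; rewrite dotDl.
have [w hw] := adjointP v lS cS.
have tss : t <= s <= s' by rewrite ts ss'.
have e : \int[leb]_(r in itv t s) dot (push s' u r) v = dot (S (s' - s) (input_map t s u)) v.
  apply: etrans (esym (hw (input_map t s u))); apply: etrans (esym (dot_input_map t s w gu)).
  apply: eq_Rintegral => r; rewrite inE /= in_itv/= => /andP[_ rs].
  have rss : r <= s <= s' by rewrite rs ss'.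
  by rewrite -(hw (push s u r)) (push_push u rss).
have sp := Rintegral_itv_split tss (integrable_push t s' s' v gu).
exact: (etrans (dot_input_map t s' v gu) (etrans sp (congr2 +%R e (esym (dot_input_map s s' v gu))))).
Qed.

Lemma push_linear s (a : R) u v r : push s (fun r => a *: u r + (1 - a) *: v r) r =
  a *: push s u r + (1 - a) *: push s v r.
Proof.
have lS := S_linear S_C0 (max_ge0 (s - r)).
rewrite /push (linearD' _ _ B_linear) !(linearZ' _ _ B_linear).
by rewrite (linearD' _ _ lS) !(linearZ' _ _ lS).
Qed.

Lemma input_map_cvx t s (a : R) u v : 0 <= a <= 1 -> control u -> control v ->
  input_map t s (fun r => a *: u r + (1 - a) *: v r) = a *: input_map t s u + (1 - a) *: input_map t s v.
Proof.
move=> a01 gu gv; apply: dot_inj => w.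
have gc := control_cvx sep a01 gu gv.
have iu := integrable_push t s s w gu; have iv := integrable_push t s s w gv.
set g := input_map t s _.
have eg : dot g w = \int[leb]_(r in itv t s) (a * dot (push s u r) w + (1 - a) * dot (push s v r) w).
  apply: etrans (dot_input_map t s w gc) _.
  by apply: eq_Rintegral => r _; rewrite push_linear dotDl !dotZl.
rewrite eg (RintegralD (mI t s) (integrable_scaleR (mI t s) a iu) (integrable_scaleR (mI t s) (1 - a) iv)).
rewrite (RintegralZl a (mI t s) iu) (RintegralZl (1 - a) (mI t s) iv).
apply: etrans (esym (etrans (dotDl (a *: input_map t s u) ((1 - a) *: input_map t s v) w)
  (congr2 +%R (dotZl a (input_map t s u) w) (dotZl (1 - a) (input_map t s v) w)))).
exact: (congr2 (fun p q : R => a * p + (1 - a) * q) (esym (dot_input_map t s w gu)) (esym (dot_input_map t s w gv))).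
Qed.

End states.

(** * The perturbed problem, the costate and the maximum principle *)

Lemma continuous_add_real (R : realType) (V : normedModType R) (f g : V -> R) :
  continuous f -> continuous g -> continuous (fun x => f x + g x).
Proof. by move=> cf cg x; apply: cvgD; [exact: cf|exact: cg]. Qed.

Lemma tail_arith (R : realFieldType) (j0 j1 d A A' r1 r2 r3 D : R) :
  j0 = A + (r1 + r2) -> j1 = A' + (r1 + r3) -> d = D -> j0 + d <= j1 -> A + r2 + D <= A' + r3.
Proof. by move=> -> -> -> h; lra. Qed.

Lemma exchange_arith (R : realFieldType) (j0 j1 d A r0 r1 D0 D1 : R) :
  j0 = A + r0 -> j1 = A + r1 -> d = D0 - D1 -> j0 + d <= j1 -> r0 + D0 <= r1 + D1.
Proof. by move=> -> -> -> h; lra. Qed.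

Section optimal_control.
Context d (E : measurableType d) (R : realType).
Variable mu : {measure set E -> \bar R}.
Local Notation X := (L2 mu).
Local Notation leb := (@lebesgue_measure R).
Hypothesis mu_fin : (mu setT < +oo)%E.
Hypothesis sep : exists q : nat -> X, forall x (eps : R), 0 < eps ->
  exists n, `|x - q n| < eps.
Variables (T U : R) (S : R -> X -> X) (B : X -> X) (KB : R).
Hypotheses (U_gt0 : 0 < U) (S_C0 : C0_semigroup S)
  (S_contr : forall t x, 0 <= t -> `|S t x| <= `|x|)
  (B_linear : linear B) (KB_ge0 : 0 <= KB) (B_bound : forall x, `|B x| <= KB * `|x|).
Variable M : R.
Hypotheses (M_ge0 : 0 <= M) (M_bound : forall x : X, in_range U x -> `|x| <= M).
Variables (Phi h : X -> R) (Kh : R).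
Hypotheses (Phi_cvx : cvx Phi) (Phi_lba : locally_bounded_above Phi)
  (h_cvx : cvx h) (h_lba : locally_bounded_above h)
  (h_bound : forall x, in_range U x -> `|h x| <= Kh).
Local Notation control := (control U).
Local Notation itv t s := (`[t, s]%classic : set (measurableTypeR R)).
Local Notation input_map := (input_map S B).
Local Notation push := (push S B).

Let mI a b : measurable (itv a b). Proof. exact: measurable_itv. Qed.
Let intp := integrable_push sep S_C0 S_contr B_linear KB_ge0 B_bound M_bound.
Let dotg := dot_input_map sep S_C0 S_contr B_linear KB_ge0 B_bound M_bound.

Definition running_cost (t s : R) (u : R -> X) : R := \int[leb]_(r in itv t s) h (u r).

Lemma h_measurable (D : set (measurableTypeR R)) u : measurable D -> control u ->
  measurable_fun D (fun r => h (u r)).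
Proof.
move=> mD gu; exact: (borel_compR mD (control_borel (D := D) gu) (cvx_continuous h_cvx h_lba)).
Qed.

Lemma integrable_running_cost t s u : control u -> leb.-integrable (itv t s) (EFin \o (fun r => h (u r))).
Proof.
move=> gu; apply: (bounded_integrable (mI t s) (lebesgue_itv_lty t s) (K := Kh)).
  exact: h_measurable.
by move=> r _; apply: h_bound; exact: gu.2.
Qed.

Lemma running_cost_lower t s u : t <= s -> control u -> - (Kh * (s - t)) <= running_cost t s u.
Proof.
move=> ts gu; have st : 0 <= s - t by rewrite subr_ge0.
have e : fine (leb (itv t s)) = s - t by rewrite -[in RHS](lebesgue_itvE t st) subrKC.
rewrite -mulNr -e -(Rintegral_cst leb (mI t s)).
apply: le_Rintegral => //; last by move=> r _; have := h_bound (gu.2 r); rewrite ler_norml => /andP[].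
  exact: (bounded_integrable (mI t s) (lebesgue_itv_lty t s) (K := `|- Kh|)).
exact: integrable_running_cost.
Qed.

Lemma running_cost_split t s s' u : t <= s <= s' -> control u -> running_cost t s' u = running_cost t s u + running_cost s s' u.
Proof. by move=> h1 gu; exact: (Rintegral_itv_split h1 (integrable_running_cost t s' gu)). Qed.

Lemma running_cost_eq t s u u' : control u -> control u' -> aeP leb (fun r => itv t s r -> u r = u' r) ->
  running_cost t s u = running_cost t s u'.
Proof.
move=> gu gu' uu'; congr fine; apply: ae_eq_integral => //.
- by apply/measurable_EFinP; exact: h_measurable.
- by apply/measurable_EFinP; exact: h_measurable.
- by apply: aeS uu' => r e rI; rewrite /= e.
Qed.

Section from_time.
Variables (t : R) (y : X).
Hypothesis tT : t <= T.

Definition final_state (u : R -> X) : X := S (T - t) y + input_map t T u.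
(** The cost of u when the final state is displaced by z. *)
Definition perturbed_cost (u : R -> X) (z : X) : R := Phi (final_state u + z) + running_cost t T u.

Lemma perturbed_cost_lower z : exists m, forall u, control u -> m <= perturbed_cost u z.
Proof.
have [K K0 hK] := cvx_affine_minorant Phi_cvx Phi_lba.
have [K' K'0 hK'] := input_map_bound sep S_C0 S_contr B_linear KB_ge0 B_bound M_ge0 M_bound.
exists (Phi 0 - K * (`|y| + (T - t) * K' + `|z|) - Kh * (T - t)) => u gu.
apply: lerD; last exact: running_cost_lower.
apply: le_trans (hK _); rewrite lerD2l lerN2 ler_wpM2l//.
apply: le_trans (ler_normD _ _) _; rewrite lerD2r.
apply: le_trans (ler_normD _ _) _; apply: lerD; last exact: hK'.
by apply: S_contr; rewrite subr_ge0.
Qed.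

Lemma perturbed_cost_cvx a u v z w : 0 <= a <= 1 -> control u -> control v ->
  perturbed_cost (fun r => a *: u r + (1 - a) *: v r) (a *: z + (1 - a) *: w) <= a * perturbed_cost u z + (1 - a) * perturbed_cost v w.
Proof.
move=> a01 gu gv; have gc := control_cvx sep a01 gu gv.
have e : final_state (fun r => a *: u r + (1 - a) *: v r) + (a *: z + (1 - a) *: w) =
    a *: (final_state u + z) + (1 - a) *: (final_state v + w).
  rewrite /final_state (input_map_cvx sep S_C0 S_contr B_linear KB_ge0 B_bound M_bound t T a01 gu gv).
  move: (S (T - t) y) (input_map t T u) (input_map t T v) => s g g'.
  rewrite !scalerDr [RHS]addrACA; congr (_ + _).
  by rewrite [RHS]addrACA -scalerDl subrKC scale1r.
rewrite /perturbed_cost (congr1 Phi e).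
have r : running_cost t T (fun r => a *: u r + (1 - a) *: v r) <= a * running_cost t T u + (1 - a) * running_cost t T v.
  have iu := integrable_running_cost t T gu; have iv := integrable_running_cost t T gv.
  rewrite /running_cost -(RintegralZl a (mI t T) iu) -(RintegralZl (1 - a) (mI t T) iv).
  have ia := integrable_scaleR (mI t T) a iu; have ib := integrable_scaleR (mI t T) (1 - a) iv.
  rewrite -(RintegralD (mI t T) ia ib).
  apply: le_Rintegral => //; first exact: integrable_running_cost.
    exact: integrable_addR.
  by move=> r _; exact: h_cvx.
have p := Phi_cvx (final_state u + z) (final_state v + w) a01.
apply: le_trans (lerD p r) _; rewrite le_eqVlt; apply/orP; left; apply/eqP; ring.
Qed.

Let F z := inf [set perturbed_cost u z | u in control].

Let F_le u z : control u -> F z <= perturbed_cost u z.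
Proof.
move=> gu; apply: ge_inf; last by exists u.
by have [m hm] := perturbed_cost_lower z; exists m => _ [v gv <-]; exact: hm.
Qed.

Variable u0 : R -> X.
Hypothesis gu0 : control u0.

Let F_near z eps : 0 < eps -> exists2 u, control u & perturbed_cost u z < F z + eps.
Proof.
move=> eps0; have hi : has_inf [set perturbed_cost u z | u in control].
  split; first by exists (perturbed_cost u0 z), u0.
  by have [m hm] := perturbed_cost_lower z; exists m => _ [v gv <-]; exact: hm.
have [_ [u gu <-] hu] := inf_adherent eps0 hi.
by exists u.
Qed.

Let F_cvx : cvx F.
Proof.
move=> z w a a01; apply/ler_addgt0Pl => eps eps0.
have [u gu hu] := F_near z eps0; have [v gv hv] := F_near w eps0.
apply: le_trans (F_le _ (control_cvx sep a01 gu gv)) _.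
apply: le_trans (perturbed_cost_cvx z w a01 gu gv) _.
have /andP[a0 a1] := a01; have a1' : 0 <= 1 - a by rewrite subr_ge0.
apply: le_trans (lerD (ler_wpM2l a0 (ltW hu)) (ler_wpM2l a1' (ltW hv))) _.
by rewrite le_eqVlt; apply/orP; left; apply/eqP; ring.
Qed.

Let F_lba : locally_bounded_above F.
Proof.
move=> z; have [m [r [r0 hr]]] := Phi_lba (final_state u0 + z).
exists (m + running_cost t T u0), r; split => // w wr.
by apply: le_trans (F_le _ gu0) _; rewrite /perturbed_cost addrA lerD2r; exact: hr.
Qed.

Hypothesis u0_opt : forall u, control u -> perturbed_cost u0 0 <= perturbed_cost u 0.

(** The infimum of [perturbed_cost] over u is convex in z, as the partial infimum of
    a jointly convex function, bounded below by an affine minorant of Phi, and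
    bounded above near each point by the cost of the single control u0. *)
Lemma optimal_subgradient : exists p, forall u z, control u -> perturbed_cost u0 0 + dot p z <= perturbed_cost u z.
Proof.
have [p hp] := convex_subgradient F_cvx F_lba.
exists p => u z gu; apply: le_trans (F_le z gu); apply: le_trans (hp z); rewrite lerD2r.
by apply: lb_le_inf; [exists (perturbed_cost u0 0), u0|move=> _ [v gv <-]; exact: u0_opt].
Qed.

Variable p : X.
Hypothesis hp : forall u z, control u -> perturbed_cost u0 0 + dot p z <= perturbed_cost u z.

(** The solution of the adjoint equation with final value p. *)
Definition costate (s : R) : X := adjoint (S (T - s)) p.

Lemma dot_costate s x : s <= T -> dot (S (T - s) x) p = dot x (costate s).
Proof.
move=> sT; have h0 : 0 <= T - s by rewrite subr_ge0.
exact: (dot_adjoint x p (S_linear S_C0 h0) (S_continuous S_C0 h0)).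
Qed.

Lemma ae_neq (s : R) : aeP leb (fun r => r != s).
Proof.
exists [set s]; split=> //; first exact: lebesgue_measure_set1.
by move=> r /= /negP; rewrite negbK => /eqP.
Qed.

(** Follow u0 until time s and u afterwards, and displace the final state by
    S (T - s) (z - x), where x is the optimal state at time s.  Up to time s the
    costs agree. *)
Lemma tail_subgradient s u z : t <= s <= T -> control u ->
  Phi (S (T - s) (S (s - t) y + input_map t s u0) + input_map s T u0) + running_cost s T u0
    + dot (z - (S (s - t) y + input_map t s u0)) (costate s)
  <= Phi (S (T - s) z + input_map s T u) + running_cost s T u.
Proof.
move=> /andP[ts sT] gu; have tsT : t <= s <= T by rewrite ts sT.
have st0 : 0 <= s - t by rewrite subr_ge0.
have Ts0 : 0 <= T - s by rewrite subr_ge0.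
have lS := S_linear S_C0 Ts0.
(* the new control keeps the value of u0 at the time s itself, which is negligible *)
have mA : measurable (`]s, +oo[%classic : set (measurableTypeR R)) by exact: measurable_itv.
pose u' r := if r \in (`]s, +oo[%classic : set (measurableTypeR R)) then u r else u0 r.
have gu' : control u' := control_if sep mA gu gu0.
have before : aeP leb (fun r => itv t s r -> u' r = u0 r).
  apply: aeW => r; rewrite /= in_itv/= => /andP[_ rs].
  by rewrite /u' memNset//= in_itv/= andbT ltNge rs.
have after : aeP leb (fun r => itv s T r -> u' r = u r).
  apply: aeS (ae_neq s) => r rs; rewrite /= in_itv/= => /andP[sr _].
  by rewrite /u' mem_set//= in_itv/= andbT lt_def rs.
have split_final v : control v -> final_state v = S (T - s) (S (s - t) y + input_map t s v) + input_map s T v.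
  move=> gv; rewrite /final_state (linearD' _ _ lS) -addrA.
  rewrite -(input_map_split sep S_C0 S_contr B_linear KB_ge0 B_bound M_bound tsT gv).
  by rewrite -(S_add S_C0 _ Ts0 st0) addrA subrK.
have g1 : input_map t s u' = input_map t s u0.
  exact: (input_map_ae sep S_C0 B_linear KB_ge0 B_bound (control_borel gu') (control_borel gu0) before).
have g2 : input_map s T u' = input_map s T u.
  exact: (input_map_ae sep S_C0 B_linear KB_ge0 B_bound (control_borel gu') (control_borel gu) after).
set xs := S (s - t) y + input_map t s u0.
have hh := hp (S (T - s) (z - xs)) gu'.
have eD : dot p (S (T - s) (z - xs)) = dot (z - xs) (costate s) := etrans (dotC _ _) (dot_costate _ sT).
have eJ0 : perturbed_cost u0 0 = Phi (S (T - s) xs + input_map s T u0) + (running_cost t s u0 + running_cost s T u0).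
  exact: (congr2 +%R (congr1 Phi (etrans (addr0 _) (split_final _ gu0))) (running_cost_split tsT gu0)).
have e1 : final_state u' + S (T - s) (z - xs) = S (T - s) z + input_map s T u.
  have e2 : final_state u' = S (T - s) xs + input_map s T u.
    apply: etrans (split_final _ gu') _.
    exact: (congr2 (fun a b => S (T - s) (S (s - t) y + a) + b) g1 g2).
  apply: etrans (congr2 +%R e2 (linearB' z xs lS)) _.
  by move: (S _ xs) (input_map s T u) (S _ z) => a g b; rewrite addrC addrA subrK.
have eJ1 : perturbed_cost u' (S (T - s) (z - xs)) = Phi (S (T - s) z + input_map s T u) + (running_cost t s u0 + running_cost s T u).
  apply: (congr2 +%R (congr1 Phi e1)); apply: etrans (running_cost_split tsT gu') _.
  exact: (congr2 +%R (running_cost_eq gu' gu0 before) (running_cost_eq gu' gu after)).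
exact: (tail_arith eJ0 eJ1 eD hh).
Qed.

Definition hamiltonian (r : R) (w : X) : R := h w + dot (S (Num.max (T - r) 0) (B w)) p.

Lemma integrable_hamiltonian u : control u -> leb.-integrable (itv t T) (EFin \o (fun r => hamiltonian r (u r))).
Proof.
move=> gu; exact: (integrable_addR (mI t T) (integrable_running_cost t T gu) (intp t T T p gu)).
Qed.

(** Displacing the final state of u onto the one of u0 makes the terminal costs
    cancel. *)
Lemma hamiltonian_integral u : control u ->
  \int[leb]_(r in itv t T) hamiltonian r (u0 r) <= \int[leb]_(r in itv t T) hamiltonian r (u r).
Proof.
move=> gu.
have e v : control v -> \int[leb]_(r in itv t T) hamiltonian r (v r) = running_cost t T v + dot (input_map t T v) p.
  move=> gv; apply: etrans (RintegralD (mI t T) (integrable_running_cost t T gv) (intp t T T p gv)) _.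
  exact: (congr2 +%R erefl (esym (dotg t T p gv))).
have hh := hp (input_map t T u0 - input_map t T u) gu.
have eD : dot p (input_map t T u0 - input_map t T u) = dot (input_map t T u0) p - dot (input_map t T u) p.
  exact: etrans (dotC _ _) (dotBl (input_map t T u0) (input_map t T u) p).
have eJ0 : perturbed_cost u0 0 = Phi (final_state u0) + running_cost t T u0 := congr2 +%R (congr1 Phi (addr0 _)) erefl.
have e1 : final_state u + (input_map t T u0 - input_map t T u) = final_state u0.
  by rewrite /final_state; move: (S _ y) (input_map t T u0) (input_map t T u) => a g b; rewrite addrC addrA addrAC subrK addrC.
have eJ1 : perturbed_cost u (input_map t T u0 - input_map t T u) = Phi (final_state u0) + running_cost t T u := congr2 +%R (congr1 Phi e1) erefl.
have := exchange_arith eJ0 eJ1 eD hh.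
by rewrite -(e _ gu0) -(e _ gu).
Qed.

Lemma Rintegral_npos_eq0 (D : set (measurableTypeR R)) (f : R -> R) : measurable D ->
  leb.-integrable D (EFin \o f) -> (forall r, D r -> f r <= 0) ->
  0 <= \int[leb]_(r in D) f r -> aeP leb (fun r => D r -> f r = 0).
Proof.
move=> mD fi f0 If.
have mf := measurable_int _ fi.
have [+ _] := ae_eq_integral_abs leb mD mf.
have -> : (\int[leb]_(x in D) `|(EFin \o f) x| = - \int[leb]_(x in D) (f x)%:E)%E.
  rewrite -integralN; last exact: integrable_add_def.
  by apply: eq_integral => r; rewrite inE => Dr /=; rewrite ler0_norm ?f0.
have fin := integrable_fin_num mD fi.
have Il : (\int[leb]_(x in D) (f x)%:E <= 0)%E.
  by rewrite -[leRHS](integral0 leb D); apply: le_integral => //; [exact: integrable0|move=> r /set_mem Dr; rewrite lee_fin f0].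
have -> : (\int[leb]_(x in D) (f x)%:E = 0)%E.
  by apply/eqP; rewrite eq_le Il /= -(fineK fin) lee_fin.
rewrite oppe0 => /(_ erefl) h0.
by apply: aeS h0 => r hr /hr[].
Qed.

(** Needle variation: switch to v exactly where that decreases the Hamiltonian.
    Optimality then forces this set to be negligible. *)
Lemma hamiltonian_cst v : in_range U v -> aeP leb (fun r => itv t T r -> hamiltonian r (u0 r) <= hamiltonian r v).
Proof.
move=> rv; have gv := control_cst rv.
have iv := integrable_hamiltonian gv; have i0 := integrable_hamiltonian gu0.
pose g r := hamiltonian r v - hamiltonian r (u0 r).
have ig : leb.-integrable (itv t T) (EFin \o g) by exact: integrable_subR.
have mg : measurable_fun (itv t T) g by apply/measurable_EFinP; exact: measurable_int ig.
have mA : measurable (itv t T `&` [set r | g r < 0]).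
  have := mg (mI t T) _ (measurable_itv `]-oo, (0 : R)[).
  by rewrite (_ : g @^-1` `]-oo, 0[ = [set r | g r < 0])//; apply/seteqP; split=> r /=; rewrite in_itv.
pose u r := if r \in itv t T `&` [set r | g r < 0] then v else u0 r.
have gu : control u := control_if sep mA gv gu0.
have iu := integrable_hamiltonian gu.
pose f r := hamiltonian r (u r) - hamiltonian r (u0 r).
have fi : leb.-integrable (itv t T) (EFin \o f) by exact: integrable_subR.
(* the variation changes the Hamiltonian by the negative part of g *)
have fE r : itv t T r -> f r = Num.min (g r) 0.
  move=> rI; rewrite /f /u; case: ifPn => [/set_mem[_ g0]|].
    by apply/esym/min_idPl; exact: ltW.
  rewrite subrr; have [g0|//] := ltP (g r) 0.
  by rewrite mem_set.
have f0 r : itv t T r -> f r <= 0 by move=> /fE ->; rewrite ge_min lexx orbT.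
have If : 0 <= \int[leb]_(r in itv t T) f r.
  by rewrite /f RintegralB// subr_ge0 hamiltonian_integral.
apply: aeS (Rintegral_npos_eq0 (mI t T) fi f0 If) => r hr rI.
have := hr rI; rewrite (fE r rI) => /eqP; rewrite eq_minr /g => g0.
by rewrite -subr_ge0.
Qed.

Lemma hamiltonian_continuous r : continuous (hamiltonian r).
Proof.
have m0 : 0 <= Num.max (T - r) 0 by rewrite le_max lexx orbT.
have cS : continuous (fun w => dot (S (Num.max (T - r) 0) (B w)) p).
  move=> w; apply: (@continuous_comp X X R^o (fun w => S (Num.max (T - r) 0) (B w)) (fun x => dot x p) w).
    apply: (@continuous_comp X X X B _ w (B_continuous B_linear KB_ge0 B_bound (x:=w))).
    exact: (@S_continuous _ _ _ _ S S_C0 _ m0 _).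
  exact: (@dot_continuous _ _ _ _ p _).
exact: (@continuous_add_real R X _ _ (cvx_continuous h_cvx h_lba) cS).
Qed.

(** The exceptional null set of [hamiltonian_cst] depends on v; a countable dense set
    of values has a common one, and the Hamiltonian is continuous. *)
Lemma maximum_principle : aeP leb (fun r => itv t T r ->
  forall w, in_range U w -> hamiltonian r (u0 r) <= hamiltonian r w).
Proof.
have [q hq] := sep.
have := ae_all (fun n => hamiltonian_cst (clip_in_range mu_fin U_gt0 (q n))).
apply: aeS => r hr rI w rw; apply/ler_addgt0Pl => eps eps0.
have [dl dl0 hdl] := (@continuous_atP R X R^o _ w).1 (@hamiltonian_continuous r w) eps eps0.
have [n hn] := hq w dl dl0.
have /hdl : `|w - clip U (q n)| < dl.
  by rewrite -[w in w - _](clip_id mu_fin rw); apply: le_lt_trans hn; exact: clip_lip.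
rewrite distrC ltr_norml => /andP[_ h2].
have := hr n rI; move: h2; move: (hamiltonian _ _) (hamiltonian _ _) (hamiltonian _ _) => a b c; lra.
Qed.

End from_time.
End optimal_control.

(** * Optimality conditions in an abstract setting *)

Section duality.
Context d (E : measurableType d) (R : realType).
Variable mu : {measure set E -> \bar R}.
Local Notation X := (L2 mu).
Variables (U : R) (h0 : R -> R).

Lemma h_ext_in (u : X) : in_range U u -> h_ext U h0 u = (h1 h0 u)%:E.
Proof. by move=> ru; rewrite /h_ext; case: asboolP. Qed.

(** Fenchel: the supremum defining the conjugate at q is attained at u. *)
Lemma subdifferential_conjugate (q u : X) : in_range U u ->
  (forall w, in_range U w -> h1 h0 u - dot q u <= h1 h0 w - dot q w) ->
  subdifferential (conjugate (h_ext U h0)) q u.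
Proof.
move=> ru hu.
have lo q' : ((dot q' u - h1 h0 u)%:E <= conjugate (h_ext U h0) q')%E.
  by apply: ereal_sup_ubound; exists u => //; rewrite h_ext_in.
have e : conjugate (h_ext U h0) q = (dot q u - h1 h0 u)%:E.
  apply/eqP; rewrite eq_le lo andbT; apply: ge_ereal_sup => _ [w _ <-].
  rewrite /h_ext; case: asboolP => [rw|_]; last by rewrite leNye.
  by rewrite -EFinB lee_fin -lerN2 !opprB; exact: hu.
split; first by rewrite e.
move=> q'; rewrite e; have := lo q'; case: (conjugate _ q') => [c| |] //=.
  rewrite !lee_fin dotBl => h; rewrite lerBlDr.
  by move: h; move: (dot q u) (dot q' u) (h1 h0 u) => a a' b; lra.
by move=> _; rewrite leNye.
Qed.

Lemma subdifferential_lower (f : X -> \bar R) (x w : X) (V : R) : (f x <= V%:E)%E ->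
  (forall z, ((V + dot (z - x) w)%:E <= f z)%E) -> subdifferential f x w.
Proof.
move=> fx hf.
have e : f x = V%:E.
  by apply/eqP; rewrite eq_le fx /=; have := hf x; rewrite subrr dot0l addr0.
split; first by rewrite e.
move=> z; rewrite e; have := hf z; rewrite -(opprB x z) dotNl.
case: (f z) => [c| |] //=; last by move=> _; rewrite leNye.
by rewrite !lee_fin; move: (dot _ _) => a; lra.
Qed.

End duality.

(** An interval of positive length is not negligible. *)
Lemma ae_exists (R : realType) (P : R -> Prop) (a b : R) : a < b ->
  aeP (@lebesgue_measure R) P -> exists2 s, a < s < b & P s.
Proof.
move=> ab [N [mN N0 sub]]; apply: contrapT => hn.
have IN : `]a, b[%classic `<=` N.
  move=> s; rewrite /= in_itv/= => hs; apply: sub => /= Ps; apply: hn; by exists s.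
have h0 : (@lebesgue_measure R `]a, b[%classic <= 0)%E.
  rewrite -N0; apply: le_measure => //; rewrite inE; [exact: measurable_itv|exact: mN].
move: h0; rewrite lebesgue_measure_itv/= lte_fin ab -EFinB lee_fin.
by rewrite subr_le0 leNgt ab.
Qed.

Lemma eq_imp_le (disp : Order.disp_t) (T : porderType disp) (a b : T) : b = a -> (a <= b)%O.
Proof. by move=> ->. Qed.

Section abstract.
Context d (E : measurableType d) (R : realType).
Variable mu : {measure set E -> \bar R}.
Local Notation X := (L2 mu).
Local Notation leb := (@lebesgue_measure R).
Hypothesis mu_fin : (mu setT < +oo)%E.
Hypothesis sep : exists q : nat -> X, forall x (eps : R), 0 < eps ->
  exists n, `|x - q n| < eps.
Variables (T U : R) (S : R -> X -> X) (B : X -> X) (KB : R).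
Hypotheses (U_gt0 : 0 < U) (S_C0 : C0_semigroup S)
  (S_contr : forall t x, 0 <= t -> `|S t x| <= `|x|)
  (S_nonneg : forall t x, 0 <= t -> L2_nonneg x -> L2_nonneg (S t x))
  (B_linear : linear B) (KB_ge0 : 0 <= KB) (B_bound : forall x, `|B x| <= KB * `|x|)
  (B_nonneg : forall x, L2_nonneg x -> L2_nonneg (B x)).
Variables (phi0 h0 : R -> R).
Hypotheses
  (phi0_integrable : forall x : X, mu.-integrable setT (fun xi => (phi0 (x xi))%:E))
  (h0_integrable : forall x : X, mu.-integrable setT (fun xi => (h0 (x xi))%:E))
  (h0_convex : forall (a b s : R), 0 <= s <= 1 ->
    h0 (s * a + (1 - s) * b) <= s * h0 a + (1 - s) * h0 b)
  (phi0_concave : forall (a b s : R), 0 <= s <= 1 ->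
    - phi0 (s * a + (1 - s) * b) <= s * - phi0 a + (1 - s) * - phi0 b).
Local Notation control := (control U).
Local Notation itv t s := (`[t, s]%classic : set (measurableTypeR R)).
Local Notation H := (h1 (mu := mu) h0).
Local Notation Phi := (phi (mu := mu) phi0).

Let mI a b : measurable (itv a b). Proof. exact: measurable_itv. Qed.

Let Nphi0_integrable (x : X) : mu.-integrable setT (fun xi => (- phi0 (x xi))%:E).
Proof.
have -> : (fun xi => (- phi0 (x xi))%:E) = EFin \o (fun xi => -1 * phi0 (x xi)).
  by apply/funext => xi /=; rewrite mulN1r.
exact: (integrable_scaleR measurableT (-1) (phi0_integrable x)).
Qed.

Let PhiE : Phi = int_fun (fun r => - phi0 r).
Proof.
apply/funext => x; rewrite /phi /int_fun -mulN1r -(RintegralZl (-1) measurableT (phi0_integrable x)).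
by apply: eq_Rintegral => xi _; rewrite mulN1r.
Qed.

Let Phi_cvx : cvx Phi. Proof. by rewrite PhiE; exact: (int_fun_cvx phi0_concave Nphi0_integrable). Qed.
Let Phi_lba : locally_bounded_above Phi.
Proof. by rewrite PhiE; exact: (int_fun_locally_bounded phi0_concave Nphi0_integrable). Qed.
Let H_cvx : cvx H. Proof. exact: (int_fun_cvx h0_convex h0_integrable). Qed.
Let H_lba : locally_bounded_above H. Proof. exact: (int_fun_locally_bounded h0_convex h0_integrable). Qed.

Let M_ex : exists2 M, 0 <= M & forall x : X, in_range U x -> `|x| <= M.
Proof. exact: in_range_norm. Qed.

(** From below by an affine minorant, since the range is bounded in norm; from above
    pointwise, since a convex function on [0, U] is bounded by its values at 0 and U. *)
Lemma h1_bound : exists K, forall x, in_range U x -> `|H x| <= K.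
Proof.
have [M M0 hM] := M_ex.
have [K K0 hK] := cvx_affine_minorant H_cvx H_lba.
pose c := `|h0 0| + `|h0 U|.
exists (`|H 0| + K * M + c * fine (mu setT)) => x rx.
have c0 : 0 <= c * fine (mu setT) by rewrite mulr_ge0 ?addr_ge0 ?fine_ge0.
have KM : 0 <= K * M by rewrite mulr_ge0.
rewrite ler_norml; apply/andP; split.
  apply: le_trans (hK x).
  have h2 : K * `|x| <= K * M by rewrite ler_wpM2l ?hM.
  have := ler_norm (- H 0); rewrite normrN.
  by move: h2 c0; move: (K * `|x|) (K * M) (c * _) (H 0) `|H 0| => a b e f g; lra.
have up : H x <= c * fine (mu setT).
  rewrite -(Rintegral_cst mu)//; apply: ae_le_Rintegral; [exact: h0_integrable|exact: integrable_cst|].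
  by apply: aeS rx => xi h; apply: psi_max.
apply: le_trans up _; rewrite lerDr addr_ge0//.
Qed.

Lemma adm_rep t y (u : R -> X) : t <= T -> admissible T U S B t y u ->
  exists2 u', control u' & aeP leb (fun r => itv t T r -> u r = u' r).
Proof.
move=> tT [bu hu]; apply: (control_rep mu_fin U_gt0 (mI t T) bu).
by apply: aeS hu => r hr rI; exact: (hr rI).1.
Qed.

Let sub_itv t s : s <= T -> itv t s `<=` itv t T.
Proof. by move=> sT r; rewrite /= !in_itv/= => /andP[-> rs]; exact: le_trans sT. Qed.

Lemma mild_rep t y (u u' : R -> X) s : s <= T -> borel_fun (itv t T) u -> control u' ->
  aeP leb (fun r => itv t T r -> u r = u' r) ->
  mild S B t y u s = S (s - t) y + input_map S B t s u'.
Proof.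
move=> sT bu gu' uu'.
have bs : borel_fun (itv t s) u := measurable_funS (mI t T) (sub_itv sT) bu.
apply: etrans (mildE sep S_C0 B_linear KB_ge0 B_bound y bs) _.
have ae' : aeP leb (fun r => itv t s r -> u r = u' r).
  by apply: aeS uu' => r h rI; apply: h; exact: sub_itv rI.
exact: (congr1 (fun g => S (s - t) y + g)
  (input_map_ae sep S_C0 B_linear KB_ge0 B_bound bs (control_borel gu') ae')).
Qed.

(** The range is the set of fixed points of the continuous map [clip]. *)
Lemma h_ext_measurable t s (u : R -> X) : borel_fun (itv t s) u ->
  measurable_fun (itv t s) (fun r => h_ext U h0 (u r)).
Proof.
move=> bu.
have -> : (fun r : R => h_ext U h0 (u r)) =
    (fun r => if `|clip U (u r) - u r| <= 0 then (H (u r))%:E else +oo%E).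
  apply/funext => r; rewrite /h_ext; case: asboolP => [ru|nu].
    by rewrite (clip_id mu_fin ru) subrr normr0 lexx.
  case: ifP => // h; case: nu; have <- : clip U (u r) = u r.
    by apply/eqP; rewrite -subr_eq0 -normr_le0.
  exact: (clip_in_range mu_fin U_gt0).
have cc : continuous (fun x : X => `|clip U x - x|).
  move=> x; apply/(@continuous_atP R X R^o) => eps eps0; exists (eps / 2); first by rewrite divr_gt0.
  move=> y xy; apply: le_lt_trans (ler_dist_dist _ _) _.
  have -> : clip U x - x - (clip U y - y) = (clip U x - clip U y) - (x - y).
    move: (clip U x) (clip U y) => a b; rewrite !opprB -!addrA; congr (_ + _).
    by rewrite addrCA [RHS]addrCA; congr (_ + _); rewrite addrC.
  apply: le_lt_trans (ler_normB _ _) _; rewrite [ltRHS]splitr; apply: ltrD => //.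
  by apply: le_lt_trans xy; exact: clip_lip.
have mH : measurable_fun (itv t s) (fun r => H (u r)).
  exact: (borel_compR (mI t s) bu (cvx_continuous H_cvx H_lba)).
apply: measurable_fun_if => //.
- by apply: measurable_fun_ler => //; exact: (borel_compR (mI t s) bu cc).
- by apply/measurable_EFinP; apply: measurable_funS mH => // r [].
Qed.

Lemma cost_rep t y (u u' : R -> X) : t <= T -> borel_fun (itv t T) u -> control u' ->
  aeP leb (fun r => itv t T r -> u r = u' r) ->
  cost T U S B phi0 h0 t y u =
    (Phi (S (T - t) y + input_map S B t T u') + running_cost H t T u')%:E.
Proof.
move=> tT bu gu' uu'; rewrite /cost (mild_rep y (lexx T) bu gu' uu') EFinD.
have [K hK] := h1_bound.
have ir := integrable_running_cost H_cvx H_lba hK t T gu'.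
suff -> : (\int[leb]_(s in `[t, T]) h_ext U h0 (u s))%E = (running_cost H t T u')%:E by [].
rewrite /running_cost /Rintegral fineK; last exact: (integrable_fin_num (mI t T) ir).
apply: (ae_eq_integral _ _ (mI t T)).
- exact: h_ext_measurable.
- exact: measurable_int ir.
- by apply: aeS uu' => r h rI; rewrite /= h// h_ext_in//; exact: gu'.2.
Qed.

Lemma control_admissible t y (u : R -> X) : control u -> L2_nonneg y -> admissible T U S B t y u.
Proof.
move=> gu y0; split; first exact: (control_borel gu).
apply: aeW => s; rewrite in_itv/= => /andP[ts sT]; split; first exact: gu.2.
have e := mildE sep S_C0 B_linear KB_ge0 B_bound y (control_borel (D := itv t s) gu).
rewrite e.
have gn : L2_nonneg (input_map S B t s u).
  by have [M M0 hM] := M_ex; exact: (input_map_nonneg mu_fin sep S_C0 S_contr S_nonneg B_linear KB_ge0 B_bound B_nonneg hM t s gu).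
have Sn : L2_nonneg (S (s - t) y) by apply: S_nonneg => //; rewrite subr_ge0.
by apply: aeS3 gn Sn (L2_addE (S (s - t) y) (input_map S B t s u)) => xi a b ->; exact: addr_ge0.
Qed.

(** The trajectory is nonnegative at times arbitrarily close to t and tends to y. *)
Lemma initial_nonneg t y (u : R -> X) : t < T -> admissible T U S B t y u -> L2_nonneg y.
Proof.
move=> tT adm; have [bu hu] := adm.
have [u' gu' uu'] := adm_rep (ltW tT) adm.
have [M M0 hM] := M_ex.
have [K K0 hK] := input_map_bound sep S_C0 S_contr B_linear KB_ge0 B_bound M0 hM.
apply/(negpart_nonneg mu_fin); apply/eqP; rewrite -normr_le0; apply/ler_addgt0Pl => eps eps0.
rewrite addr0; have e2 : 0 < eps / 2 by rewrite divr_gt0.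
have [dl dl0 hdl] := S_right0 S_C0 y e2.
have K1 : 0 < K + 1 by rewrite ltr_wpDl.
pose b := t + Num.min (T - t) (Num.min dl (eps / 2 / (K + 1))).
have tb : t < b by rewrite ltrDl !lt_min subr_gt0 tT dl0 divr_gt0.
have [s /andP[ts sb] hs] := ae_exists tb hu.
have st : s - t < Num.min (T - t) (Num.min dl (eps / 2 / (K + 1))) by rewrite ltrBlDl.
move: st; rewrite !lt_min => /andP[sT /andP[sdl sK]].
have sT' : s <= T by rewrite ltW// -(ltrD2r (- t)).
have sI : s \in `[t, T] by rewrite in_itv/= ltW.
have [_ xs0] := hs sI.
set x := mild S B t y u s in xs0.
have xE : x = S (s - t) y + input_map S B t s u' := mild_rep y sT' bu gu' uu'.
have nx : negpart x = 0 by apply/(negpart_nonneg mu_fin).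
have -> : negpart y = negpart y - negpart x by rewrite nx subr0.
apply: le_trans (L2_map_lip mu_fin y x (lip1_min0 (R := R))) _.
rewrite distrC xE addrAC; apply: le_trans (ler_normD _ _) _; rewrite [leRHS]splitr; apply: lerD.
  by apply/ltW/hdl; rewrite subr_ge0 ltW.
apply: le_trans (hK _ _ _ (ltW ts) gu') _.
apply: (@le_trans _ _ ((s - t) * (K + 1))); first by rewrite ler_wpM2l ?lerDl// subr_ge0 ltW.
by rewrite -ler_pdivlMr// ltW.
Qed.

(** When t = T the conclusion concerns a negligible set of times.  Otherwise the
    constraint x >= 0 holds for all controls, the optimal one minimizes over all of
    them, and [tail_subgradient] and [maximum_principle] give the two inclusions. *)
Theorem optimality (t : R) (y : X) (x_opt u_opt : R -> X) : t <= T ->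
  optimal_pair T U S B phi0 h0 t y x_opt u_opt ->
  aeP leb (fun s => s \in `[t, T] ->
    exists2 eta, subdifferential (value T U S B phi0 h0 s) (x_opt s) eta &
      subdifferential (conjugate (h_ext U h0)) (- adjoint B eta) (u_opt s)).
Proof.
rewrite le_eqVlt => /predU1P[->|tT].
  move=> _; apply: aeS (ae_neq T) => s sT; rewrite in_itv/= => /andP[s1 s2].
  by case/negP: sT; rewrite eq_le s1 s2.
have tT' := ltW tT.
move=> [adm opt x_optE]; have bu := adm.1.
have y0 := initial_nonneg tT adm.
have [u0 gu0 uu0] := adm_rep tT' adm.
have [M M0 hM] := M_ex; have [Kh hKh] := h1_bound.
have u0_opt u : control u -> perturbed_cost T S B Phi H t y u0 0 <= perturbed_cost T S B Phi H t y u 0.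
  move=> gu; have au := control_admissible t gu y0.
  have e0 := cost_rep y tT' bu gu0 uu0.
  have e1 := cost_rep y tT' au.1 gu (aeW leb (fun r _ => erefl)).
  have le1 : (cost T U S B phi0 h0 t y u_opt <= cost T U S B phi0 h0 t y u)%E.
    by rewrite opt; apply: ereal_inf_lbound; exists u.
  have J0 v : perturbed_cost T S B Phi H t y v 0 = Phi (S (T - t) y + input_map S B t T v) + running_cost H t T v.
    exact: (congr1 (fun x => Phi x + running_cost H t T v) (addr0 _)).
  have le2 : ((Phi (S (T - t) y + input_map S B t T u0) + running_cost H t T u0)%:E <=
      (Phi (S (T - t) y + input_map S B t T u) + running_cost H t T u)%:E)%E.
    exact: (le_trans (eq_imp_le e0) (le_trans le1 (eq_imp_le (esym e1)))).
  rewrite lee_fin in le2.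
  exact: (le_trans (eq_imp_le (esym (J0 u0))) (le_trans le2 (eq_imp_le (J0 u)))).
have [p hp] := optimal_subgradient sep S_C0 S_contr B_linear KB_ge0 B_bound M0 hM
  Phi_cvx Phi_lba H_cvx H_lba hKh tT' gu0 u0_opt.
have mp := maximum_principle mu_fin sep U_gt0 S_C0 S_contr B_linear KB_ge0 B_bound hM
  H_cvx H_lba hKh gu0 hp.
have uu := uu0; apply: aeS3 uu mp adm.2 => s us ms as' sI.
have sI' : itv t T s by exact: sI.
have /andP[ts sT] : t <= s <= T by move: sI; rewrite in_itv.
have us' := us sI'; have ms' := ms sI'.
have xE : x_opt s = S (s - t) y + input_map S B t s u0.
  exact: (etrans (x_optE s sI) (mild_rep y sT bu gu0 uu0)).
have xs0 : L2_nonneg (x_opt s) by rewrite (x_optE s sI); exact: (as' sI).2.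
have B_cont := B_continuous B_linear KB_ge0 B_bound.
exists (costate T S p s).
  pose V := Phi (S (T - s) (x_opt s) + input_map S B s T u0) + running_cost H s T u0.
  apply: (@subdifferential_lower _ _ _ _ _ _ _ V).
    have au := control_admissible s gu0 xs0.
    have -> : V%:E = cost T U S B phi0 h0 s (x_opt s) u0.
      exact: (esym (cost_rep (x_opt s) sT au.1 gu0 (aeW leb (fun r _ => erefl)))).
    by apply: ereal_inf_lbound; exists u0.
  move=> z; apply: le_ereal_inf_tmp => _ [u au <-].
  have [u' gu' uu'] := adm_rep sT au.
  rewrite (cost_rep z sT au.1 gu' uu') lee_fin /V xE.
  have tsT : t <= s <= T by rewrite ts.
  exact: (tail_subgradient sep S_C0 S_contr B_linear KB_ge0 B_bound hM
    H_cvx H_lba hKh gu0 hp z tsT gu').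
apply: subdifferential_conjugate; first by rewrite us'; exact: gu0.2.
move=> w rw; have := ms' w rw; rewrite -us' /hamiltonian.
have -> : Num.max (T - s) 0 = T - s by apply/max_idPl; rewrite subr_ge0.
have e v : dot (S (T - s) (B v)) p = - dot (- adjoint B (costate T S p s)) v.
  by rewrite (dot_costate S_C0 p (B v) sT) (dot_adjoint v _ B_linear B_cont) dotNl opprK dotC.
by rewrite !e.
Qed.

End abstract.

(** * The control problem on the domain *)

Theorem proposition9 (R : realType)
    (T rho U : R) (T_gt0 : 0 < T) (rho_gt0 : 0 < rho) (U_gt0 : 0 < U)
    (Xi : set (R * R)) (Xi_open : open Xi) (Xi_bounded : bounded_set Xi)
    (Xi_regular : regular_boundary Xi)
    (S : R -> L2 (domain_measure Xi_open) -> L2 (domain_measure Xi_open))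
    (S_semigroup : neumann_semigroup rho S)
    (b : R * R -> R) (b_ge0 : forall xi, Xi xi -> 0 <= b xi)
    (b_bounded : exists M, forall xi, Xi xi -> b xi <= M)
    (b_measurable : measurable_fun (Xi : set (plane R)) b)
    (phi0 h0 : R -> R)
    (phi0_integrable : forall x : L2 (domain_measure Xi_open),
      (domain_measure Xi_open).-integrable setT (fun xi => (phi0 (x xi))%:E))
    (h0_integrable : forall u : L2 (domain_measure Xi_open),
      (domain_measure Xi_open).-integrable setT (fun xi => (h0 (u xi))%:E))
    (h0_convex : convex_function [set: R^o] h0)
    (h0_lsc : lower_semicontinuous (fun r : R => (h0 r)%:E))
    (phi0_continuous : continuous phi0)
    (phi0_concave : convex_function [set: R^o] (fun r => - phi0 r))
    (t : R) (t_in : t \in `[0, T]) (y : L2 (domain_measure Xi_open))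
    (x_opt u_opt : R -> L2 (domain_measure Xi_open))
    (opt : optimal_pair T U S (mult_op Xi_open b) phi0 h0 t y x_opt u_opt) :
  \forall s \ae @lebesgue_measure R, s \in `[t, T] ->
    exists2 eta,
      subdifferential (value T U S (mult_op Xi_open b) phi0 h0 s) (x_opt s) eta &
      subdifferential (conjugate (h_ext U h0))
        (- adjoint (mult_op Xi_open b) eta) (u_opt s).
Proof.
have sep := L2_separable Xi_open Xi_bounded.
have mfin := mu_fin Xi_open Xi_bounded.
have [S_C0 S_gen] := S_semigroup.
have S_contr s (x : L2 (domain_measure Xi_open)) : 0 <= s -> `|S s x| <= `|x|.
  move=> s0; apply: (semigroup_contraction sep S_C0 x _ s0) => v w /S_gen.
  exact: (neumann_dissipative (ltW rho_gt0)).
have S_nonneg s (x : L2 (domain_measure Xi_open)) : 0 <= s -> L2_nonneg x -> L2_nonneg (S s x).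
  move=> s0; apply: (semigroup_nonneg sep S_C0 mfin _ s0) => v w /S_gen.
  exact: (neumann_negpart Xi_bounded (ltW rho_gt0)).
have [M hM] := b_bounded.
have mb : measurable_fun setT ((b \_ Xi) : plane R -> R).
  by apply/(measurable_restrictT _ (mXi Xi_open)).
have bM (xi : plane R) : `|(b \_ Xi) xi| <= `|M|.
  rewrite patchE; case: ifPn => [/set_mem Xx|_]; last by rewrite normr0.
  by rewrite ger0_norm ?b_ge0// (le_trans (hM _ Xx))// ler_norm.
have B_linear : linear (mult_op Xi_open b) := L2_mul_linear mb bM.
have B_bound (x : L2 (domain_measure Xi_open)) : `|mult_op Xi_open b x| <= `|M| * `|x|.
  exact: (L2_mul_norm mb bM).
have B_nonneg (x : L2 (domain_measure Xi_open)) : L2_nonneg x -> L2_nonneg (mult_op Xi_open b x).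
  move=> x0; apply: aeS2 x0 (L2_mulE mb bM x) => xi x0 e.
  rewrite /mult_op e mulr_ge0// patchE; case: ifPn => // /set_mem; exact: b_ge0.
have tT : t <= T by move: t_in; rewrite in_itv => /andP[].
exact: (optimality mfin sep U_gt0 S_C0 S_contr S_nonneg B_linear (normr_ge0 M) B_bound B_nonneg
  phi0_integrable h0_integrable (convex_functionP h0_convex) (convex_functionP phi0_concave) tT opt).
Qed.
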